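(* Let $X$ be a singular complex analytic vector field on a connected Riemann surface $M$. The following statements are equivalent. 1) There exists an incomplete trajectory $z({\tt t})$ of $X$ having $\alpha$- or $\omega$-limit at $z_{\tt s}\in M$. 2) There exists a finite singular value $a\in\mathbb{C}_t$ of $\Psi_X$, whose asymptotic path $\alpha_a({\tt t})$ is a trajectory of $\mathfrak{Re}(X)$ ending at $z_{\tt s}\in M$.
   Context: **Setting.** $M$ is a connected, not necessarily compact, Riemann surface; conformal punctures of $M$ are regarded as points of $M$. $\widehat{\mathbb{C}}_t$ is the Riemann sphere with coordinate $t$. *Singular complex analytic* means analytic away from singularities, which may be zeros, poles, essential singularities and accumulation points of these. A singular complex analytic vector field $X=f(z)\frac{\partial}{\partial z}\not\equiv 0$ has 1-form of time $\omega_X=dz/f(z)$ and associated function $\Psi_X(z)=\int_{z_{\tt o}}^z\omega_X$ (possibly multivalued, defined up to an additive constant, $z_{\tt o}$ nonsingular). The singular set $\mathcal{S}$ of $X$ is the union of the zeros of $X$ with zero residue ($\mathcal{Z}_0$) and nonzero residue ($\mathcal{Z}_R$), poles $\mathcal{P}$, and essential singularities $\mathbb{E}$ (possibly nonisolated); residues are those of $\omega_X$. $\mathbb{E}_R\subset\mathbb{E}$ are the essential singularities with well defined nonzero residue, and $\mathcal{S}_R=\mathcal{Z}_R\cup\mathbb{E}_R$ is assumed at most countable. $\Psi_X$ is defined on $M\backslash(\mathbb{E}\cup\mathcal{Z}_R)$. **Trajectories.** A maximal real trajectory of $X$ (equivalently of the real vector field $\mathfrak{Re}(X)$) is a maximal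 solution $z({\tt t}):(a,b)\subseteq\mathbb{R}\to M\backslash(\mathcal{P}\cup\mathbb{E})$ of $dz/d{\tt t}=f(z({\tt t}))$. It is *incomplete* if its maximal domain is a strict subset of $\mathbb{R}$. **Singular values.** A $C^1$ path $\alpha_a:[0,\infty)\to M$, with $\alpha_a(0)=z_{\tt o}\in M\backslash\mathcal{S}$, tending to $z_{\tt s}\in\mathcal{S}$ with well defined slope and with $a=\lim_{{\tt t}\to\infty}\int_{\alpha_a({\tt t})}\omega_X\in\widehat{\mathbb{C}}_t$ is called an asymptotic path with value $a$. A *singular value* $a$ of $\Psi_X$ is a critical value (the path arrives at a critical point $z_{\tt s}$ of $\Psi_X$: $\Psi_X(z_{\tt s})=a\in\mathbb{C}$ with $\Psi_X'(z_{\tt s})=0$, or $a=\infty$ with $z_{\tt s}$ a multiple pole of $\Psi_X$) or an asymptotic value (the path defines a transcendental singularity: for $D(a,\rho)$ the spherical disk, the nested components $U_a(\rho)$ of $\Psi_X^{-1}(D(a,\rho))$ eventually containing $\alpha_a$ have empty intersection over $\rho>0$). By a slight abuse, in the case of a critical value the path arriving at the critical point is also called asymptotic path. When $\Psi_X$ is multivalued, these notions refer to a single-valued restriction $\Psi_{X,\Lambda}$ to a fundamental domain $\Lambda$: cut $M$ along a chain of simple paths $\gamma_k$ joining consecutive points of $\mathcal{S}_R=\{z_1,z_2,\dots\}$, avoiding other singular points and meeting only at common endpoints, with connected open complement of the closure of their union; then, if $M$ is not $\widehat{\mathbb{C}}$ or the disk, cut also along simple closed paths in $M\backslash\mathcal{S}$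 representing generators of the fundamental group of the resulting surface; of each cut, only one of the two boundary copies is retained. With $\mathcal{R}_X=\{(z,t):t=\Psi_X(z)\}\subset M\times\widehat{\mathbb{C}}_t$, projections $\pi_1,\pi_2$, and $\Omega=\{(z,\Psi_{X,\Lambda}(z)):z\in\Lambda\backslash\mathbb{E}\}$, the sets $U_a(\rho)$ are then $\pi_1|_\Omega$ of the component of $\pi_2^{-1}(D(a,\rho))\subset\mathcal{R}_X$ determined by $\alpha_a$.
   Formalization: The α- or ω-limit at z_s is required at an end of the trajectory reached in finite time, and the ''well defined slope'' of an asymptotic path is measured in the flat coordinate t = Ψ_X(z) rather than as a tangent direction at z_s; with the literal readings the equivalence is false. *)

(* Defs.v *)
From HB Require Import structures.
From mathcomp Require Export all_boot all_order all_algebra.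
From mathcomp Require Export all_classical all_reals all_analysis.
From mathcomp Require Export complex.

Set Implicit Arguments.
Unset Strict Implicit.
Unset Printing Implicit Defensive.

Import Order.TTheory GRing.Theory Num.Theory.
Import numFieldNormedType.Exports.

Local Open Scope classical_set_scope.
Local Open Scope ring_scope.
Local Open Scope complex_scope.

(* R[i] as a normed module over itself: [is_derive] and [derivable] in the
   direction 1 are complex differentiation. *)
Notation cplx R := ((complex R)^o).

(* The Riemann sphere; [None] is the point at infinity. *)
Notation sphere R := (one_point_compactification (cplx R)).

(* The inverse charts are total functions; only their values on the image of
   the corresponding chart matter. *)
Record riemann_surface (R : realType) := RiemannSurface {
  surface :> topologicalType;
  chart_index : Type;
  chart_dom : chart_index -> set surface;
  chart : chart_index -> surface -> cplx R;
  chart_inv : chart_index -> cplx R -> surface;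
  chart_at : surface -> chart_index;
  surface_hausdorff : hausdorff_space surface;
  surface_nonempty : [set: surface] !=set0;
  surface_connected : connected [set: surface];
  chart_at_dom : forall p, chart_dom (chart_at p) p;
  chart_dom_open : forall i, open (chart_dom i);
  chart_image_open : forall i, open (chart i @` chart_dom i);
  chartK : forall i p, chart_dom i p -> chart_inv i (chart i p) = p;
  chart_continuous : forall i p, chart_dom i p -> {for p, continuous (chart i)};
  chart_inv_continuous : forall i p, chart_dom i p ->
    {for chart i p, continuous (chart_inv i)};
  chart_transition : forall i j p, chart_dom i p -> chart_dom j p ->
    derivable (chart j \o chart_inv i : cplx R -> cplx R) (chart i p) 1
}.

Section Surface.
Context {R : realType} (M : riemann_surface R).
Implicit Types (i j : chart_index M) (p q : M).

Definition is_chart_derive i (g : M -> cplx R) p (d : cplx R) : Prop :=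
  is_derive (chart i p : cplx R) (1 : cplx R) (g \o chart_inv i) d.

Definition holomorphic_at (g : M -> cplx R) p : Prop :=
  derivable (g \o chart_inv (chart_at p) : cplx R -> cplx R)
    (chart (chart_at p) p) 1.

Definition conformal_to_disc : Prop :=
  exists g : M -> cplx R,
    [/\ injective g, range g = [set w | `|w| < 1] &
        forall p, holomorphic_at g p].

Definition conformal_to_sphere : Prop :=
  exists (F : M -> sphere R) (G : sphere R -> M),
    [/\ cancel F G, cancel G F, continuous F, continuous G &
        forall p, F p <> None ->
          exists g : M -> cplx R,
            (\forall q \near p, F q = Some (g q)) /\ holomorphic_at g p].

End Surface.

Arguments conformal_to_disc {R} M.
Arguments conformal_to_sphere {R} M.

(* [field_comp i] is the component f of X = f d/dz in the chart i; it is
   meaningful on [field_dom], the set where X is analytic (zeros included). *)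
Record vector_field (R : realType) (M : riemann_surface R) := VectorField {
  field_dom : set M;
  field_comp : chart_index M -> M -> cplx R;
  field_dom_open : open field_dom;
  field_comp_holomorphic : forall i p, field_dom p -> chart_dom i p ->
    derivable (field_comp i \o chart_inv i : cplx R -> cplx R) (chart i p) 1;
  field_comp_change : forall i j p,
    field_dom p -> chart_dom i p -> chart_dom j p ->
    field_comp j p =
    'D_1 (chart j \o chart_inv i : cplx R -> cplx R) (chart i p) * field_comp i p
}.

Section Singularities.
Context {R : realType} (M : riemann_surface R) (X : vector_field M).
Implicit Types (i : chart_index M) (p q : M).

Definition zeros : set M :=
  [set p | field_dom X p /\ field_comp X (chart_at p) p = 0].

Definition isolated_singularity p : Prop :=
  ~ field_dom X p /\ \forall q \near p^', field_dom X q.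

Definition removable p : Prop :=
  isolated_singularity p /\
  exists g : M -> cplx R,
    (\forall q \near p, holomorphic_at g q) /\
    (\forall q \near p^', field_comp X (chart_at p) q = g q).

Definition poles : set M := [set p |
  isolated_singularity p /\
  exists (n : nat) (g : M -> cplx R),
    [/\ (0 < n)%N, g p != 0,
        \forall q \near p, chart_dom (chart_at p) q /\
          derivable (g \o chart_inv (chart_at p) : cplx R -> cplx R)
            (chart (chart_at p) q) 1 &
        \forall q \near p^', field_comp X (chart_at p) q =
          g q / (chart (chart_at p) q - chart (chart_at p) p) ^+ n]].

Definition essential : set M := ~` (field_dom X `|` poles).

Definition isolated_essential : set M := essential `&` isolated_singularity.

Definition singular_set : set M := zeros `|` poles `|` essential.

End Singularities.

(* The last condition is X != 0; it is imposed locally because the set of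
   essential singularities may disconnect the surface. *)
Record singular_vector_field (R : realType) (M : riemann_surface R) :=
  SingularVectorField {
  field :> vector_field M;
  field_no_removable : forall p : M, ~ removable field p;
  field_essential : essential field `<=`
    isolated_essential field `|`
    closure (zeros field `|` poles field `|` isolated_essential field);
  field_nonzero : forall V : set M, open V -> V !=set0 ->
    V `<=` field_dom field -> ~ (V `<=` zeros field)
}.

Section Time.
Context {R : realType} {M : riemann_surface R} (X : vector_field M).
Implicit Types (i : chart_index M) (p q : M).

(* Coefficient of the 1-form of time in a chart; it is analytic, with value 0,
   at the poles of X, and meaningless at zeros and essential singularities. *)
Definition omega i p : cplx R :=
  if `[< field_dom X p >] then (field_comp X i p)^-1 else 0.

Definition cintegral (a b : R) (h : R -> cplx R) : cplx R :=
  (\int[@lebesgue_measure R]_(t in `[a, b]) complex.Re (h t)) +i*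
  (\int[@lebesgue_measure R]_(t in `[a, b]) complex.Im (h t)).

Definition expi (t : R) : cplx R := cos t +i* sin t.

Definition chart_circle i p (r t : R) : M :=
  chart_inv i (chart i p + r%:C * expi t).

Definition circle_avoids i p (r : R) : Prop :=
  forall t, ~ (zeros X `|` essential X) (chart_circle i p r t).

Definition circle_integral i p (r : R) : cplx R :=
  cintegral 0 (2 * pi)
    (fun t => omega i (chart_circle i p r t) * ('i * r%:C * expi t)).

(* At an isolated singularity of the 1-form of time this is the usual residue.
   At a nonisolated one the residue is well defined when the integrals over
   all small circles missing the singularities agree. *)
Definition has_residue p (c : cplx R) : Prop :=
  forall i, chart_dom i p -> exists r0 : R,
    [/\ 0 < r0,
        forall w : cplx R, `|w - chart i p| < r0%:C ->
          (chart i @` chart_dom i) w,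
        forall e : R, 0 < e -> exists r, [/\ 0 < r, r < e & circle_avoids i p r] &
        forall r, 0 < r -> r < r0 -> circle_avoids i p r ->
          circle_integral i p r = 2 * pi%:C * 'i * c].

Definition residual : set M := [set p | exists2 c, c != 0 & has_residue p c].

Definition zeros_R : set M := zeros X `&` residual.

Definition essential_R : set M := essential X `&` residual.

Definition singular_R : set M := zeros_R `|` essential_R.

Definition psi_dom : set M := ~` (essential X `|` zeros_R).

(* Single-valued branches on V of Psi = \int omega; the poles of a branch are
   the zeros of X with zero residue. *)
Definition branch (V : set M) (Psi : M -> sphere R) : Prop :=
  [/\ open V, V `<=` psi_dom &
      forall p, V p ->
        [/\ {for p, continuous Psi},
            zeros X p -> Psi p = None &
            ~ zeros X p -> exists g : M -> cplx R,
              (\forall q \near p, Psi q = Some (g q)) /\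
              is_chart_derive (chart_at p) g p (omega (chart_at p) p)]].

Definition unit_interval : set R := [set s | 0 <= s <= 1].

(* tau is the value of the continuation of a branch of Psi along c, i.e.
   s |-> (c s, tau s) is a path in the Riemann surface R_X of Psi. *)
Definition continuation (c : R -> M) (tau : R -> sphere R) : Prop :=
  {within unit_interval, continuous c} /\
  forall s, unit_interval s -> exists (V : set M) (Psi : M -> sphere R),
    [/\ branch V Psi, V (c s) &
        \forall u \near s, unit_interval u -> tau u = Psi (c u)].

(* Two points of R_X lie in the same component of the preimage of D under the
   projection to the sphere; R_X carries its topology of a Riemann surface
   (not that of a subset of the product, in which distinct sheets may
   accumulate on each other), so components are path components. *)
Definition same_component (D : set (sphere R)) (x y : M * sphere R) : Prop :=
  exists (c : R -> M) (tau : R -> sphere R),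
    [/\ continuation c tau, (c 0, tau 0) = x, (c 1, tau 1) = y &
        forall s, unit_interval s -> D (tau s)].

End Time.

Section SphericalDisc.
Context {R : realType}.
Implicit Types x y : sphere R.

Definition modulus (z : cplx R) : R := complex.Re `|z|.

(* Chordal form of the spherical metric; its discs are those of the geodesic
   distance, up to the parametrization of the radius. *)
Definition chordal x y : R :=
  match x, y with
  | Some z, Some w => 2 * modulus (z - w) /
      (Num.sqrt (1 + modulus z ^+ 2) * Num.sqrt (1 + modulus w ^+ 2))
  | Some z, None | None, Some z => 2 / Num.sqrt (1 + modulus z ^+ 2)
  | None, None => 0
  end.

Definition spherical_disc x (rho : R) : set (sphere R) :=
  [set y | chordal x y < rho].

End SphericalDisc.

Section FundamentalDomain.
Context {R : realType} {M : riemann_surface R} (X : vector_field M).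

Definition trace (c : R -> M) : set M := c @` unit_interval.

Definition simple_path (c : R -> M) : Prop :=
  {within unit_interval, continuous c} /\ {in unit_interval &, injective c}.

Definition loop_in (N : set M) (b : M) (c : R -> M) : Prop :=
  [/\ {within unit_interval, continuous c}, c 0 = b, c 1 = b &
      trace c `<=` N].

Definition simple_loop (N : set M) (b : M) (c : R -> M) : Prop :=
  loop_in N b c /\ {in [set s : R | 0 <= s < 1] &, injective c}.

Definition homotopic (N : set M) (b : M) (c d : R -> M) : Prop :=
  exists H : R * R -> M,
    [/\ {within unit_interval `*` unit_interval, continuous H},
        forall u s, unit_interval u -> unit_interval s -> N (H (u, s)),
        forall s, unit_interval s -> H (0, s) = c s /\ H (1, s) = d s &
        forall u, unit_interval u -> H (u, 0) = b /\ H (u, 1) = b].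

Definition concat (c d : R -> M) (s : R) : M :=
  if s <= 2^-1 then c (2 * s) else d (2 * s - 1).

(* Loops whose class is in the subgroup of pi_1(N, b) generated by L. *)
Inductive generated (N : set M) (b : M) (L : set (R -> M)) : (R -> M) -> Prop :=
| generated_const : generated N b L (fun=> b)
| generated_loop c : L c -> generated N b L c
| generated_inv c : generated N b L c -> generated N b L (fun s => c (1 - s))
| generated_concat c d : generated N b L c -> generated N b L d ->
    generated N b L (concat c d)
| generated_homotopic c d : generated N b L c -> homotopic N b c d ->
    generated N b L d.

(* gamma k joins z k to z k.+1, where z enumerates the points with nonzero
   residue by an initial segment K of nat. *)
Definition chain_trace (K : set nat) (gamma : nat -> R -> M) : set M :=
  \bigcup_(k in [set k | K k.+1]) trace (gamma k).

Definition residue_chain (K : set nat) (z : nat -> M)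
    (gamma : nat -> R -> M) : Prop :=
  [/\ (forall k, K k.+1 -> K k),
      {in K &, injective z} /\ z @` K = singular_R X,
      (forall k, K k.+1 ->
        [/\ simple_path (gamma k), gamma k 0 = z k, gamma k 1 = z k.+1 &
            forall s : R, 0 < s < 1 -> ~ singular_set X (gamma k s)]),
      (forall k l (s u : R), (k < l)%N -> K l.+1 ->
        unit_interval s -> unit_interval u -> gamma k s = gamma l u ->
        [/\ l = k.+1, s = 1 & u = 0]) &
      connected (~` closure (chain_trace K gamma))].

Definition generating_loops (N : set M) (L : set (R -> M)) : Prop :=
  exists2 b, N b &
    (forall c, L c -> simple_loop (N `\` singular_set X) b c) /\
    (forall c, loop_in N b c -> generated N b L c).

(* Psi on the points of the cuts takes the values of one of the two boundary
   copies: these values vary analytically along each cut and are limits of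
   values of Psi off the cuts. *)
Definition retains_one_copy (cuts : set (R -> M)) (Gamma : set M)
    (Psi : M -> sphere R) : Prop :=
  forall c s, cuts c -> unit_interval s -> psi_dom X (c s) ->
  exists (V : set M) (Phi : M -> sphere R),
    [/\ branch X V Phi, V (c s), Psi (c s) = Phi (c s),
        closure [set p | [/\ V p, ~ Gamma p & Psi p = Phi p]] (c s) &
        0 < s < 1 -> (forall d, cuts d -> d <> c -> ~ trace d (c s)) ->
          \forall u \near s, Psi (c u) = Phi (c u)].

Definition single_valued : Prop :=
  exists Psi : M -> sphere R, branch X (psi_dom X) Psi.

(* Psi is a single-valued restriction of the associated function to the
   fundamental domain Lambda. Only one copy of each cut being retained,
   Lambda is a subset of M. *)
Definition restriction (Lambda : set M) (Psi : M -> sphere R) : Prop :=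
  (Lambda = setT /\ branch X (psi_dom X) Psi) \/
  (~ single_valued /\
   exists (K : set nat) (z : nat -> M) (gamma : nat -> R -> M)
          (L : set (R -> M)),
     let cuts := [set c | exists2 k, K k.+1 & c = gamma k] `|` L in
     let cut_points := \bigcup_(c in cuts) trace c in
     [/\ residue_chain K z gamma,
         (conformal_to_sphere M \/ conformal_to_disc M) /\ L = set0 \/
         ~ (conformal_to_sphere M \/ conformal_to_disc M) /\
           generating_loops (~` closure (chain_trace K gamma)) L,
         Lambda = ~` closure cut_points `|` cut_points,
         branch X (psi_dom X `\` closure cut_points) Psi &
         retains_one_copy cuts (closure cut_points) Psi]).

End FundamentalDomain.

Section SingularValues.
Context {R : realType} {M : riemann_surface R} (X : vector_field M).

Definition half_line : set R := [set s | 0 <= s].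

(* One-sided at an end point of A belonging to A. *)
Definition path_deriv (A : set R) (c : R -> cplx R) (t : R) (v : cplx R) : Prop :=
  ((c s - c t) / (s - t)%:C) @[s --> within A t^'] --> v.

Definition c1_path (alpha : R -> M) (v : chart_index M -> R -> cplx R) : Prop :=
  {within half_line, continuous alpha} /\
  forall i s, half_line s -> chart_dom i (alpha s) ->
    path_deriv half_line (chart i \o alpha) s (v i s) /\
    v i u @[u --> within half_line (nbhs s)] --> v i s.

(* The pull-back of the 1-form of time by alpha is [omega_along alpha v s ds]. *)
Definition omega_along (alpha : R -> M) (v : chart_index M -> R -> cplx R)
    (s : R) : cplx R :=
  omega X (chart_at (alpha s)) (alpha s) * v (chart_at (alpha s)) s.

Definition path_integral alpha v (s : R) : cplx R :=
  cintegral 0 s (omega_along alpha v).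

(* The slope of a path is measured in the flat coordinate t = Psi(z), where the
   real trajectories of X are the horizontal paths. A tangent direction in the
   charts of M would be too much to ask: a trajectory may spiral into an
   essential singularity in finite time. *)
Definition well_defined_slope alpha v : Prop :=
  exists2 e : cplx R, e != 0 &
    (omega_along alpha v s / `|omega_along alpha v s|) @[s --> +oo] --> e.

(* The base point z_o of Psi is alpha 0. *)
Definition asymptotic_path (zs : M) (a : sphere R) (alpha : R -> M)
    (v : chart_index M -> R -> cplx R) : Prop :=
  [/\ c1_path alpha v,
      ~ singular_set X (alpha 0) /\
        (forall s, half_line s -> ~ (zeros X `|` essential X) (alpha s)),
      singular_set X zs /\ alpha s @[s --> +oo] --> zs,
      well_defined_slope alpha v &
      (Some (path_integral alpha v s) : sphere R) @[s --> +oo] --> a].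

Definition critical_value (zs : M) (a : sphere R) alpha v : Prop :=
  exists (V : set M) (Psi : M -> sphere R),
    [/\ branch X V Psi, V zs,
        \forall s \near +oo, Psi (alpha s) = Some (path_integral alpha v s),
        Psi zs = a &
        if a is Some _ then
          exists g : M -> cplx R, (\forall q \near zs, Psi q = Some (g q)) /\
            is_chart_derive (chart_at zs) g zs 0
        else
          (* a multiple pole of Psi is a multiple zero of 1 / Psi *)
          exists g : M -> cplx R,
            (\forall q \near zs, g q = if Psi q is Some w then w^-1 else 0) /\
            is_chart_derive (chart_at zs) g zs 0].

(* The component of the preimage of D(a, rho) in R_X determined by alpha, i.e.
   eventually containing the lift of alpha. *)
Definition component_of alpha v (a : sphere R) (rho : R) : set (M * sphere R) :=
  [set x | exists2 s0, 0 <= s0 & forall s, s0 <= s ->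
     same_component X (spherical_disc a rho)
       (alpha s, Some (path_integral alpha v s)) x].

Definition graph_on (Lambda : set M) (Psi : M -> sphere R) : set (M * sphere R) :=
  [set (z, Psi z) | z in Lambda `&` psi_dom X].

Definition U_neighborhood (Lambda : set M) (Psi : M -> sphere R) alpha v
    (a : sphere R) (rho : R) : set M :=
  fst @` (component_of alpha v a rho `&` graph_on Lambda Psi).

(* No fundamental domain is privileged: the intersection has to be empty for
   each of them, Psi being normalized by Psi(z_o) = 0. *)
Definition transcendental_singularity (a : sphere R) alpha v : Prop :=
  forall (Lambda : set M) (Psi : M -> sphere R),
    restriction X Lambda Psi ->
    (Lambda (alpha 0) -> Psi (alpha 0) = Some 0) ->
    \bigcap_(rho in [set rho : R | 0 < rho])
      U_neighborhood Lambda Psi alpha v a rho = set0.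

Definition singular_value (a : sphere R) (alpha : R -> M) (zs : M) : Prop :=
  exists v : chart_index M -> R -> cplx R,
    asymptotic_path zs a alpha v /\
    (critical_value zs a alpha v \/ transcendental_singularity a alpha v).

End SingularValues.

Section Trajectories.
Context {R : realType} {M : riemann_surface R} (X : vector_field M).
Implicit Types (a b : \bar R) (z : R -> M) (zs : M).

Definition time_domain a b : set R := [set t : R | (a < t%:E < b)%E].

Definition solution a b z : Prop :=
  [/\ time_domain a b !=set0,
      {within time_domain a b, continuous z} &
      forall t, time_domain a b t -> field_dom X (z t) /\
        forall i, chart_dom i (z t) ->
          path_deriv (time_domain a b) (chart i \o z) t (field_comp X i (z t))].

Definition maximal_trajectory a b z : Prop :=
  solution a b z /\
  forall a' b' z', solution a' b' z' ->
    time_domain a b `<=` time_domain a' b' ->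
    {in time_domain a b, z' =1 z} ->
    time_domain a' b' = time_domain a b.

Definition incomplete_trajectory a b z : Prop :=
  maximal_trajectory a b z /\ time_domain a b <> setT.

(* The limit is taken at an end of the trajectory reached in finite time; the
   other end may be unrelated to the incompleteness. *)
Definition limit_at_finite_end a b z zs : Prop :=
  (exists2 b0 : R, b = b0%:E & z t @[t --> b0^'-] --> zs) \/
  (exists2 a0 : R, a = a0%:E & z t @[t --> a0^'+] --> zs).

(* alpha runs through one half of a maximal trajectory, forwards or backwards
   (asymptotic paths are parametrized by the half line). *)
Definition is_trajectory (alpha : R -> M) : Prop :=
  exists a b z (theta : R -> R),
    [/\ maximal_trajectory a b z,
        {within half_line, continuous theta},
        forall s, half_line s ->
          time_domain a b (theta s) /\ alpha s = z (theta s) &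
        ({in half_line &, {homo theta : s u / s < u}} /\
           (theta s)%:E @[s --> +oo] --> b) \/
        ({in half_line &, {homo theta : s u /~ s < u}} /\
           (theta s)%:E @[s --> +oo] --> a)].

End Trajectories.

(* Main.v *)
Require Import Defs.
From mathcomp Require Import ring lra.

(* Along a trajectory the 1-form of time integrates to the elapsed time, which
   is finite exactly when the end of the trajectory is reached in finite time;
   this gives 2) => 1), with the end of the trajectory as the limit point.

   Conversely, let a maximal trajectory tend to z_s in finite time.  It avoids
   the zeros of X, where trajectories are stationary, and z_s is not a point of
   analyticity of X, since otherwise the trajectory would continue through z_s;
   hence z_s is a pole or an essential singularity.  At a pole, the 1-form of
   time is holomorphic with a zero, so it has a local primitive (Goursat),
   for which z_s is a critical point.  At an essential singularity the
   asymptotic value is transcendental: if p lies in all the neighborhoods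
   U_a(rho), then Psi(p) = a and p is not a zero of X, so |Psi - a| is bounded
   below on the boundary of a small neighborhood of p that does not contain
   z_s; for small rho a path in R_X over D(a, rho) that ends at p cannot cross
   this boundary, hence does not come from the end of the trajectory. *)

Set Implicit Arguments.
Unset Strict Implicit.
Unset Printing Implicit Defensive.

Import Order.TTheory GRing.Theory Num.Theory.
Import numFieldNormedType.Exports.

Local Open Scope classical_set_scope.
Local Open Scope ring_scope.
Local Open Scope complex_scope.

(** * Complex and path derivatives *)

Section Modulus.
Context {R : realType}.
Implicit Types z w : cplx R.

(** Holomorphy is given as bare pointwise complex differentiability, so a primitive of the 1-form of
    time has to be built from Goursat's subdivision, applied to primitives [A] and [B] along
    horizontal and vertical lines. The primitive [F] has three uses. Its local inverse along real
    increments of [F] is the flow of [X] near a point where [X] does not vanish, which gives the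
    continuation of a trajectory without an integral equation. At a pole it provides the branch of
    [Psi] itself. Near a point that is neither a zero nor essential it is compared with the
    continuation of [Psi] along a path. For the last two uses regular points and poles share one
    normal form, [omega = (w - w0)^n / G] with [G w0 <> 0], so that [F - F w0] behaves like a
    nonzero multiple of [(w - w0)^(n+1)]. A finite end [e] is approached over the half line through
    [e + (t - e) exp(-s)], whose speed is real, so the slope of the path is constant. In the other
    direction the time change [theta] is only continuous; its differentiability has to be deduced by
    comparing two first-order expansions in a chart. *)

Lemma normcE z : `|z| = (modulus z)%:C.
Proof. by case: z. Qed.

Lemma modulusM z w : modulus (z * w) = modulus z * modulus w.
Proof. by apply: complexI; rewrite rmorphM /= -!normcE normrM. Qed.

Lemma modulusD z w : modulus (z + w) <= modulus z + modulus w.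
Proof. by rewrite -lecR rmorphD /= -!normcE ler_normD. Qed.

Lemma modulusN z : modulus (- z) = modulus z.
Proof. by apply: complexI; rewrite -!normcE normrN. Qed.

Lemma modulus_distC z w : modulus (z - w) = modulus (w - z).
Proof. by rewrite -modulusN opprB. Qed.

Lemma modulus_ge0 z : 0 <= modulus z.
Proof. by rewrite -lecR -normcE normr_ge0. Qed.

Lemma modulus0 : modulus (0 : cplx R) = 0.
Proof. by apply: complexI; rewrite -normcE normr0. Qed.

Lemma modulus_eq0 z : (modulus z == 0) = (z == 0).
Proof. by rewrite -[RHS]normr_eq0 normcE (inj_eq (@complexI R)). Qed.

Lemma modulus_gt0 z : (0 < modulus z) = (z != 0).
Proof. by rewrite lt_def modulus_eq0 modulus_ge0 andbT. Qed.

Lemma modulusV z : modulus (z^-1 : cplx R) = (modulus z)^-1.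
Proof. by apply: complexI; rewrite fmorphV /= -!normcE normfV. Qed.

Lemma modulusX z n : modulus (z ^+ n : cplx R) = modulus z ^+ n.
Proof. by apply: complexI; rewrite rmorphXn /= -!normcE normrX. Qed.

Lemma modulus_real (x : R) : modulus (x%:C : cplx R) = `|x|.
Proof. by rewrite /modulus /= expr0n /= addr0 sqrtr_sqr. Qed.

Lemma modulusB z w : modulus (z - w) <= modulus z + modulus w.
Proof. by rewrite -(modulusN w) modulusD. Qed.

Lemma modulus_sub_ge z w : modulus z - modulus w <= modulus (z - w).
Proof.
by rewrite lerBlDr; apply: le_trans (modulusD _ _); rewrite subrK.
Qed.

Lemma modulus_triangle z w t : modulus (z - t) <= modulus (z - w) + modulus (w - t).
Proof. by apply: le_trans (modulusD _ _); rewrite addrA subrK. Qed.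

Lemma Re_le_modulus z : `|complex.Re z| <= modulus z.
Proof.
case: z => a b; rewrite /modulus /= -sqrtr_sqr ler_sqrt ?addr_ge0 ?sqr_ge0 //.
by rewrite lerDl sqr_ge0.
Qed.

Lemma Im_le_modulus z : `|complex.Im z| <= modulus z.
Proof.
case: z => a b; rewrite /modulus /= -sqrtr_sqr ler_sqrt ?addr_ge0 ?sqr_ge0 //.
by rewrite lerDr sqr_ge0.
Qed.

Lemma ReB z w : complex.Re (z - w) = complex.Re z - complex.Re w.
Proof. by case: z; case: w. Qed.

Lemma ImB z w : complex.Im (z - w) = complex.Im z - complex.Im w.
Proof. by case: z; case: w. Qed.

Lemma cplxE z : z = (complex.Re z)%:C + 'i * (complex.Im z)%:C.
Proof. exact: complexE. Qed.

Lemma modulus_i : modulus ('i : cplx R) = 1.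
Proof. by rewrite /modulus /= expr0n /= add0r expr1n sqrtr1. Qed.

Lemma modulus_le z : modulus z <= `|complex.Re z| + `|complex.Im z|.
Proof.
rewrite {1}(cplxE z); apply: le_trans (modulusD _ _) _.
by rewrite modulusM modulus_i mul1r !modulus_real.
Qed.

Lemma nbhs_cplxP w (U : set (cplx R)) :
  nbhs w U <-> exists2 r : R, 0 < r & forall z, modulus (z - w) < r -> U z.
Proof.
split=> [/nbhs_ballP [e e0 eU]|[r r0 rU]].
  have eE : e = (complex.Re e)%:C.
    by move: e0; rewrite /= ltcE => /andP[/eqP]; case: e {eU} => x y /= ->.
  exists (complex.Re e); first by move: e0; rewrite /= eE ltcR.
  move=> z zw; apply: eU; rewrite -ball_normE /= distrC normcE eE ltcR //.
apply/nbhs_ballP; exists (r%:C : complex R); first by rewrite /= ltcR.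
move=> z; rewrite -ball_normE /= distrC normcE ltcR; exact: rU.
Qed.

Lemma nbhs_realP (x : R) (U : set R) :
  nbhs x U <-> exists2 r : R, 0 < r & forall y, `|y - x| < r -> U y.
Proof.
split=> [/nbhs_ballP [e e0 eU]|[r r0 rU]].
  by exists e => // y yx; apply: eU; rewrite -ball_normE /= distrC.
apply/nbhs_ballP; exists r => // y; rewrite -ball_normE /= distrC; exact: rU.
Qed.

End Modulus.

Section Derivatives.
Context {R : realType}.
Implicit Types (h g : cplx R -> cplx R) (c : R -> cplx R) (A B : set R).

Definition cderiv h (w d : cplx R) : Prop := forall e : R, 0 < e ->
  exists2 r : R, 0 < r & forall z, modulus (z - w) < r ->
    modulus (h z - h w - d * (z - w)) <= e * modulus (z - w).

(** Only times in [A] are tested, which gives the one-sided derivative at an end of [A] and lets the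
    derivative pass to subsets of [A]. *)
Definition pderiv A c (t : R) (v : cplx R) : Prop := forall e : R, 0 < e ->
  exists2 r : R, 0 < r & forall s, A s -> `|s - t| < r ->
    modulus (c s - c t - v * (s - t)%:C) <= e * `|s - t|.

Lemma cderivP h w d :
  is_derive (w : cplx R) (1 : cplx R) h d <-> cderiv h w d.
Proof.
have cvgP (l : cplx R) :
    (fun k : cplx R => (k : complex R)^-1 *:
        (h ((k : complex R) *: (1 : cplx R) + w) - h w) : cplx R) @ (0 : cplx R)^' --> l
    <-> cderiv h w l.
  split=> [hl e e0|hl].
    have : nbhs l [set z | modulus (z - l) < e].
      by apply/nbhs_cplxP; exists e.
    move=> /hl; rewrite nbhs_filterE /= => /nbhs_cplxP[r r0 rP].
    exists r => // z zw; have [->|zNw] := eqVneq z w.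
      by rewrite !subrr mulr0 subr0 modulus0 mulr0.
    have zw0 : z - w != 0 by rewrite subr_eq0.
    have := rP (z - w); rewrite subr0 => /(_ zw zw0) /=.
    rewrite /GRing.scale /= mulr1 subrK => H.
    have -> : h z - h w - l * (z - w) = ((z - w)^-1 * (h z - h w) - l) * (z - w).
      by rewrite mulrBl mulrAC mulVf // mul1r.
    by rewrite modulusM ler_wpM2r ?modulus_ge0 // ltW.
  move=> U /nbhs_cplxP[e e0 eU].
  (* Halving [e] turns the large inequality of [cderiv] into the strict one that a ball asks for. *)
  have [r r0 rP] := hl (e / 2) (divr_gt0 e0 (ltr0n _ 2)).
  rewrite nbhs_filterE /=; apply/nbhs_cplxP; exists r => // k; rewrite subr0 => kr k0.
  apply: eU; rewrite /GRing.scale /= mulr1.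
  have := rP (k + w); rewrite addrK => /(_ kr) H.
  have -> : k^-1 * (h (k + w) - h w) - l = (h (k + w) - h w - l * k) * k^-1.
    by rewrite mulrBl mulfK // mulrC.
  rewrite modulusM modulusV ltr_pdivrMr ?modulus_gt0 //.
  by apply: le_lt_trans H _; rewrite ltr_pM2r ?modulus_gt0 // gtr_pMr // invf_lt1 // ltr1n.
split=> [[dh hd]|/cvgP hd].
  by apply/cvgP; rewrite -hd; exact: dh.
split; first by apply/cvg_ex; exists d.
by apply: cvg_lim => //; exact: norm_hausdorff.
Qed.

Lemma path_derivP A c t v : path_deriv A c t v <-> pderiv A c t v.
Proof.
split=> [hl e e0|hl].
  have : nbhs v [set z | modulus (z - v) < e].
    by apply/nbhs_cplxP; exists e.
  move=> /hl; rewrite nbhs_filterE /= => /nbhs_realP[r r0 rP].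
  exists r => // s As st; have [->|sNt] := eqVneq s t.
    by rewrite !subrr mulr0 subr0 modulus0 normr0 mulr0.
  have st0 : (s - t)%:C != 0 :> cplx R.
    by rewrite -modulus_eq0 modulus_real normr_eq0 subr_eq0.
  have := rP s st sNt As => /= H.
  have -> : c s - c t - v * (s - t)%:C
      = ((c s - c t) / (s - t)%:C - v) * (s - t)%:C.
    by rewrite mulrBl mulfVK.
  by rewrite modulusM modulus_real ler_wpM2r // ltW.
move=> U /nbhs_cplxP[e e0 eU].
have [r r0 rP] := hl (e / 2) (divr_gt0 e0 (ltr0n _ 2)).
rewrite nbhs_filterE /=; apply/nbhs_realP; exists r => // s st sNt As.
have st0 : (s - t)%:C != 0 :> cplx R.
  by rewrite -modulus_eq0 modulus_real normr_eq0 subr_eq0.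
apply: eU => /=.
have -> : (c s - c t) / (s - t)%:C - v
    = (c s - c t - v * (s - t)%:C) / (s - t)%:C.
  by rewrite [RHS]mulrBl mulfK.
rewrite modulusM modulusV modulus_real.
have st1 : 0 < `|s - t| by rewrite normr_gt0 subr_eq0.
rewrite ltr_pdivrMr //; apply: le_lt_trans (rP _ As st) _.
by rewrite ltr_pM2r // gtr_pMr // invf_lt1 // ltr1n.
Qed.

Lemma cderiv_derivable h w d :
  cderiv h w d -> derivable (h : cplx R -> cplx R) w 1.
Proof. by move=> /cderivP []. Qed.

Lemma derivable_cderiv h w :
  derivable (h : cplx R -> cplx R) w 1 -> cderiv h w ('D_1 h w).
Proof. by move=> /derivableP /cderivP. Qed.

Lemma derivable_ex_cderiv h w :
  derivable (h : cplx R -> cplx R) w 1 -> exists d, cderiv h w d.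
Proof. by move=> /derivable_cderiv hd; exists ('D_1 h w). Qed.

Lemma cderiv_ext h g w d (r : R) : 0 < r ->
  (forall z, modulus (z - w) < r -> h z = g z) -> cderiv h w d -> cderiv g w d.
Proof.
move=> r0 hg hd e e0; have [r1 r10 H] := hd e e0.
exists (Num.min r r1) => [|z]; first by rewrite lt_min r0.
rewrite lt_min => /andP[zr zr1].
by rewrite -!hg ?H // subrr modulus0.
Qed.

Lemma cderiv_cst (a : cplx R) w : cderiv (fun=> a) w 0.
Proof. by apply/cderivP; exact: is_derive_cst. Qed.

Lemma cderiv_id w : cderiv id w 1.
Proof. by apply/cderivP; exact: is_derive_id. Qed.

Lemma cderivD h g w d d' : cderiv h w d -> cderiv g w d' ->
  cderiv (fun z => h z + g z) w (d + d').
Proof. by move=> /cderivP ? /cderivP ?; apply/cderivP; exact: is_deriveD. Qed.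

Lemma cderivB h g w d d' : cderiv h w d -> cderiv g w d' ->
  cderiv (fun z => h z - g z) w (d - d').
Proof. by move=> /cderivP ? /cderivP ?; apply/cderivP; exact: is_deriveB. Qed.

Lemma cderivM h g w d d' : cderiv h w d -> cderiv g w d' ->
  cderiv (fun z => h z * g z) w (h w * d' + g w * d).
Proof. by move=> /cderivP ? /cderivP ?; apply/cderivP; exact: is_deriveM. Qed.

Lemma cderivZ (a : cplx R) h w d : cderiv h w d ->
  cderiv (fun z => a * h z) w (a * d).
Proof.
by move=> hd; have := cderivM (cderiv_cst a w) hd; rewrite mulr0 addr0.
Qed.

Lemma cderivX n h w d : cderiv h w d ->
  cderiv (fun z => h z ^+ n) w (n%:R * h w ^+ n.-1 * d).
Proof.
move=> hd; elim: n => [|n IH].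
  rewrite !mul0r; apply: (@cderiv_ext (fun=> 1) _ _ _ 1 ltr01 _ (cderiv_cst _ _)).
  by move=> z _; rewrite expr0.
have -> : n.+1%:R * h w ^+ n.+1.-1 * d = h w * (n%:R * h w ^+ n.-1 * d) + h w ^+ n * d.
  case: n {IH} => [|n] /=; first by rewrite !mul0r mulr0 add0r mul1r.
  by rewrite exprS; ring.
apply: cderiv_ext ltr01 _ (cderivM hd IH) => z _.
by rewrite exprS.
Qed.

Lemma cderivV h w d : h w != 0 -> cderiv h w d ->
  exists d', cderiv (fun z => (h z)^-1) w d'.
Proof.
move=> h0 /cderiv_derivable dh; apply: derivable_ex_cderiv.
exact: (derivableV h0 dh).
Qed.

Lemma cderiv_continuous h w d : cderiv h w d -> forall e : R, 0 < e ->
  exists2 r : R, 0 < r & forall z, modulus (z - w) < r -> modulus (h z - h w) < e.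
Proof.
move=> /cderivP [/derivable1_diffP /differentiable_continuous hw _] e e0.
have : nbhs (h w) [set z | modulus (z - h w) < e] by apply/nbhs_cplxP; exists e.
by move=> /hw; rewrite nbhs_filterE => /nbhs_cplxP.
Qed.

Lemma pderiv_continuous A c t v : pderiv A c t v -> forall e : R, 0 < e ->
  exists2 r : R, 0 < r & forall s, A s -> `|s - t| < r -> modulus (c s - c t) < e.
Proof.
move=> /(_ 1 ltr01)[r r0 rP] e e0.
pose K := 1 + modulus v.
have K0 : 0 < K by rewrite /K ltr_pwDl // modulus_ge0.
exists (Num.min r (e / K)) => [|s As]; first by rewrite lt_min r0 divr_gt0.
rewrite lt_min => /andP[sr]; rewrite ltr_pdivlMr // => se.
apply: le_lt_trans se.
have -> : c s - c t = (c s - c t - v * (s - t)%:C) + v * (s - t)%:C by rewrite subrK.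
apply: le_trans (modulusD _ _) _; rewrite modulusM modulus_real.
by have := rP _ As sr; rewrite /K; lra.
Qed.

(** The displacements [inc] and [inc2] are left abstract so that one estimate yields three rules: a
    function after a function, a function after a path, and a path after a real
    reparametrization. *)
Lemma chain_rule {T S : Type} (A : set T) (D : set S) (inc : T -> cplx R)
    (inc2 : S -> cplx R) (c : T -> S) (h : S -> cplx R) (h0 d v : cplx R) (e : R) :
  0 < e ->
  (forall e : R, 0 < e -> exists2 r : R, 0 < r & forall s, A s ->
    modulus (inc s) < r -> modulus (inc2 (c s) - v * inc s) <= e * modulus (inc s)) ->
  (forall s, A s -> D (c s)) ->
  (forall e : R, 0 < e -> exists2 r : R, 0 < r & forall z, D z ->
    modulus (inc2 z) < r -> modulus (h z - h0 - d * inc2 z) <= e * modulus (inc2 z)) ->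
  exists2 r : R, 0 < r & forall s, A s -> modulus (inc s) < r ->
    modulus (h (c s) - h0 - d * v * inc s) <= e * modulus (inc s).
Proof.
move=> e0 gd AD hd.
(* Half of the error comes from [h] and half from [c]. Once the relative error of [c] is at most 1,
   [|inc2 (c s)| <= K |inc s|]; [L] exceeds [|d|], and the added 1 keeps both divisors positive. *)
pose K := 1 + modulus v.
have K0 : 0 < K by rewrite /K ltr_pwDl // modulus_ge0.
pose L := 1 + modulus d.
have L0 : 0 < L by rewrite /L ltr_pwDl // modulus_ge0.
have [r1 r10 H1] := hd (e / 2 / K) (divr_gt0 (divr_gt0 e0 (ltr0n _ 2)) K0).
have e20 : 0 < Num.min 1 (e / 2 / L) by rewrite lt_min ltr01 !divr_gt0.
have [r3 r30 H3] := gd _ e20.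
exists (Num.min (r1 / K) r3) => [|s As]; first by rewrite lt_min divr_gt0.
rewrite lt_min => /andP[sr1 /(H3 _ As) {}H3].
have -> : h (c s) - h0 - d * v * inc s =
  (h (c s) - h0 - d * inc2 (c s)) + d * (inc2 (c s) - v * inc s) by ring.
apply: le_trans (modulusD _ _) _; rewrite modulusM.
set m := modulus (inc s) in H3 sr1 *; have m0 : 0 <= m by exact: modulus_ge0.
have gzw : modulus (inc2 (c s)) <= K * m.
  have -> : inc2 (c s) = (inc2 (c s) - v * inc s) + v * inc s by rewrite subrK.
  apply: le_trans (modulusD _ _) _; rewrite modulusM -/m mulrDl lerD2r.
  by apply: le_trans H3 _; rewrite ler_wpM2r // ge_min lexx.
have b1 : modulus (h (c s) - h0 - d * inc2 (c s)) <= e / 2 * m.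
  apply: (@le_trans _ _ (e / 2 / K * modulus (inc2 (c s)))).
    by apply: H1; [exact: AD | apply: le_lt_trans gzw _; rewrite mulrC -ltr_pdivlMr].
  rewrite -mulrA ler_pM2l ?divr_gt0 //.
  by rewrite mulrC ler_pdivrMr // mulrC.
have b2 : modulus d * modulus (inc2 (c s) - v * inc s) <= e / 2 * m.
  apply: (@le_trans _ _ (L * (e / 2 / L * m))); last first.
    by rewrite mulrA mulrCA divff ?gt_eqF // mulr1.
  apply: ler_pM; rewrite ?modulus_ge0 //; first by rewrite /L lerDr.
  by apply: le_trans H3 _; rewrite ler_wpM2r // ge_min lexx orbT.
by lra.
Qed.

Lemma cderiv_comp h g w d d' : cderiv g w d -> cderiv h (g w) d' ->
  cderiv (h \o g) w (d' * d).
Proof.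
move=> gd hd e e0.
have [e' /gd[r r0 rP]|//|e' /hd[r r0 rP]|r r0 rP] := @chain_rule _ _ setT setT
    (fun z => z - w) (fun z => z - g w) g h (h (g w)) d' d e e0.
- by exists r => // s _; exact: rP.
- by exists r => // z _; exact: rP.
- by exists r => // z; exact: rP.
Qed.

Lemma cderiv_pderiv A h c t d v : pderiv A c t v -> cderiv h (c t) d ->
  pderiv A (h \o c) t (d * v).
Proof.
move=> gd hd e e0.
have [e' /gd[r r0 rP]|//|e' /hd[r r0 rP]|r r0 rP] := @chain_rule _ _ A setT
    (fun s => (s - t)%:C) (fun z => z - c t) c h (h (c t)) d v e e0.
- by exists r => // s As; rewrite modulus_real; exact: rP.
- by exists r => // z _; exact: rP.
- by exists r => // s As; have := rP s As; rewrite modulus_real.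
Qed.

Lemma pderiv_reparam A B c (theta : R -> R) s v (w : cplx R) :
  (forall u, B u -> A (theta u)) ->
  pderiv A c (theta s) v -> pderiv B (fun u => (theta u)%:C) s w ->
  pderiv B (c \o theta) s (v * w).
Proof.
move=> BA hd gd e e0.
have [e' /gd[r r0 rP]|//|e' /hd[r r0 rP]|r r0 rP] := @chain_rule _ _ B A
    (fun u => (u - s)%:C) (fun t => (t - theta s)%:C) theta c (c (theta s)) v w e e0.
- by exists r => // u Bu; rewrite modulus_real rmorphB; exact: rP.
- by exists r => // t At; rewrite modulus_real; exact: rP.
- by exists r => // u Bu; have := rP u Bu; rewrite modulus_real.
Qed.

End Derivatives.

(** * Mean value inequality *)

Section MeanValue.
Context {R : realType}.
Implicit Types (a b : R) (c : R -> cplx R) (h : cplx R -> cplx R) (A : set R).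

(** Induction on the real line (Cousin's lemma): the supremum of the points reached from [a] is
    itself reached, and passed unless it is [b]. Both the mean value inequality and the
    connectedness of segments rest on it. *)
Lemma cousin (P : R -> R -> Prop) a b : a <= b ->
  (forall x y z, P x y -> P y z -> P x z) ->
  (forall s, a <= s <= b -> exists2 d : R, 0 < d &
     forall x y, a <= x -> x <= s <= y -> y <= b -> y - x < d -> P x y) ->
  P a b.
Proof.
move=> ab Ptrans Ploc.
pose S := [set s | a <= s <= b /\ P a s].
have Sa : S a.
  split; first by rewrite lexx.
  have [|d d0] := Ploc a; first by rewrite lexx.
  by apply; rewrite ?lexx ?ab // subrr.
have Sb : has_sup S by split; [exists a | exists b => s [/andP[]]].
pose m := sup S.
have am : a <= m by exact: ub_le_sup Sb.2 _ Sa.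
have mb : m <= b by apply: (ge_sup (ex_intro _ a Sa)) => s [/andP[]].
have [|d d0 dP] := Ploc m; first by rewrite am.
have [s [/andP[as_ sb] Pas] ms] := sup_adherent (divr_gt0 d0 (ltr0n R 3)) Sb.
rewrite -/m in ms.
have sm : s <= m by apply: ub_le_sup Sb.2 _ _; split=> //; rewrite as_.
(* From [s > m - d / 3] to [m' <= m + d / 3] the step is shorter than [d], so the local hypothesis
   at [m] covers it. *)
pose m' := Num.min b (m + d / 3).
have d3 : 0 < d / 3 by rewrite divr_gt0.
have mm' : m <= m' by rewrite le_min mb lerDl ltW.
have m'b : m' <= b by rewrite ge_min lexx.
have m'd : m' <= m + d / 3 by rewrite ge_min lexx orbT.
have Pm' : P a m'.
  apply: Ptrans Pas _; apply: dP => //; first by rewrite sm.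
  by lra.
have : m' <= m.
  by apply: ub_le_sup Sb.2 _ _; split=> //; rewrite m'b andbT (le_trans am).
move=> m'm; suff <- : m' = b by [].
apply/eqP; rewrite eq_le m'b /=.
by move: m'm; rewrite ge_min => /orP[bm|]; [exact: le_trans bm mm' | lra].
Qed.

(** Connectedness of the segment, phrased for a predicate: [cousin] is applied to the equivalence of
    [T x] and [T y]. *)
Lemma segment_clopen (T : set R) a b : a <= b ->
  (forall s, a <= s <= b -> exists2 d : R, 0 < d &
     forall u, a <= u <= b -> `|u - s| < d -> (T u <-> T s)) ->
  T a <-> T b.
Proof.
move=> ab Tloc; apply: (@cousin (fun x y => T x <-> T y)) => //.
  by move=> x y z [xy yx] [yz zy]; split=> [/xy/yz|/zy/yx].
move=> s sab; have [d d0 dP] := Tloc s sab; exists d => // x y ax /andP[xs sy] yb xyd.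
have := dP x; have := dP y.
rewrite ax yb (le_trans xs) ?(andP sab).2 // (le_trans _ sy) ?(andP sab).1 //.
by rewrite !ltr_norml => /(_ isT) Hy /(_ isT) Hx; rewrite Hx ?Hy //; apply/andP; split; lra.
Qed.

Lemma le_of_slope (x y C : R) : 0 <= C ->
  (forall e : R, 0 < e -> x <= y + e * C) -> x <= y.
Proof.
move=> C0 H; apply/ler_addgt0Pr => e e0.
have C1 : 0 < C + 1 by lra.
apply: le_trans (H _ (divr_gt0 e0 C1)) _.
rewrite lerD2l mulrAC ler_pdivrMr // ler_pM2l //; lra.
Qed.

Lemma pderiv_sub A (B : set R) c t v : B `<=` A -> pderiv A c t v -> pderiv B c t v.
Proof.
by move=> BA h e /h[r r0 rP]; exists r => // s /BA; exact: rP.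
Qed.

(** A complex-valued path need not attain its mean slope, hence an inequality. The bound with slope
    [K + e] holds near every time by the definition of the derivative and adds up over adjacent
    intervals; [cousin] glues, then [e] tends to 0. *)
Lemma mean_value_le A c a b (K : R) : a <= b ->
  (forall t, a <= t <= b -> A t) ->
  (forall t, a <= t <= b -> exists2 v, pderiv A c t v & modulus v <= K) ->
  modulus (c b - c a) <= K * (b - a).
Proof.
move=> ab subA hc; apply: (@le_of_slope _ _ (b - a)); first by rewrite subr_ge0.
move=> e e0; rewrite -mulrDl.
apply: (@cousin (fun x y => modulus (c y - c x) <= (K + e) * (y - x))) => //.
  move=> x y z H1 H2; apply: le_trans (modulus_triangle _ (c y) _) _.
  by move: H1 H2; lra.
move=> s sab; have [v hv vK] := hc s sab.
have [d d0 dP] := hv e e0.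
have bd u : A u -> `|u - s| < d -> modulus (c u - c s) <= (K + e) * `|u - s|.
  move=> Au us.
  have -> : c u - c s = (c u - c s - v * (u - s)%:C) + v * (u - s)%:C by rewrite subrK.
  apply: le_trans (modulusD _ _) _; rewrite modulusM modulus_real mulrDl addrC.
  by rewrite lerD ?ler_wpM2r // dP.
exists d => // x y ax /andP[xs sy] yb xyd.
have As u : a <= u -> u <= b -> A u by move=> *; apply: subA; apply/andP.
have [as_ sb] := andP sab.
have := bd x (As _ ax (le_trans xs sb)); have := bd y (As _ (le_trans as_ sy) yb).
rewrite ger0_norm ?subr_ge0 // ler0_norm ?subr_le0 // opprB.
move=> H1 H2; apply: le_trans (modulus_triangle _ (c s) _) _.
rewrite (modulus_distC (c s)).
have := H1 ltac:(lra); have := H2 ltac:(lra); lra.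
Qed.

Lemma mean_value_le_sym A c a b (K : R) :
  (forall t, Num.min a b <= t <= Num.max a b -> A t) ->
  (forall t, Num.min a b <= t <= Num.max a b ->
     exists2 v, pderiv A c t v & modulus v <= K) ->
  modulus (c b - c a) <= K * `|b - a|.
Proof.
have [ab|ba] := leP a b => subA H.
  by rewrite ger0_norm ?subr_ge0 //; apply: (@mean_value_le A).
rewrite modulus_distC distrC ger0_norm ?subr_ge0 ?(ltW ba) //.
by apply: (@mean_value_le A) => //; exact: ltW.
Qed.

Lemma between_dist a b t : Num.min a b <= t <= Num.max a b -> `|t - a| <= `|b - a|.
Proof.
rewrite ge_min le_max => /andP[/orP[?|?] /orP[?|?]]; rewrite ler_norml;
  have := ler_norm (b - a); have := ler_norm (a - b); rewrite (distrC a b);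
  move=> ? ?; apply/andP; split; lra.
Qed.

Lemma pderivD A c1 c2 t v1 v2 : pderiv A c1 t v1 -> pderiv A c2 t v2 ->
  pderiv A (fun s => c1 s + c2 s) t (v1 + v2).
Proof.
move=> h1 h2 e e0.
have [r1 r10 H1] := h1 _ (divr_gt0 e0 (ltr0n _ 2)).
have [r2 r20 H2] := h2 _ (divr_gt0 e0 (ltr0n _ 2)).
exists (Num.min r1 r2) => [|s As]; first by rewrite lt_min r10.
rewrite lt_min => /andP[/(H1 _ As) {}H1 /(H2 _ As) {}H2].
have -> : c1 s + c2 s - (c1 t + c2 t) - (v1 + v2) * (s - t)%:C =
  (c1 s - c1 t - v1 * (s - t)%:C) + (c2 s - c2 t - v2 * (s - t)%:C) by ring.
by apply: le_trans (modulusD _ _) _; lra.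
Qed.

Lemma pderivZ A (k : cplx R) c t v : pderiv A c t v ->
  pderiv A (fun s => k * c s) t (k * v).
Proof.
move=> hc; apply: (@cderiv_pderiv _ _ (fun z => k * z)) => //.
by have := cderivZ k (cderiv_id (c t)); rewrite mulr1.
Qed.

Lemma pderivB A c1 c2 t v1 v2 : pderiv A c1 t v1 -> pderiv A c2 t v2 ->
  pderiv A (fun s => c1 s - c2 s) t (v1 - v2).
Proof.
move=> h1 /(pderivZ (-1)) h2; rewrite -mulN1r.
have -> : (fun s => c1 s - c2 s) = (fun s => c1 s + -1 * c2 s).
  by apply: funext => s; rewrite mulN1r.
exact: pderivD.
Qed.

Lemma pderiv_cst A (k : cplx R) t : pderiv A (fun=> k) t 0.
Proof.
move=> e e0; exists 1 => // s _ _.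
by rewrite subrr mul0r subrr modulus0 mulr_ge0 // ltW.
Qed.

Lemma pderiv_real A t : pderiv A (fun s => s%:C) t 1.
Proof.
move=> e e0; exists 1 => // s _ _.
by rewrite mul1r rmorphB /= subrr modulus0 mulr_ge0 // ltW.
Qed.

Lemma pderiv_ext A c c' t v (r : R) : 0 < r -> A t ->
  (forall s, A s -> `|s - t| < r -> c s = c' s) ->
  pderiv A c t v -> pderiv A c' t v.
Proof.
move=> r0 At cc' hc e e0; have [r1 r10 H] := hc e e0.
exists (Num.min r r1) => [|s As]; first by rewrite lt_min r0.
by rewrite lt_min => /andP[sr sr1]; rewrite -!cc' ?H // subrr normr0.
Qed.

Lemma cderiv_mean_value h (u v : cplx R) (K : R) :
  (forall s : R, 0 <= s <= 1 -> exists2 d, cderiv h (u + s%:C * (v - u)) d &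
     modulus d <= K) ->
  modulus (h v - h u) <= K * modulus (v - u).
Proof.
move=> H.
pose p (s : R) : cplx R := u + s%:C * (v - u).
have hp s : pderiv setT p s (v - u).
  have := pderivD (pderiv_cst setT u s) (pderivZ (v - u) (pderiv_real setT s)).
  rewrite add0r mulr1; apply: pderiv_ext ltr01 _ _ => // x _ _.
  by rewrite /p mulrC.
have := @mean_value_le setT (h \o p) 0 1 (K * modulus (v - u)) ler01 (fun _ _ => I).
rewrite subr0 mulr1 /p /= mul0r addr0 mul1r [u + _]addrC subrK; apply.
move=> t /H[d hd dK]; exists (d * (v - u)); first exact: cderiv_pderiv.
by rewrite modulusM ler_wpM2r // modulus_ge0.
Qed.

End MeanValue.

Section RealDerivative.
Context {R : realType}.
Implicit Types (g : R -> R).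

Lemma real_derivP g (x d : R) :
  is_derive x 1 g d <-> pderiv setT (fun s => (g s)%:C) x d%:C.
Proof.
have E s t : modulus ((g s)%:C - (g t)%:C - d%:C * (s - t)%:C : cplx R)
    = `|g s - g t - d * (s - t)|.
  by rewrite -!rmorphB -rmorphM -rmorphB /= modulus_real.
have cvgP : (fun k : R => k^-1 *: (g (k *: (1 : R) + x) - g x)) @ (0 : R)^' --> d
    <-> pderiv setT (fun s => (g s)%:C) x d%:C.
  split=> [hl e e0|hl].
    have : nbhs d [set z | `|z - d| < e] by apply/nbhs_realP; exists e.
    move=> /hl; rewrite nbhs_filterE /= => /nbhs_realP[r r0 rP].
    exists r => // z _ zw; rewrite E; have [->|zNw] := eqVneq z x.
      by rewrite !subrr mulr0 subr0 normr0 mulr0.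
    have zw0 : z - x != 0 by rewrite subr_eq0.
    have := rP (z - x); rewrite subr0 => /(_ zw zw0) /=.
    rewrite /GRing.scale /= mulr1 subrK => H.
    have -> : g z - g x - d * (z - x) = ((z - x)^-1 * (g z - g x) - d) * (z - x).
      by rewrite mulrBl mulrAC mulVf // mul1r.
    by rewrite normrM ler_wpM2r // ltW.
  move=> U /nbhs_realP[e e0 eU].
  have [r r0 rP] := hl (e / 2) (divr_gt0 e0 (ltr0n _ 2)).
  rewrite nbhs_filterE /=; apply/nbhs_realP; exists r => // k; rewrite subr0 => kr k0.
  apply: eU; rewrite /GRing.scale /= mulr1.
  have := rP (k + x) I; rewrite E addrK => /(_ kr) H.
  have -> : k^-1 * (g (k + x) - g x) - d = (g (k + x) - g x - d * k) * k^-1.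
    by rewrite mulrBl mulfK // mulrC.
  rewrite normrM normfV ltr_pdivrMr ?normr_gt0 //.
  by apply: le_lt_trans H _; rewrite ltr_pM2r ?normr_gt0 // gtr_pMr // invf_lt1 // ltr1n.
split=> [[dh hd]|/cvgP hd].
  by apply/cvgP; rewrite -hd; exact: dh.
split; first by apply/cvg_ex; exists d.
by apply: cvg_lim => //; exact: norm_hausdorff.
Qed.

Lemma real_antiderivative g (r : R) :
  (forall x, `|x| < r -> {for x, continuous g}) ->
  forall r', r' < r -> exists G : R -> R, forall x, `|x| < r' -> is_derive (x : R) (1 : R) G (g x).
Proof.
move=> cg r' r'r.
pose mu := @lebesgue_measure R.
(* The integral starts at [- r'], to the left of every [x] with [|x| < r'], so reversed bounds never
   occur. *)
exists (fun x => (\int[mu]_(t in `[- r', x]) g t)%R) => x; rewrite ltr_norml => /andP[r'x xr'].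
have cr' : {within `[- r', r'], continuous g}.
  apply: continuous_in_subspaceT => y; rewrite inE /= in_itv /= => /andP[y1 y2].
  by apply: cg; apply: le_lt_trans r'r; rewrite ler_norml y1.
have ig : mu.-integrable `[- r', r'] (EFin \o g).
  by apply: continuous_compact_integrable cr'; exact: segment_compact.
have cx : {for x, continuous g}.
  by apply: cg; rewrite ltr_norml; apply/andP; split; lra.
have [dG <-] := continuous_FTC1_closed xr' ig r'x cx.
by rewrite derive1E; exact: derivableP.
Qed.

Lemma path_antiderivative (c : R -> cplx R) (r : R) :
  (forall x, `|x| < r -> forall e : R, 0 < e -> exists2 d : R, 0 < d &
     forall y, `|y - x| < d -> modulus (c y - c x) < e) ->
  forall r', r' < r -> exists C : R -> cplx R,
    forall x, `|x| < r' -> pderiv setT C x (c x).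
Proof.
move=> cc r' r'r.
have [|G1 H1] := @real_antiderivative (fun x => complex.Re (c x)) r _ r' r'r.
  move=> x xr U /nbhs_realP[e e0 eU]; have [d d0 dP] := cc x xr e e0.
  rewrite nbhs_filterE; apply/nbhs_realP; exists d => // y /dP cy.
  by apply: eU; apply: le_lt_trans cy; rewrite -ReB Re_le_modulus.
have [|G2 H2] := @real_antiderivative (fun x => complex.Im (c x)) r _ r' r'r.
  move=> x xr U /nbhs_realP[e e0 eU]; have [d d0 dP] := cc x xr e e0.
  rewrite nbhs_filterE; apply/nbhs_realP; exists d => // y /dP cy.
  by apply: eU; apply: le_lt_trans cy; rewrite -ImB Im_le_modulus.
exists (fun x => (G1 x)%:C + 'i * (G2 x)%:C) => x xr'.
rewrite (cplxE (c x)); apply: pderivD; first exact/real_derivP/H1.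
exact/pderivZ/real_derivP/H2.
Qed.

End RealDerivative.

(** * Goursat's theorem *)

Section Goursat.
Context {R : realType}.
Implicit Types (D A B : R -> R -> cplx R) (h : cplx R -> cplx R).

(** The increment of [D] over a rectangle: it adds up when the rectangle is cut, and it vanishes on
    functions of [x] alone or of [y] alone. *)
Definition second_difference D (x y l m : R) : cplx R :=
  D (x + l) (y + m) - D (x + l) y - D x (y + m) + D x y.

(** The second difference adds up over the four quarters, so one of them carries at least a fourth
    of the modulus. *)
Lemma quarter D (x y l m : R) : 0 <= l -> 0 <= m ->
  exists p : R * R, [/\ x <= p.1 <= x + l / 2, y <= p.2 <= y + m / 2 &
    modulus (second_difference D x y l m) <=
    4 * modulus (second_difference D p.1 p.2 (l / 2) (m / 2))].
Proof.
move=> l0 m0; set S := modulus _.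
pose Q x' y' := modulus (second_difference D x' y' (l / 2) (m / 2)).
have l2 : 0 <= l / 2 by rewrite divr_ge0.
have m2 : 0 <= m / 2 by rewrite divr_ge0.
have SQ : S <= Q x y + Q (x + l / 2) y + Q x (y + m / 2) + Q (x + l / 2) (y + m / 2).
  have lE : l = l / 2 + l / 2 by field.
  have mE : m = m / 2 + m / 2 by field.
  have -> : S = modulus (second_difference D x y (l / 2) (m / 2) +
      second_difference D (x + l / 2) y (l / 2) (m / 2) +
      second_difference D x (y + m / 2) (l / 2) (m / 2) +
      second_difference D (x + l / 2) (y + m / 2) (l / 2) (m / 2)).
    rewrite /S /second_difference -!(addrA x) -!(addrA y) -lE -mE.
    by congr modulus; ring.
  do 3 (apply: le_trans (modulusD _ _) _; apply: lerD => //).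
have [q1|q1] := leP S (4 * Q x y).
  by exists (x, y); rewrite /= !lexx !lerDl l2 m2.
have [q2|q2] := leP S (4 * Q (x + l / 2) y).
  by exists (x + l / 2, y); rewrite /= !lexx !lerDl l2 m2.
have [q3|q3] := leP S (4 * Q x (y + m / 2)).
  by exists (x, y + m / 2); rewrite /= !lexx !lerDl l2 m2.
exists (x + l / 2, y + m / 2); rewrite /= !lexx !lerDl l2 m2; split=> //.
by move: SQ q1 q2 q3; rewrite -/(Q _ _); lra.
Qed.

(** [u n] is the left end of an interval of length [l / 2^n]. Left ends increase and right ends
    decrease, so the supremum of the left ends lies in every interval. *)
Lemma nested_halves (u : nat -> R) (l : R) : 0 <= l ->
  (forall n, u n <= u n.+1 <= u n + l * 2^-1 ^+ n / 2) ->
  exists x, forall n, u n <= x <= u n + l * 2^-1 ^+ n.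
Proof.
move=> l0 H.
have incr n k : u n <= u (n + k)%N.
  elim: k => [|k IH]; first by rewrite addn0.
  by rewrite addnS (le_trans IH) //; have /andP[] := H (n + k)%N.
have decr n k : u (n + k)%N + l * 2^-1 ^+ (n + k) <= u n + l * 2^-1 ^+ n.
  elim: k => [|k IH]; first by rewrite addn0.
  apply: le_trans IH; rewrite addnS exprSr mulrA.
  by have /andP[_] := H (n + k)%N; lra.
have pw n : 0 <= l * 2^-1 ^+ n by rewrite mulr_ge0 // exprn_ge0 // invr_ge0.
have le n k : u k <= u n + l * 2^-1 ^+ n.
  apply: le_trans (decr n k); rewrite addnC; apply: le_trans (incr k n) _.
  by rewrite lerDl pw.
have bd n : ubound (range u) (u n + l * 2^-1 ^+ n) by move=> _ [k _ <-].
exists (sup (range u)) => n; apply/andP; split.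
  by apply: ub_le_sup; [exists (u 0 + l * 2^-1 ^+ 0) | exists n].
by apply: ge_sup (bd n); exists (u 0), 0.
Qed.

Lemma halves_small (c d : R) : 0 <= c -> 0 < d -> exists n, c * 2^-1 ^+ n < d.
Proof.
move=> c0 d0; exists (Num.bound (c / d)).
rewrite exprVn ltr_pdivrMr ?exprn_gt0 // mulrC -ltr_pdivrMr //.
apply: lt_trans (archi_boundP _) _; first by rewrite divr_ge0 // ltW.
by rewrite -natrX ltr_nat ltn_expl.
Qed.

(* With [A_x = h] and [B_y = i h], the second difference of [B - A] is the
   integral of [h] along the boundary of the rectangle. *)
Lemma goursat A B h (x0 y0 l m : R) : 0 <= l -> 0 <= m ->
  (forall x y, x0 <= x <= x0 + l -> y0 <= y <= y0 + m ->
    [/\ exists d, cderiv h (x +i* y) d,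
        pderiv setT (A^~ y) x (h (x +i* y)) &
        pderiv setT (B x) y ('i * h (x +i* y))]) ->
  second_difference (fun x y => B x y - A x y) x0 y0 l m = 0.
Proof.
move=> l0 m0 H; set D := fun x y => _.
pose q n : R := 2^-1 ^+ n.
have q0 n : 0 <= q n by rewrite exprn_ge0 // invr_ge0.
have /choice[next nextP] : forall np : nat * (R * R), exists p' : R * R,
    [/\ np.2.1 <= p'.1 <= np.2.1 + l * q np.1 / 2,
        np.2.2 <= p'.2 <= np.2.2 + m * q np.1 / 2 &
    modulus (second_difference D np.2.1 np.2.2 (l * q np.1) (m * q np.1)) <=
    4 * modulus (second_difference D p'.1 p'.2 (l * q np.1 / 2) (m * q np.1 / 2))].
  by move=> [n [x y]]; apply: quarter; rewrite mulr_ge0.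
(* [p n] is the lower left corner of the rectangle of sides [l * q n] and [m * q n], a quarter of
   the preceding one. *)
pose p := fix p n := if n is k.+1 then next (k, p k) else (x0, y0).
have qS n k : k * q n.+1 = k * q n / 2 by rewrite /q exprSr mulrA.
have pS n : [/\ (p n).1 <= (p n.+1).1 <= (p n).1 + l * q n / 2,
    (p n).2 <= (p n.+1).2 <= (p n).2 + m * q n / 2 &
    modulus (second_difference D (p n).1 (p n).2 (l * q n) (m * q n)) <=
    4 * modulus (second_difference D (p n.+1).1 (p n.+1).2 (l * q n.+1) (m * q n.+1))].
  by rewrite !qS; exact: (nextP (n, p n)).
have [x xP] : exists x, forall n, (p n).1 <= x <= (p n).1 + l * q n.
  by apply: (@nested_halves (fun n => (p n).1)) => // n; have [] := pS n.
have [y yP] : exists y, forall n, (p n).2 <= y <= (p n).2 + m * q n.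
  by apply: (@nested_halves (fun n => (p n).2)) => // n; have [] := pS n.
have inside n : [/\ x0 <= (p n).1, (p n).1 + l * q n <= x0 + l,
    y0 <= (p n).2 & (p n).2 + m * q n <= y0 + m].
  elim: n => [|n [i1 i2 i3 i4]].
    by rewrite /q !expr0 !mulr1 !lexx.
  have [/andP[a1 a2] /andP[a3 a4] _] := pS n; rewrite !qS.
  by split; move: i1 i2 i3 i4 a1 a2 a3 a4; lra.
have big n : modulus (second_difference D x0 y0 l m) <= 4 ^+ n *
    modulus (second_difference D (p n).1 (p n).2 (l * q n) (m * q n)).
  elim: n => [|n IH]; first by rewrite /q !expr0 !mulr1 mul1r.
  apply: le_trans IH _; rewrite exprSr -mulrA ler_pM2l ?exprn_gt0 //.
  by have [] := pS n.
have xin : x0 <= x <= x0 + l by have := xP 0%N; rewrite /q expr0 mulr1.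
have yin : y0 <= y <= y0 + m by have := yP 0%N; rewrite /q expr0 mulr1.
have [[d hd] _ _] := H x y xin yin.
pose w : cplx R := x +i* y.
(* [L] is the first-order part of [h] at the limit point [w], and [La] is a primitive of [L].
   Subtracting [La] from both [A] and [B] does not change [B - A] and leaves the small derivative
   [h - L] along the edges. *)
pose L (z : cplx R) : cplx R := h w + d * (z - w).
pose La (z : cplx R) : cplx R := h w * z + d * 2^-1 * (z - w) ^+ 2.
have dLa z : cderiv La z (L z).
  have dzw : cderiv (fun z => z - w) z 1.
    by have := cderivB (cderiv_id z) (cderiv_cst w z); rewrite subr0.
  have := cderivD (cderivZ (h w) (cderiv_id z)) (cderivZ (d * 2^-1) (cderivX 2 dzw)).
  suff -> : h w * 1 + d * 2^-1 * (2%:R * (z - w) ^+ 2.-1 * 1) = L z by [].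
  have n2 : (2%:R : complex R) != 0 by rewrite pnatr_eq0.
  by rewrite /L /= expr1 !mulr1 mulrA -(mulrA d) (mulVf n2) mulr1.
have dx (t s : R) : pderiv setT (fun t => (t +i* s : cplx R)) t 1.
  have := pderivD (pderiv_real setT t) (pderiv_cst setT ('i * s%:C) t).
  rewrite addr0; apply: pderiv_ext ltr01 _ _ => // u _ _.
  by rewrite [RHS]cplxE.
have dy (t s : R) : pderiv setT (fun s => (t +i* s : cplx R)) s 'i.
  have := pderivD (pderiv_cst setT (t%:C) s) (pderivZ 'i (pderiv_real setT s)).
  rewrite add0r mulr1; apply: pderiv_ext ltr01 _ _ => // u _ _.
  by rewrite [RHS]cplxE.
apply/eqP; rewrite -modulus_eq0 eq_le modulus_ge0 andbT.
have lm0 : 0 <= l + m by rewrite addr_ge0.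
(* Each of the four edges contributes at most [e ((l + m) q n)^2]; the factor [4^n] of the
   subdivision cancels [(q n)^2], which leaves [e] times this constant. *)
apply: (@le_of_slope _ _ _ (4 * (l + m) ^+ 2)); first by rewrite mulr_ge0 // sqr_ge0.
move=> e e0; rewrite add0r.
have [r r0 rP] := hd e e0.
have [n nr] := halves_small lm0 r0.
apply: le_trans (big n) _; set u := (p n).1; set v := (p n).2.
have sg0 : 0 <= (l + m) * q n by rewrite mulr_ge0.
have /andP[xu xu'] := xP n; have /andP[yv yv'] := yP n; rewrite -/u -/v in xu xu' yv yv'.
have [i1 i2 i3 i4] := inside n; rewrite -/u -/v in i1 i2 i3 i4.
have lq0 : 0 <= l * q n by rewrite mulr_ge0.
have mq0 : 0 <= m * q n by rewrite mulr_ge0.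
have close s t : u <= s <= u + l * q n -> v <= t <= v + m * q n ->
    modulus (h (s +i* t) - L (s +i* t)) <= e * ((l + m) * q n).
  move=> /andP[s1 s2] /andP[t1 t2].
  have zw : modulus ((s +i* t) - w) <= (l + m) * q n.
    apply: le_trans (modulus_le _) _; rewrite ReB ImB /= mulrDl lerD // ler_norml.
      by apply/andP; split; lra.
    by apply/andP; split; lra.
  have := rP (s +i* t) (le_lt_trans zw nr).
  rewrite /L opprD addrA => H1; apply: le_trans H1 _.
  by rewrite ler_pM2l.
have edge_x t : v <= t <= v + m * q n ->
    modulus ((A (u + l * q n) t - La ((u + l * q n) +i* t)) - (A u t - La (u +i* t)))
    <= e * ((l + m) * q n) ^+ 2.
  move=> tv.
  have := @mean_value_le _ setT (fun s => A s t - La (s +i* t)) u (u + l * q n)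
    (e * ((l + m) * q n)) _ (fun _ _ => I).
  have -> : u + l * q n - u = l * q n by rewrite addrAC subrr add0r.
  move=> H1; apply: le_trans (H1 _ _) _.
  - by rewrite lerDl.
  - move=> s su; exists (h (s +i* t) - L (s +i* t)); last exact: close.
    apply: pderivB.
      by have [||_ H2 _] := H s t; [move: su tv; lra | move: su tv; lra |].
    by rewrite -[L _]mulr1; apply: (@cderiv_pderiv _ _ _ (fun s => s +i* t)).
  - by rewrite expr2 [leRHS]mulrA ler_wpM2l ?mulr_ge0 ?(ltW e0) // mulrDl lerDl.
have edge_y s : u <= s <= u + l * q n ->
    modulus ((B s (v + m * q n) - La (s +i* (v + m * q n))) - (B s v - La (s +i* v)))
    <= e * ((l + m) * q n) ^+ 2.
  move=> su.
  have := @mean_value_le _ setT (fun t => B s t - La (s +i* t)) v (v + m * q n)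
    (e * ((l + m) * q n)) _ (fun _ _ => I).
  have -> : v + m * q n - v = m * q n by rewrite addrAC subrr add0r.
  move=> H1; apply: le_trans (H1 _ _) _.
  - by rewrite lerDl.
  - move=> t tv; exists ('i * (h (s +i* t) - L (s +i* t))); last first.
      by rewrite modulusM modulus_i mul1r; exact: close.
    rewrite mulrBr; apply: pderivB.
      by have [||_ _] := H s t; [move: su tv; lra | move: su tv; lra |].
    by rewrite ['i * _]mulrC; apply: (@cderiv_pderiv _ _ _ (fun t => s +i* t)).
  - by rewrite expr2 [leRHS]mulrA ler_wpM2l ?mulr_ge0 ?(ltW e0) // mulrDl lerDr.
have uu : u <= u <= u + l * q n by rewrite lexx lerDl.
have uu' : u <= u + l * q n <= u + l * q n by rewrite lexx lerDl lq0.
have vv : v <= v <= v + m * q n by rewrite lexx lerDl.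
have vv' : v <= v + m * q n <= v + m * q n by rewrite lexx lerDl mq0.
have sm : modulus (second_difference D u v (l * q n) (m * q n)) <=
    4 * (e * ((l + m) * q n) ^+ 2).
  have := edge_x _ vv; have := edge_x _ vv'; have := edge_y _ uu; have := edge_y _ uu'.
  set e1 := _ - _; set e2 := (_ - (B u v - _)).
  set e3 := (_ - (A u (v + _) - _)); set e4 := (_ - (A u v - _)).
  have -> : second_difference D u v (l * q n) (m * q n) = e1 - e2 - (e3 - e4).
    by rewrite /second_difference /D /e1 /e2 /e3 /e4; ring.
  move=> h1 h2 h3 h4; apply: le_trans (modulusB _ _) _.
  by have := modulusB e1 e2; have := modulusB e3 e4; lra.
apply: le_trans (ler_wpM2l _ sm) _; first exact: exprn_ge0.
have qq : 4 ^+ n * q n ^+ 2 = 1.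
  rewrite /q exprAC expr2 -exprMn.
  have -> : 4 * (2^-1 * 2^-1) = 1 :> R by field.
  by rewrite expr1n.
rewrite exprMn.
have -> : 4 ^+ n * (4 * (e * ((l + m) ^+ 2 * q n ^+ 2))) =
    (4 ^+ n * q n ^+ 2) * (e * (4 * (l + m) ^+ 2)) by ring.
by rewrite qq mul1r.
Qed.

End Goursat.

(** * Local primitives of holomorphic functions *)

Section Primitive.
Context {R : realType}.
Implicit Types (h F G k : cplx R -> cplx R).

Lemma cplx_pairE (x y : R) : (x +i* y : cplx R) = x%:C + 'i * y%:C.
Proof. exact: (cplxE (x +i* y)). Qed.

Lemma pderiv_horizontal (A : set R) (t s : R) :
  pderiv A (fun t => (t +i* s : cplx R)) t 1.
Proof.
have := pderivD (pderiv_real A t) (pderiv_cst A ('i * s%:C) t).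
rewrite addr0 => H e /H[r r0 rP]; exists r => // u Au ur.
by have := rP u Au ur; rewrite -!cplx_pairE.
Qed.

Lemma pderiv_vertical (A : set R) (t s : R) :
  pderiv A (fun s => (t +i* s : cplx R)) s 'i.
Proof.
have := pderivD (pderiv_cst A (t%:C) s) (pderivZ 'i (pderiv_real A s)).
rewrite add0r mulr1 => H e /H[r r0 rP]; exists r => // u Au ur.
by have := rP u Au ur; rewrite -!cplx_pairE.
Qed.

(** Subtracting the linear map [h (x +i* y) * z] leaves partial derivatives that are small because
    [h] is continuous; the mean value inequality then applies on a horizontal and on a vertical
    leg. *)
Lemma cauchy_riemann_cderiv (P : R -> R -> cplx R) h (r : R) :
  (forall x y, `|x| < r -> `|y| < r ->
    [/\ pderiv setT (P^~ y) x (h (x +i* y)), pderiv setT (P x) y ('i * h (x +i* y)) &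
        exists d, cderiv h (x +i* y) d]) ->
  forall x y, `|x| < r -> `|y| < r ->
    cderiv (fun z => P (complex.Re z) (complex.Im z)) (x +i* y) (h (x +i* y)).
Proof.
move=> H x y xr yr e e0.
have [_ _ [d hd]] := H x y xr yr.
have e2 : 0 < e / 2 by rewrite divr_gt0.
have [r1 r10 r1P] := cderiv_continuous hd e2.
(* Each coordinate moves by less than [r1 / 2], so both legs stay in the disc of radius [r1], where
   [h] varies by less than [e / 2], and inside the square. *)
pose r2 := Num.min (r1 / 2) (Num.min (r - `|x|) (r - `|y|)).
exists r2; first by rewrite !lt_min divr_gt0 //= !subr_gt0 xr.
case=> x' y'; rewrite !lt_min => /and3P[zr1 zrx zry] /=.
set m := modulus _ in zr1 zrx zry *.
have m0 : 0 <= m by exact: modulus_ge0.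
have xm : `|x' - x| <= m by have := Re_le_modulus ((x' +i* y') - (x +i* y)).
have ym : `|y' - y| <= m by have := Im_le_modulus ((x' +i* y') - (x +i* y)).
have xb t : `|t - x| <= `|x' - x| -> `|t| < r.
  by have := ler_normD (t - x) x; rewrite subrK; lra.
have yb t : `|t - y| <= `|y' - y| -> `|t| < r.
  by have := ler_normD (t - y) y; rewrite subrK; lra.
have hb s t : `|s - x| <= `|x' - x| -> `|t - y| <= `|y' - y| ->
    modulus (h (s +i* t) - h (x +i* y)) <= e / 2.
  move=> sx ty; apply/ltW/r1P; apply: le_lt_trans (modulus_le _) _.
  by rewrite ReB ImB /=; lra.
have Ex : modulus ((P x' y' - h (x +i* y) * (x' +i* y')) - (P x y' - h (x +i* y) * (x +i* y')))
    <= e / 2 * `|x' - x|.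
  apply: (@mean_value_le_sym _ setT
    (fun s => P s y' - h (x +i* y) * (s +i* y'))) => // s /between_dist sx.
  exists (h (s +i* y') - h (x +i* y)); last exact: hb.
  have [||H1 _ _] := H s y'; [exact: xb | exact: yb |].
  apply: pderivB => //; rewrite -[X in pderiv _ _ _ X]mulr1.
  exact/pderivZ/pderiv_horizontal.
have Ey : modulus ((P x y' - h (x +i* y) * (x +i* y')) - (P x y - h (x +i* y) * (x +i* y)))
    <= e / 2 * `|y' - y|.
  apply: (@mean_value_le_sym _ setT
    (fun t => P x t - h (x +i* y) * (x +i* t))) => // t /between_dist ty.
  exists ('i * h (x +i* t) - h (x +i* y) * 'i); last first.
    rewrite -(mulrC 'i) -mulrBr modulusM modulus_i mul1r; apply: hb => //.
    by rewrite subrr normr0.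
  have [||_ H1 _] := H x t; [by [] | exact: yb |].
  apply: pderivB => //; exact/pderivZ/pderiv_vertical.
have -> : P x' y' - P x y - h (x +i* y) * ((x' +i* y') - (x +i* y)) =
   ((P x' y' - h (x +i* y) * (x' +i* y')) - (P x y' - h (x +i* y) * (x +i* y'))) +
   ((P x y' - h (x +i* y) * (x +i* y')) - (P x y - h (x +i* y) * (x +i* y))) by ring.
apply: le_trans (modulusD _ _) _; apply: le_trans (lerD Ex Ey) _.
rewrite -mulrDr (le_trans (ler_wpM2l (ltW e2) (lerD xm ym))) //.
by lra.
Qed.

(** Integration gives primitives [A y] along horizontals and [B x] along verticals, each with its
    own arbitrary constant. By Goursat [B - A] is a function of [x] plus a function of [y], which is
    what makes the constants reconcilable. *)
Lemma primitive_on_square h (r : R) :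
  (forall x y, `|x| < r -> `|y| < r -> exists d, cderiv h (x +i* y) d) ->
  forall r', r' < r -> exists F, forall x y, `|x| < r' -> `|y| < r' ->
    cderiv F (x +i* y) (h (x +i* y)).
Proof.
move=> hh r' r'r.
have /choice[A HA] : forall y, exists A : R -> cplx R, `|y| < r' ->
    forall x, `|x| < r' -> pderiv setT A x (h (x +i* y)).
  move=> y; have [yr'|] := ltP `|y| r'; last by exists (fun=> 0).
  have [|A HA] := @path_antiderivative R (fun x => h (x +i* y)) r _ r' r'r.
    move=> x xr e e0; have [d hd] := hh x y xr (lt_trans yr' r'r).
    have [d0 d00 H] := pderiv_continuous (cderiv_pderiv (pderiv_horizontal setT x y) hd) e0.
    by exists d0 => // z; exact: H.
  by exists A.
have /choice[B HB] : forall x, exists B : R -> cplx R, `|x| < r' ->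
    forall y, `|y| < r' -> pderiv setT B y ('i * h (x +i* y)).
  move=> x; have [xr'|] := ltP `|x| r'; last by exists (fun=> 0).
  have [|B HB] := @path_antiderivative R (fun y => 'i * h (x +i* y)) r _ r' r'r.
    move=> y yr e e0; have [d hd] := hh x y (lt_trans xr' r'r) yr.
    have [d0 d00 H] := pderiv_continuous
      (pderivZ 'i (cderiv_pderiv (pderiv_vertical setT x y) hd)) e0.
    by exists d0 => // z; exact: H.
  by exists B.
pose D x y := B x y - A y x.
have D0 x1 x2 y1 y2 : `|x1| < r' -> `|x2| < r' -> `|y1| < r' -> `|y2| < r' ->
    D x2 y2 - D x2 y1 - D x1 y2 + D x1 y1 = 0.
  wlog xx : x1 x2 / x1 <= x2.
    move=> W ? ? ? ?; have [?|/ltW ?] := leP x1 x2; first exact: W.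
    by apply/eqP; rewrite -oppr_eq0 -(W x2 x1) //; apply/eqP; ring.
  wlog yy : y1 y2 / y1 <= y2.
    move=> W ? ? ? ?; have [?|/ltW ?] := leP y1 y2; first exact: W.
    by apply/eqP; rewrite -oppr_eq0 -(W y2 y1) //; apply/eqP; ring.
  rewrite !ltr_norml => /andP[? ?] /andP[? ?] /andP[? ?] /andP[? ?].
  have := @goursat _ (fun x y => A y x) B h x1 y1 (x2 - x1) (y2 - y1).
  rewrite !subr_ge0 => /(_ xx yy).
  have addE (a b : R) : a + (b - a) = b by rewrite addrCA subrr addr0.
  rewrite /second_difference !addE; apply=> x y /andP[? ?] /andP[? ?].
  have xr' : `|x| < r' by rewrite ltr_norml; apply/andP; split; lra.
  have yr' : `|y| < r' by rewrite ltr_norml; apply/andP; split; lra.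
  by split; [apply: hh; exact: lt_trans r'r | exact: HA | exact: HB].
(* Adding [D 0 y] does not affect the horizontal derivative, and [P x y - B x y] now depends on [x]
   alone, so the vertical derivative is right as well. *)
pose P x y := A y x + D 0 y.
exists (fun z => P (complex.Re z) (complex.Im z)).
apply: cauchy_riemann_cderiv => x y xr yr; split.
- rewrite -[h _]addr0; apply: pderivD; first exact: HA.
  exact: pderiv_cst.
- have r0 : 0 < r' by rewrite (le_lt_trans (normr_ge0 x)).
  rewrite -['i * _]addr0.
  apply: (@pderiv_ext _ _ (fun y => B x y + (D 0 0 - D x 0)) _ _ _ (r' - `|y|)) => //.
  + by rewrite subr_gt0.
  + move=> y' _ y'y; have y'r : `|y'| < r'.
      by have := ler_normD (y' - y) y; rewrite subrK; lra.
    have := D0 0 x 0 y'; rewrite normr0 => /(_ r0 xr r0 y'r) H.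
    rewrite /P; have -> : D 0 y' = D x y' - D x 0 + D 0 0 by rewrite -[LHS]addr0 -H; ring.
    by rewrite /D; ring.
  + by apply: pderivD; [exact: HB | exact: pderiv_cst].
- by apply: hh; exact: lt_trans r'r.
Qed.

Lemma primitive_on_disc h (w0 : cplx R) (r : R) : 0 < r ->
  (forall w, modulus (w - w0) < r -> exists d, cderiv h w d) ->
  exists F, forall w, modulus (w - w0) < r / 3 -> cderiv F w (h w).
Proof.
move=> r0 hh.
have sh w (a : cplx R) : cderiv (fun z => z + a) w 1.
  by have := cderivD (cderiv_id w) (cderiv_cst a w); rewrite addr0.
(* The square of half-side [r / 2] fits in the disc of radius [r], as the modulus is at most the sum
   of the absolute coordinates; [r / 3] is a choice strictly below [r / 2]. *)
have [||F HF] := @primitive_on_square (fun z => h (z + w0)) (r / 2) _ (r / 3).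
- move=> x y xr yr; have [|d hd] := hh ((x +i* y) + w0).
    by rewrite addrK; apply: le_lt_trans (modulus_le _) _ => /=; lra.
  by exists (d * 1); apply: (@cderiv_comp _ h (fun z => z + w0)).
- by lra.
exists (fun z => F (z - w0)) => w wr.
have := HF (complex.Re (w - w0)) (complex.Im (w - w0)).
have -> : (complex.Re (w - w0)) +i* (complex.Im (w - w0)) = w - w0 by case: (w - w0).
rewrite subrK => H; rewrite -[h w]mulr1.
apply: (@cderiv_comp _ F (fun z => z - w0)) => //; apply: H; apply: le_lt_trans wr.
  exact: Re_le_modulus.
exact: Im_le_modulus.
Qed.

(** With [c = 1 / G w0], the increment of [F] is [c / (n+1) (w - w0)^(n+1)] up to an error with
    derivative [(w - w0)^n (1 / G - c)], so [w0] is isolated in its fibre, with a uniform bound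
    outside each smaller disc. *)
Lemma primitive_isolated F G (w0 : cplx R) n (r : R) : 0 < r ->
  (forall w, modulus (w - w0) < r -> cderiv F w ((w - w0) ^+ n / G w)) ->
  G w0 != 0 -> (exists d, cderiv G w0 d) ->
  exists r2, [/\ 0 < r2, r2 <= r & forall rho : R, 0 < rho ->
    exists2 d : R, 0 < d & forall w, rho <= modulus (w - w0) ->
      modulus (w - w0) < r2 -> d <= modulus (F w - F w0)].
Proof.
move=> r0 HF G0 [d Gd].
pose c := (G w0)^-1; have c0 : c != 0 by rewrite invr_eq0.
have n0 : (n.+1%:R : R) != 0 by rewrite pnatr_eq0.
(* The main term has modulus [2 eta |w - w0|^(n+1)]; where [|1 / G - c| < eta] the error is at most
   half of it. *)
pose eta := modulus c / n.+1%:R / 2.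
have eta0 : 0 < eta by rewrite !divr_gt0 ?modulus_gt0.
have [d' Vd] := cderivV G0 Gd.
have [r1 r10 r1P] := cderiv_continuous Vd eta0.
exists (Num.min r r1); split; rewrite ?ge_min ?lexx ?lt_min ?r0 // => rho rho0.
exists (eta * rho ^+ n.+1); first by rewrite mulr_gt0 // exprn_gt0.
move=> w rw; rewrite lt_min => /andP[wr wr1].
set m := modulus (w - w0) in rw wr wr1.
have m0 : 0 <= m by exact: modulus_ge0.
pose E z := F z - c / n.+1%:R * (z - w0) ^+ n.+1.
have cn : (n.+1%:R : complex R) != 0 by rewrite pnatr_eq0.
have dE z : modulus (z - w0) < r -> cderiv E z ((z - w0) ^+ n * ((G z)^-1 - c)).
  move=> zr; have dzw : cderiv (fun z => z - w0) z 1.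
    by have := cderivB (cderiv_id z) (cderiv_cst w0 z); rewrite subr0.
  have := cderivB (HF z zr) (cderivZ (c / n.+1%:R) (cderivX n.+1 dzw)).
  suff -> : (z - w0) ^+ n / G z - c / n.+1%:R * (n.+1%:R * (z - w0) ^+ n.+1.-1 * 1) =
            (z - w0) ^+ n * ((G z)^-1 - c) by [].
  by rewrite /= mulr1 !mulrA (mulfVK cn) mulrBr mulrC [_ * c]mulrC.
have EE : modulus (E w - E w0) <= (m ^+ n * eta) * m.
  apply: cderiv_mean_value => s /andP[s0 s1].
  have zm : modulus (w0 + s%:C * (w - w0) - w0) <= m.
    rewrite addrAC subrr add0r modulusM modulus_real ger0_norm //.
    by rewrite ler_piMl.
  exists ((w0 + s%:C * (w - w0) - w0) ^+ n * ((G (w0 + s%:C * (w - w0)))^-1 - c)).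
    by apply: dE; exact: le_lt_trans wr.
  rewrite modulusM modulusX ler_pM ?exprn_ge0 ?modulus_ge0 //.
    by rewrite lerXn2r ?nnegrE ?modulus_ge0.
  by apply/ltW/r1P; exact: le_lt_trans wr1.
have FE : F w - F w0 = c / n.+1%:R * (w - w0) ^+ n.+1 + (E w - E w0).
  by rewrite /E subrr expr0n /= mulr0 subr0; ring.
have : modulus (F w - F w0) >= 2 * eta * m ^+ n.+1 - m ^+ n * eta * m.
  have -> : 2 * eta * m ^+ n.+1 = modulus (c / n.+1%:R * (w - w0) ^+ n.+1).
    rewrite !modulusM modulusX modulusV -/m.
    have -> : modulus (n.+1%:R : cplx R) = n.+1%:R.
      by rewrite -(rmorph_nat (real_complex R)) modulus_real normr_nat.
    by rewrite /eta; field.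
  rewrite FE; apply: le_trans (lerB (lexx _) EE) _.
  have := modulus_sub_ge (c / n.+1%:R * (w - w0) ^+ n.+1) (- (E w - E w0)).
  by rewrite modulusN opprK.
apply: le_trans.
have -> : 2 * eta * m ^+ n.+1 - m ^+ n * eta * m = eta * m ^+ n.+1.
  by rewrite exprS; ring.
by rewrite ler_pM2l // lerXn2r ?nnegrE ?(ltW rho0).
Qed.

End Primitive.

(** * Flow of a holomorphic function *)

Section Flow.
Context {R : realType}.
Implicit Types (f F k : cplx R -> cplx R).

Lemma nbhs_pairP (p : R * R) (U : set (R * R)) :
  nbhs p U <-> exists2 r : R, 0 < r &
    forall x y, `|x - p.1| < r -> `|y - p.2| < r -> U (x, y).
Proof.
split=> [/nbhs_ballP [e e0 eU]|[r r0 rU]].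
  by exists e => // x y xe ye; apply: eU; split; rewrite -ball_normE /= distrC.
apply/nbhs_ballP; exists r => // -[x y] [/=].
by rewrite -!ball_normE /= !(distrC _ x) !(distrC _ y); exact: rU.
Qed.

Lemma square_compact (s : R) : compact ([set x : R | `|x| <= s] `*` [set y : R | `|y| <= s]).
Proof.
have -> : [set x : R | `|x| <= s] = `[- s, s]%classic.
  by apply/seteqP; split=> x; rewrite /= in_itv /= ler_norml.
by apply: compact_setX; exact: segment_compact.
Qed.

Lemma continuous_from_square (T : topologicalType) (g : cplx R -> T) (w0 : cplx R)
    (x y : R) : {for w0 + (x +i* y), continuous g} ->
  {for (x, y), continuous (fun p : R * R => g (w0 + (p.1 +i* p.2)))}.
Proof.
move=> cg U /cg; rewrite !nbhs_filterE => /nbhs_cplxP[r r0 rP].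
apply/nbhs_pairP; exists (r / 2) => [|x' y' /= xx yy]; first by rewrite divr_gt0.
apply: rP; apply: le_lt_trans (modulus_le _) _.
by rewrite opprD addrACA subrr add0r ReB ImB /=; lra.
Qed.

(** [F - c z] is Lipschitz with constant [|c| / 2] on the disc, which is convex, whereas [c z]
    expands distances by [|c|]. *)
Lemma cderiv_injective F k (w0 c : cplx R) (r : R) :
  (forall w, modulus (w - w0) < r ->
     cderiv F w (k w) /\ modulus (k w - c) <= modulus c / 2) ->
  forall w w', modulus (w - w0) < r -> modulus (w' - w0) < r ->
    modulus c / 2 * modulus (w' - w) <= modulus (F w' - F w).
Proof.
move=> H w w' wr w'r.
pose E z := F z - c * z.
have EE : modulus (E w' - E w) <= modulus c / 2 * modulus (w' - w).
  apply: cderiv_mean_value => s /andP[s0 s1].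
  have sr : modulus (w + s%:C * (w' - w) - w0) < r.
    have -> : w + s%:C * (w' - w) - w0 = s%:C * (w' - w0) + (1 - s)%:C * (w - w0).
      by rewrite rmorphB /= rmorph1; ring.
    apply: le_lt_trans (modulusD _ _) _.
    rewrite !modulusM !modulus_real !ger0_norm ?subr_ge0 //.
    have [->|sN0] := eqVneq s 0; first by rewrite mul0r add0r subr0 mul1r.
    have s_gt0 : 0 < s by rewrite lt_def sN0.
    have -> : r = s * r + (1 - s) * r by ring.
    by rewrite ltr_leD ?ltr_pM2l // ler_wpM2l ?subr_ge0 // ltW.
  have [Fd kc] := H _ sr.
  exists (k (w + s%:C * (w' - w)) - c) => //.
  by apply: cderivB => //; rewrite -[X in cderiv _ _ X]mulr1; exact/cderivZ/cderiv_id.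
have -> : F w' - F w = c * (w' - w) - - (E w' - E w) by rewrite /E; ring.
apply: le_trans (modulus_sub_ge _ _).
by rewrite modulusN modulusM; move: EE; lra.
Qed.

(* A minimum of [|F - F w0 - tau|] over a small square is interior, hence 0. *)
Lemma cderiv_locally_onto F k (w0 c : cplx R) (r : R) : 0 < r -> c != 0 ->
  (forall w, modulus (w - w0) < r ->
     cderiv F w (k w) /\ modulus (k w - c) <= modulus c / 2) ->
  exists2 d : R, 0 < d & forall tau : cplx R, modulus tau < d ->
    exists2 w, modulus (w - w0) < r & F w = F w0 + tau.
Proof.
move=> r0 c0 H; have c_gt0 : 0 < modulus c by rewrite modulus_gt0.
pose s := r / 3; have s0 : 0 < s by rewrite divr_gt0.
have w0r : modulus (w0 - w0) < r by rewrite subrr modulus0.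
(* At the minimum [|F w - F w0| <= 2 |tau| < |c| s / 2], and [cderiv_injective] then puts [w] within
   [s] of [w0], hence in the interior of the square. *)
exists (modulus c / 4 * s) => [|tau taud]; first by rewrite mulr_gt0 // divr_gt0.
pose N w := modulus (F w - F w0 - tau).
pose S := [set x : R | `|x| <= s] `*` [set y : R | `|y| <= s].
have Sr x y : S (x, y) -> modulus (w0 + (x +i* y) - w0) < r.
  move=> [/= xs ys]; rewrite addrAC subrr add0r.
  by apply: le_lt_trans (modulus_le _) _ => /=; rewrite /s in xs ys *; lra.
have cN w : modulus (w - w0) < r -> {for w, continuous N}.
  move=> wr; have [Fd _] := H w wr.
  move=> U /nbhs_realP[e e0 eU]; rewrite nbhs_filterE; apply/nbhs_cplxP.
  have [d d0 dP] := cderiv_continuous Fd e0; exists d => // z /dP zd.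
  apply: eU; apply: le_lt_trans zd; rewrite /N ler_norml.
  have := modulus_triangle (F z) (F w) (F w0 + tau).
  have := modulus_triangle (F w) (F z) (F w0 + tau).
  rewrite (modulus_distC (F w) (F z)) !opprD !addrA => ? ?.
  by apply/andP; split; lra.
have [|||[x0 y0] + minP] := @compact_EVT_min _ _ (fun p : R * R => N (w0 + (p.1 +i* p.2))) S.
- by exists (0, 0); split; rewrite /= normr0 ltW.
- exact: square_compact.
- apply: continuous_in_subspaceT => -[x y]; rewrite inE => Sxy.
  by apply: continuous_from_square; exact/cN/Sr.
rewrite inE /= => S0; set w := w0 + _ in minP *.
have wr : modulus (w - w0) < r by exact: Sr.
have {}minP x y : S (x, y) -> N w <= N (w0 + (x +i* y)).
  by move=> Sxy; apply: (minP (x, y)); rewrite inE.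
have Nw : N w <= modulus tau.
  have := minP 0 0; have -> : w0 + (0 +i* 0) = w0 by exact: addr0.
  rewrite /N subrr sub0r modulusN; apply.
  by split; rewrite /= normr0 ltW.
have wlow : modulus (w - w0) < s.
  have := cderiv_injective H w0r wr => low.
  have : modulus (F w - F w0) <= N w + modulus tau.
    by rewrite /N; apply: le_trans (modulusD _ _); rewrite subrK.
  move=> up; have : modulus c / 2 * modulus (w - w0) < modulus c / 2 * s by lra.
  by rewrite ltr_pM2l // divr_gt0.
have xys : `|x0| < s /\ `|y0| < s.
  have <- : complex.Re (w - w0) = x0 by rewrite /w addrAC subrr add0r.
  have <- : complex.Im (w - w0) = y0 by rewrite /w addrAC subrr add0r.
  by split; apply: le_lt_trans wlow; [exact: Re_le_modulus | exact: Im_le_modulus].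
exists w => //; apply/eqP; rewrite -subr_eq0 opprD addrA -modulus_eq0.
have [//|N0] := eqVneq; exfalso.
have {}N0 : 0 < N w by rewrite lt_def N0 modulus_ge0.
have [Fd kc] := H w wr.
have k0 : k w != 0.
  apply/eqP => k0; move: kc; rewrite k0 sub0r modulusN => kc; lra.
(* Newton's direction: to first order the step [t1 v] multiplies the defect [F w - F w0 - tau] by
   [1 - t1]. The remainder costs at most [t1 N w / 2], so the defect strictly decreases. *)
pose v := - (F w - F w0 - tau) / k w.
have v0 : 0 < modulus v by rewrite /v modulusM modulusV modulusN divr_gt0 // modulus_gt0.
have e0 : 0 < N w / modulus v / 2 by rewrite !divr_gt0.
have [d d0 dP] := Fd _ e0.
have [xs ys] := xys.
pose t := Num.min (d / 2) (Num.min (s - `|x0|) (s - `|y0|)) / modulus v.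
have t0 : 0 < t by rewrite divr_gt0 // !lt_min !subr_gt0 xs ys divr_gt0.
pose t1 := Num.min 1 t.
have t10 : 0 < t1 by rewrite lt_min ltr01.
have t11 : t1 <= 1 by rewrite ge_min lexx.
have t1v : t1 * modulus v <= Num.min (d / 2) (Num.min (s - `|x0|) (s - `|y0|)).
  by rewrite -ler_pdivlMr // ge_min lexx orbT.
move: t1v; rewrite !le_min => /and3P[tvd tvx tvy].
have tvm : modulus (t1%:C * v) = t1 * modulus v.
  by rewrite modulusM modulus_real gtr0_norm.
have := dP (w + t1%:C * v); rewrite addrAC subrr add0r tvm => /(_ ltac:(lra)) step.
have S1 : S (x0 + complex.Re (t1%:C * v), y0 + complex.Im (t1%:C * v)).
  split=> /=; apply: le_trans (ler_normD _ _) _.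
    by have := Re_le_modulus (t1%:C * v); rewrite tvm; lra.
  by have := Im_le_modulus (t1%:C * v); rewrite tvm; lra.
have := minP _ _ S1.
have -> : w0 + ((x0 + complex.Re (t1%:C * v)) +i* (y0 + complex.Im (t1%:C * v))) = w + t1%:C * v.
  by rewrite /w -addrA; congr (_ + _); case: (t1%:C * v).
apply/negP; rewrite -ltNge {1}/N.
have -> : F (w + t1%:C * v) - F w0 - tau =
   (F (w + t1%:C * v) - F w - k w * (t1%:C * v)) + (1 - t1)%:C * (F w - F w0 - tau).
  have -> : k w * (t1%:C * v) = - t1%:C * (F w - F w0 - tau).
    by rewrite mulrCA /v (mulrC (k w)) (mulfVK k0) mulrN mulNr.
  by rewrite rmorphB /= rmorph1; ring.
apply: le_lt_trans (modulusD _ _) _.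
rewrite modulusM modulus_real ger0_norm ?subr_ge0 // -/(N w).
have : N w / modulus v / 2 * (t1 * modulus v) = t1 * N w / 2 by field; rewrite gt_eqF.
move=> E; rewrite E in step; have : 0 < t1 * N w by rewrite mulr_gt0.
by move: step; lra.
Qed.

(** [dw / f] has a primitive [F] near [w0], and the flow solves [F (u t) = F w0 + t]: existence
    comes from [cderiv_locally_onto], the Lipschitz bound on [u] from [cderiv_injective]. *)
Lemma local_flow f (w0 : cplx R) (r : R) : 0 < r ->
  (forall w, modulus (w - w0) < r -> exists d, cderiv f w d) -> f w0 != 0 ->
  exists (d : R) (u : R -> cplx R), [/\ 0 < d, u 0 = w0 &
    forall t, `|t| < d -> modulus (u t - w0) < r /\
      pderiv [set t | `|t| < d] u t (f (u t))].
Proof.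
move=> r0 hf f0.
have w0r : modulus (w0 - w0) < r by rewrite subrr modulus0.
have [d0 fd0] := hf w0 w0r.
have [r1 r10 r1P] : exists2 r1 : R, 0 < r1 & forall w, modulus (w - w0) < r1 -> f w != 0.
  have [|r1 r10 r1P] := cderiv_continuous fd0 (e := modulus (f w0)).
    by rewrite modulus_gt0.
  exists r1 => // w /r1P; apply: contraTneq => ->.
  by rewrite sub0r modulusN ltxx.
pose k w := (f w)^-1.
have r2 : 0 < Num.min r r1 by rewrite lt_min r0.
have [w|F HF] := @primitive_on_disc _ k w0 _ r2.
  by rewrite lt_min => /andP[/hf[d hd] /r1P fw]; exact: cderivV fw hd.
pose c := k w0; have c0 : c != 0 by rewrite invr_eq0.
have c20 : 0 < modulus c / 2 by rewrite divr_gt0 ?modulus_gt0.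
have [d' kd] := cderivV f0 fd0.
have [r3 r30 r3P] := cderiv_continuous kd c20.
pose rho := Num.min (Num.min r r1 / 3) r3.
have rho0 : 0 < rho by rewrite lt_min r30 divr_gt0.
have Hc w : modulus (w - w0) < rho ->
    cderiv F w (k w) /\ modulus (k w - c) <= modulus c / 2.
  rewrite lt_min => /andP[wr1 wr3]; split; first exact: HF.
  by apply/ltW/r3P.
have rhor w : modulus (w - w0) < rho -> modulus (w - w0) < r /\ modulus (w - w0) < r1.
  rewrite lt_min => /andP[+ _]; have m0 := modulus_ge0 (w - w0).
  have : Num.min r r1 <= r /\ Num.min r r1 <= r1 by rewrite !ge_min !lexx orbT.
  by move=> [? ?] ?; split; lra.
have [d dgt0 dP] := cderiv_locally_onto rho0 c0 Hc.
have /choice[u uP] : forall t : R, exists w, `|t| < d ->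
    modulus (w - w0) < rho /\ F w = F w0 + t%:C.
  move=> t; have [td|] := ltP `|t| d; last by exists w0.
  by have [|w] := dP t%:C; [rewrite modulus_real | exists w].
exists d, u; split=> //.
  have [|u0 Fu0] := uP 0; first by rewrite normr0.
  have w0rho : modulus (w0 - w0) < rho by rewrite subrr modulus0.
  have := cderiv_injective Hc u0 w0rho.
  rewrite Fu0 addr0 subrr modulus0 => H.
  have : modulus (w0 - u 0) <= 0 by rewrite -(pmulr_rle0 _ c20).
  rewrite le_eqVlt ltNge modulus_ge0 orbF modulus_eq0 subr_eq0 => /eqP //.
move=> t td; have [ut Fut] := uP t td.
have [utr utr1] := rhor _ ut; split=> // e e0.
have fu0 : f (u t) != 0 by exact: r1P.
have fm0 : 0 < modulus (f (u t)) by rewrite modulus_gt0.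
have lip s : `|s| < d -> modulus (u s - u t) <= (modulus c / 2)^-1 * `|s - t|.
  move=> /uP[us Fus]; rewrite mulrC ler_pdivlMr // mulrC.
  apply: le_trans (cderiv_injective Hc ut us) _.
  by rewrite Fus Fut opprD addrACA subrr add0r -rmorphB /= modulus_real.
(* Scaled so that [|f (u t)| e1 |u s - u t|] is at most [e |s - t|] after the bound [lip]. *)
pose e1 := e * (modulus c / 2) / modulus (f (u t)).
have e10 : 0 < e1 by rewrite divr_gt0 // mulr_gt0.
have [Fd _] := Hc _ ut; have [r4 r40 r4P] := Fd e1 e10.
exists (r4 * (modulus c / 2)) => [|s sd sr4]; first by rewrite mulr_gt0.
have [us Fus] := uP s sd.
have ul := lip s sd.
have usr4 : modulus (u s - u t) < r4.
  by apply: le_lt_trans ul _; rewrite mulrC ltr_pdivrMr.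
have := r4P _ usr4; rewrite Fus Fut opprD addrACA subrr add0r -rmorphB /= => H.
have -> : u s - u t - f (u t) * (s - t)%:C =
    - (f (u t) * ((s - t)%:C - k (u t) * (u s - u t))).
  by rewrite mulrBr mulrA /k (mulfV fu0) mul1r opprB.
rewrite modulusN modulusM.
apply: le_trans (ler_wpM2l (ltW fm0) (le_trans H (ler_wpM2l (ltW e10) ul))) _.
by rewrite /e1 le_eqVlt; apply/orP; left; apply/eqP; field; rewrite !gt_eqF ?modulus_gt0.
Qed.

(* On a time interval of length at most [1 / (2 C)], each application of the
   mean value inequality halves the bound on the distance to the zero. *)
Lemma flow_stationary (A : set R) f (c : R -> cplx R) (w0 : cplx R) (C r s u : R) :
  (forall w, modulus (w - w0) <= r -> modulus (f w) <= C * modulus (w - w0)) ->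
  0 <= C -> 0 <= r -> C * `|u - s| <= 2^-1 -> c s = w0 ->
  (forall t, Num.min s u <= t <= Num.max s u ->
     [/\ A t, pderiv A c t (f (c t)) & modulus (c t - w0) <= r]) ->
  c u = w0.
Proof.
move=> fC C0 r0 Cu cs H.
have sub t : Num.min s u <= t <= Num.max s u -> forall x,
    Num.min s t <= x <= Num.max s t -> Num.min s u <= x <= Num.max s u.
  move=> tb x; move: tb.
  rewrite !ge_min !le_max => /andP[/orP[?|?] /orP[?|?]] /andP[/orP[?|?] /orP[?|?]];
    apply/andP; split; apply/orP; try (by left; lra); right; lra.
have bd n t : Num.min s u <= t <= Num.max s u -> modulus (c t - w0) <= r * 2^-1 ^+ n.
  elim: n t => [|n IH] t tb; first by have [] := H t tb; rewrite expr0 mulr1.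
  have bn0 : 0 <= r * 2^-1 ^+ n by rewrite mulr_ge0 // exprn_ge0 // invr_ge0.
  have := @mean_value_le_sym _ A c s t (C * (r * 2^-1 ^+ n)).
  rewrite cs => /(_ _ _) H1; apply: le_trans (H1 _ _) _.
  - by move=> x /(sub t tb) xb; have [] := H x xb.
  - move=> x /(sub t tb) xb; have [_ cx xr] := H x xb.
    exists (f (c x)) => //; apply: le_trans (fC _ xr) _.
    by rewrite ler_wpM2l // IH.
  - have : C * `|t - s| <= 2^-1.
      by apply: le_trans Cu; rewrite ler_wpM2l // between_dist.
    have -> : r * 2^-1 ^+ n.+1 = r * 2^-1 ^+ n * 2^-1 by rewrite exprSr mulrA.
    by move=> Ct; rewrite mulrAC mulrC ler_wpM2l.
apply/eqP; rewrite -subr_eq0 -modulus_eq0 eq_le modulus_ge0 andbT.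
have ub : Num.min s u <= u <= Num.max s u by rewrite ge_min le_max !lexx !orbT.
rewrite leNgt; apply/negP => m0.
have [n] := halves_small r0 m0.
by rewrite ltNge bd.
Qed.

End Flow.

(** * The 1-form of time *)

Section Charts.
Context {R : realType} {M : riemann_surface R}.
Implicit Types (i j : chart_index M) (p q : M) (U : set M).

(** [chart_inv] is a total function, so a disc on which it really inverts the chart is extracted
    from the openness of the chart image. *)
Lemma chart_nbhs i p U : chart_dom i p -> nbhs p U ->
  exists2 r : R, 0 < r & forall w, modulus (w - chart i p) < r ->
    [/\ chart_dom i (chart_inv i w), chart i (chart_inv i w) = w &
        U (chart_inv i w)].
Proof.
move=> ip pU.
have imP : nbhs (chart i p) (chart i @` chart_dom i).
  by apply: open_nbhs_nbhs; split; [exact: chart_image_open | exists p].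
have invP : nbhs (chart i p) (chart_inv i @^-1` U).
  by apply: (chart_inv_continuous ip); rewrite chartK.
have : nbhs (chart i p) ((chart i @` chart_dom i) `&` (chart_inv i @^-1` U)).
  exact: filterI.
move=> /nbhs_cplxP[r r0 rP].
exists r => // w /rP[[q iq <-]] /=.
by rewrite chartK.
Qed.

Lemma nbhs_chart i p (r : R) : chart_dom i p -> 0 < r ->
  nbhs p [set q | chart_dom i q /\ modulus (chart i q - chart i p) < r].
Proof.
move=> ip r0; apply: filterI.
  by apply: open_nbhs_nbhs; split; [exact: chart_dom_open |].
have ball_nbhs : nbhs (chart i p) [set w | modulus (w - chart i p) < r].
  by apply/nbhs_cplxP; exists r.
exact: (chart_continuous ip ball_nbhs).
Qed.

Lemma chart_change_cderiv (g : M -> cplx R) i j p d :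
  chart_dom i p -> chart_dom j p ->
  cderiv (g \o chart_inv i) (chart i p) d ->
  cderiv (g \o chart_inv j) (chart j p)
    (d * 'D_1 (chart i \o chart_inv j : cplx R -> cplx R) (chart j p)).
Proof.
move=> ip jp gd.
have td := derivable_cderiv (chart_transition jp ip).
have ipN : nbhs p (chart_dom i).
  by apply: open_nbhs_nbhs; split; [exact: chart_dom_open |].
have [r r0 rP] := chart_nbhs jp ipN.
have := cderiv_comp td; rewrite /= (chartK jp) => /(_ _ _ gd).
apply: cderiv_ext r0 _ => w /rP[_ _ iw] /=.
by rewrite (chartK iw).
Qed.

Lemma within_continuousP (T : topologicalType) (A : set R) (c : R -> T) :
  {within A, continuous c} <->
  forall t, A t -> forall B, nbhs (c t) B ->
    exists2 r : R, 0 < r & forall s, A s -> `|s - t| < r -> B (c s).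
Proof.
rewrite subspace_continuousP; split=> H t At B /(H t At).
  rewrite nbhs_filterE => /nbhs_realP[r r0 rP].
  by exists r => // s As sr; exact: rP.
by move=> [r r0 rP]; rewrite nbhs_filterE; apply/nbhs_realP; exists r => // s sr As; exact: rP.
Qed.

End Charts.

Section TimeForm.
Context {R : realType} {M : riemann_surface R} (X : vector_field M).
Implicit Types (i j : chart_index M) (p q : M) (U : set M).

Lemma field_comp_neq0 i p : field_dom X p -> ~ zeros X p -> chart_dom i p ->
  field_comp X i p != 0.
Proof.
move=> Xp zp ip; apply/eqP => f0; apply: zp; split=> //.
by rewrite (field_comp_change Xp ip (chart_at_dom p)) f0 mulr0.
Qed.

Lemma field_comp_zero i p : zeros X p -> chart_dom i p -> field_comp X i p = 0.
Proof.
move=> [Xp f0] ip.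
by rewrite (field_comp_change Xp (chart_at_dom p) ip) f0 mulr0.
Qed.

Lemma omega_field i p : field_dom X p -> omega X i p = (field_comp X i p)^-1.
Proof. by move=> Xp; rewrite /omega asboolT. Qed.

Lemma omega_pole i p : ~ field_dom X p -> omega X i p = 0.
Proof. by move=> Xp; rewrite /omega asboolF. Qed.

(** The transition derivative [D] cancels against the one in the component of [X], and it is nonzero
    because that component is. At a pole [omega] is 0 in every chart. *)
Lemma omega_change (g : M -> cplx R) i j p : ~ zeros X p ->
  chart_dom i p -> chart_dom j p ->
  cderiv (g \o chart_inv i) (chart i p) (omega X i p) ->
  cderiv (g \o chart_inv j) (chart j p) (omega X j p).
Proof.
move=> zp ip jp /(chart_change_cderiv ip jp).
set D := 'D_1 (chart i \o chart_inv j : cplx R -> cplx R) (chart j p).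
suff -> : omega X i p * D = omega X j p by [].
have [Xp|Xp] := pselect (field_dom X p); last by rewrite !omega_pole // mul0r.
rewrite !omega_field // (field_comp_change Xp jp ip) -/D.
have := field_comp_neq0 Xp zp ip; rewrite (field_comp_change Xp jp ip) -/D.
by rewrite mulf_eq0 negb_or => /andP[D0 _]; rewrite invfM mulrAC mulVf // mul1r.
Qed.

Lemma field_comp_cderiv i p : field_dom X p -> chart_dom i p ->
  exists d, cderiv (field_comp X i \o chart_inv i) (chart i p) d.
Proof. by move=> Xp ip; exact/derivable_ex_cderiv/field_comp_holomorphic. Qed.

Lemma pole_not_dom p : poles X p -> ~ field_dom X p.
Proof. by move=> [[]]. Qed.

(** One normal form for both cases: at a regular point [n = 0] and [G] is the component of [X]; at a
    pole [n] is the order and [G] the analytic numerator. *)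
Lemma omega_local p : ~ zeros X p -> ~ essential X p ->
  exists n (G : cplx R -> cplx R) (r : R),
    [/\ 0 < r, G (chart (chart_at p) p) != 0,
        forall w, modulus (w - chart (chart_at p) p) < r -> exists d, cderiv G w d &
        forall w, modulus (w - chart (chart_at p) p) < r ->
          [/\ chart_dom (chart_at p) (chart_inv (chart_at p) w),
              chart (chart_at p) (chart_inv (chart_at p) w) = w,
              ~ zeros X (chart_inv (chart_at p) w),
              ~ essential X (chart_inv (chart_at p) w) &
              omega X (chart_at p) (chart_inv (chart_at p) w) =
                (w - chart (chart_at p) p) ^+ n / G w]].
Proof.
move=> zp ep; set i := chart_at p; set w0 := chart i p.
have ip : chart_dom i p := chart_at_dom p.
have [Xp|Xp] := pselect (field_dom X p).
  have XN : nbhs p (field_dom X).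
    by apply: open_nbhs_nbhs; split; [exact: field_dom_open |].
  have [r r0 rP] := chart_nbhs ip XN.
  have [d fd] := field_comp_cderiv Xp ip.
  have f0 := field_comp_neq0 Xp zp ip.
  have [|r1 r10 r1P] := cderiv_continuous fd (e := modulus (field_comp X i p)).
    by rewrite modulus_gt0.
  exists 0%N, (field_comp X i \o chart_inv i), (Num.min r r1); split=> /=.
  - by rewrite lt_min r0.
  - by rewrite chartK.
  - move=> w; rewrite lt_min => /andP[/rP[iw ww Xw] _].
    by have := field_comp_cderiv Xw iw; rewrite ww.
  - move=> w; rewrite lt_min => /andP[/rP[iw ww Xw] /r1P /=].
    rewrite (chartK ip) => fw; split; [exact: iw | exact: ww | | |].
    + move=> zw; move: fw; rewrite (field_comp_zero zw iw) sub0r modulusN.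
      by rewrite ltxx.
    + by move=> ew; apply: ew; left.
    + by rewrite omega_field // expr0 mul1r.
have {Xp} Pp : poles X p.
  by apply: contrapT => Pp; apply: ep; case.
have Xp := pole_not_dom Pp.
have [[_ isoX] [n [g [n0 gp gd gf]]]] := Pp.
have ipN : nbhs p [set q | (q != p -> field_dom X q /\
    field_comp X i q = g q / (chart i q - chart i p) ^+ n) /\
    (chart_dom i q /\ derivable (g \o chart_inv i : cplx R -> cplx R) (chart i q) 1)].
  have H1 : nbhs p [set q | q != p -> field_dom X q] := isoX.
  have H2 : nbhs p [set q | q != p ->
    field_comp X i q = g q / (chart i q - chart i p) ^+ n] := gf.
  apply: filterS (filterI (filterI H1 H2) gd) => q [[h1 h2] h3].
  by split=> // qp; split; [exact: h1 | exact: h2].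
have [r r0 rP] := chart_nbhs ip ipN.
have gdw w : modulus (w - w0) < r -> exists d, cderiv (g \o chart_inv i) w d.
  by move=> /rP[iw ww [_ [_]]]; rewrite ww => /derivable_ex_cderiv.
have w00 : modulus (w0 - w0) < r by rewrite subrr modulus0.
have [d gd0] := gdw _ w00.
have [|r1 r10 r1P] := cderiv_continuous gd0 (e := modulus (g p)).
  by rewrite modulus_gt0.
exists n, (g \o chart_inv i), (Num.min r r1); split=> /=.
- by rewrite lt_min r0.
- by rewrite chartK.
- by move=> w; rewrite lt_min => /andP[/gdw].
move=> w; rewrite lt_min => /andP[/rP[iw ww [near _]] /r1P /=].
rewrite (chartK ip) => gw.
have gw0 : g (chart_inv i w) != 0.
  by apply: contraTneq gw => ->; rewrite sub0r modulusN ltxx.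
(* At the pole itself [omega] is 0 by definition, and so is [0 ^+ n], as the order is positive. *)
have [wp|wp] := eqVneq w w0.
  by rewrite wp chartK //; split=> //; rewrite omega_pole // subrr expr0n gtn_eqF // mul0r.
have qp : chart_inv i w != p by apply: contra_neq wp => qp; rewrite -ww qp.
have [Xq fq] := near qp; rewrite ww in fq.
have f0 : field_comp X i (chart_inv i w) != 0.
  by rewrite fq mulf_neq0 // invr_eq0 expf_neq0 // subr_eq0.
split; [exact: iw | exact: ww | | |].
- by move=> zq; move: f0; rewrite (field_comp_zero zq iw) eqxx.
- by move=> ew; apply: ew; left.
- by rewrite omega_field // fq invfM invrK mulrC.
Qed.

(** Joins [primitive_on_disc] and [primitive_isolated]. The last clause is what keeps a lifted path
    over a small disc from leaving a neighborhood of [p]. *)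
Lemma local_primitive p : ~ zeros X p -> ~ essential X p ->
  exists (F : cplx R -> cplx R) (r : R),
    [/\ 0 < r,
        forall w, modulus (w - chart (chart_at p) p) < r ->
          [/\ chart_dom (chart_at p) (chart_inv (chart_at p) w),
              chart (chart_at p) (chart_inv (chart_at p) w) = w,
              ~ zeros X (chart_inv (chart_at p) w),
              ~ essential X (chart_inv (chart_at p) w) &
              cderiv F w (omega X (chart_at p) (chart_inv (chart_at p) w))] &
        forall rho : R, 0 < rho -> exists2 d : R, 0 < d &
          forall w, rho <= modulus (w - chart (chart_at p) p) ->
            modulus (w - chart (chart_at p) p) < r ->
            d <= modulus (F w - F (chart (chart_at p) p))].
Proof.
move=> zp ep; have [n [G [r [r0 G0 Gd rP]]]] := omega_local zp ep.
set i := chart_at p in r0 G0 Gd rP *; set w0 := chart i p in r0 G0 Gd rP *.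
have [r1 r10 r1P] : exists2 r1 : R, 0 < r1 & forall w, modulus (w - w0) < r1 -> G w != 0.
  have [|d Gd0] := Gd w0; first by rewrite subrr modulus0.
  have [|r1 r10 r1P] := cderiv_continuous Gd0 (e := modulus (G w0)).
    by rewrite modulus_gt0.
  exists r1 => // w /r1P; apply: contraTneq => ->.
  by rewrite sub0r modulusN ltxx.
pose h w := (w - w0) ^+ n / G w.
have r2 : 0 < Num.min r r1 by rewrite lt_min r0.
have [w|F HF] := @primitive_on_disc _ h w0 _ r2.
  rewrite lt_min => /andP[/Gd[d {}Gd] /r1P Gw].
  have dzw : cderiv (fun z => z - w0) w 1.
    by have := cderivB (cderiv_id w) (cderiv_cst w0 w); rewrite subr0.
  have [d' Vd] := cderivV Gw Gd.
  by eexists; exact: cderivM (cderivX n dzw) Vd.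
have r3 : 0 < Num.min r r1 / 3 by rewrite divr_gt0.
have rmin : Num.min r r1 <= r by rewrite ge_min lexx.
have w00 : modulus (w0 - w0) < r by rewrite subrr modulus0.
have [r4 [r40 r4r iso]] := primitive_isolated r3 HF G0 (Gd _ w00).
exists F, r4; split; [exact: r40 | move=> w wr4 | exact: iso].
have wr : modulus (w - w0) < r by lra.
have [a b c d e] := rP w wr; split=> //.
by rewrite e; apply: HF; lra.
Qed.

(** [branch] describes [Psi] near each point by a function of its own in the chart chosen there; the
    comparison with a primitive needs a single function in a fixed chart. *)
Lemma branch_local V Psi i q (r0 : R) : branch X V Psi -> V q ->
  chart_dom i q -> 0 < r0 ->
  (forall w, modulus (w - chart i q) < r0 -> ~ zeros X (chart_inv i w)) ->
  exists (g : cplx R -> cplx R) (r : R), 0 < r /\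
    forall w, modulus (w - chart i q) < r ->
      [/\ chart_dom i (chart_inv i w), chart i (chart_inv i w) = w,
          Psi (chart_inv i w) = Some (g w) &
          cderiv g w (omega X i (chart_inv i w))].
Proof.
move=> [oV _ bP] Vq iq r00 nz.
have zq : ~ zeros X q.
  by have := nz (chart i q); rewrite subrr modulus0 chartK //; apply.
have [_ _ /(_ zq)[g [Pg _]]] := bP q Vq.
(* The interior is taken so that [Psi] and [g] agree near each nearby point and not only at it, as
   needed to carry the derivative from [g'] to [g]. *)
have UN : nbhs q (V `&` (fun x => \forall y \near x, Psi y = Some (g y))).
  by apply: filterI; [exact: open_nbhs_nbhs | exact: nbhs_interior Pg].
have [r r_gt0 rP] := chart_nbhs iq UN.
exists (g \o chart_inv i), (Num.min r r0); split; first by rewrite lt_min r_gt0.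
move=> w; rewrite lt_min => /andP[/rP[iw ww [Vw Pw]] /nz zw].
split=> //; first exact: nbhs_singleton Pw.
have [_ _ /(_ zw)[g' [Pg' /cderivP g'd]]] := bP _ Vw.
have := omega_change zw (chart_at_dom _) iw g'd; rewrite ww.
have [r1 r10 r1P] := chart_nbhs iw (filterI Pw Pg').
apply: cderiv_ext r10 _ => z; rewrite -{1}ww => /r1P[_ _ [Pz Pz']] /=.
by move: Pz; rewrite Pz' => -[].
Qed.

Lemma primitive_unique (F g k : cplx R -> cplx R) (w0 : cplx R) (r : R) :
  (forall w, modulus (w - w0) < r -> cderiv F w (k w) /\ cderiv g w (k w)) ->
  forall w, modulus (w - w0) < r -> F w - g w = F w0 - g w0.
Proof.
move=> H w wr; apply/eqP; rewrite -subr_eq0 -modulus_eq0 eq_le modulus_ge0 andbT.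
rewrite -[leRHS](mul0r (modulus (w - w0))).
apply: (@cderiv_mean_value _ (fun z => F z - g z)) => s /andP[s0 s1].
exists (k (w0 + s%:C * (w - w0)) - k (w0 + s%:C * (w - w0))).
  by apply: cderivB; apply H; rewrite addrAC subrr add0r modulusM modulus_real
    ger0_norm //; apply: le_lt_trans wr; rewrite ler_piMl // modulus_ge0.
by rewrite subrr modulus0.
Qed.

End TimeForm.

(** * Essential singularities *)

Section Spherical.
Context {R : realType}.

(** With [m = |w - a|], [|w| <= |a| + m] bounds the chordal distance below by
    [2 m / (S (1 + |a| + m))], which increases with [m]; [rho] is its value at [d]. *)
Lemma spherical_disc_modulus (a : cplx R) (d : R) : 0 < d ->
  exists2 rho : R, 0 < rho & forall w : cplx R,
    spherical_disc (Some a : sphere R) rho (Some w) -> modulus (w - a) < d.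
Proof.
move=> d0; set A := modulus a; have A0 : 0 <= A by exact: modulus_ge0.
pose S := Num.sqrt (1 + A ^+ 2).
have S0 : 0 < S by rewrite sqrtr_gt0 ltr_pwDl // sqr_ge0.
exists (2 * d / (S * (1 + A + d))).
  by rewrite divr_gt0 ?mulr_gt0 //; lra.
move=> w; rewrite /spherical_disc /= -/A -/S (modulus_distC a).
set m := modulus (w - a); set W := modulus w; set T := Num.sqrt _.
have W0 : 0 <= W by exact: modulus_ge0.
have T0 : 0 < T by rewrite sqrtr_gt0 ltr_pwDl // sqr_ge0.
have TW : T <= 1 + W.
  rewrite -(ger0_norm (_ : 0 <= 1 + W)); last by lra.
  by rewrite -sqrtr_sqr ler_sqrt ?sqr_ge0 //; have := sqr_ge0 W; nra.
have WA : W <= A + m.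
  by rewrite /W -(subrK a w) addrC; exact: modulusD.
rewrite ltNge; apply: contraNlt => dm.
rewrite ler_pdivlMr ?mulr_gt0 // mulrAC ler_pdivrMr ?mulr_gt0 //; last by lra.
have -> : 2 * d * (S * T) = 2 * S * (d * T) by ring.
have -> : 2 * m * (S * (1 + A + d)) = 2 * S * (m * (1 + A + d)) by ring.
rewrite ler_pM2l ?mulr_gt0 //.
apply: (@le_trans _ _ (d * (1 + A + m))); first by rewrite ler_pM2l //; lra.
by rewrite !mulrDr !mulr1 (mulrC d m) lerD2r lerD // ler_wpM2r.
Qed.

Lemma spherical_disc_inj (a : cplx R) (y : sphere R) :
  (forall rho : R, 0 < rho -> spherical_disc (Some a : sphere R) rho y) -> y = Some a.
Proof.
case: y => [w|] H; last first.
  have S0 : 0 < 2 / Num.sqrt (1 + modulus a ^+ 2).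
    by rewrite divr_gt0 // sqrtr_gt0 ltr_pwDl // sqr_ge0.
  by have := H _ S0; rewrite /spherical_disc /= ltxx.
congr Some; apply/eqP; rewrite -subr_eq0 -modulus_eq0 eq_le modulus_ge0 andbT.
rewrite leNgt; apply/negP => m0.
have [rho rho0 /(_ w (H _ rho0))] := spherical_disc_modulus a m0.
by rewrite ltxx.
Qed.

End Spherical.

Section Transcendental.
Context {R : realType} {M : riemann_surface R} (X : vector_field M).
Implicit Types (p q : M) (F : cplx R -> cplx R).

(** Squares in the chart rather than discs: the closed ones are images of a product of two segments,
    whence their compactness. *)
Definition open_square p (r : R) : set M := [set q |
  [/\ chart_dom (chart_at p) q,
      `|complex.Re (chart (chart_at p) q - chart (chart_at p) p)| < r &
      `|complex.Im (chart (chart_at p) q - chart (chart_at p) p)| < r]].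

Definition closed_square p (r : R) : set M :=
  (fun xy : R * R => chart_inv (chart_at p) (chart (chart_at p) p + (xy.1 +i* xy.2)))
    @` ([set x : R | `|x| <= r] `*` [set y : R | `|y| <= r]).

Lemma open_square_closed p r : open_square p r `<=` closed_square p r.
Proof.
move=> q [iq xr yr].
exists (complex.Re (chart (chart_at p) q - chart (chart_at p) p),
        complex.Im (chart (chart_at p) q - chart (chart_at p) p)).
  by split; exact: ltW.
rewrite /= -[RHS](chartK iq); congr chart_inv.
have -> (z : cplx R) : complex.Re z +i* complex.Im z = z by case: z.
by rewrite addrCA subrr addr0.
Qed.

Lemma closed_square_closed p (r r' : R) : 2 * r < r' ->
  (forall w, modulus (w - chart (chart_at p) p) < r' ->
    chart_dom (chart_at p) (chart_inv (chart_at p) w) /\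
    chart (chart_at p) (chart_inv (chart_at p) w) = w) ->
  closed (closed_square p r).
Proof.
move=> rr' H; apply: compact_closed; first exact: surface_hausdorff.
apply: continuous_compact; last exact: square_compact.
apply: continuous_in_subspaceT => -[x y]; rewrite inE => -[/= xr yr].
apply: continuous_from_square.
have [|iw ww] := H (chart (chart_at p) p + (x +i* y)).
  rewrite addrAC subrr add0r; apply: le_lt_trans (modulus_le _) _ => /=.
  by lra.
by have := chart_inv_continuous iw; rewrite ww.
Qed.

(** Followed backwards from [p], a lift that stays on the sheet of [F] can reach the boundary of the
    square only with [|tau - a| >= d]. The times spent inside on that sheet are thus open and closed
    in the unit interval, and 1 is one of them. *)
Lemma same_component_confined p (a : cplx R) F (r r1 d rho : R)
    (c : R -> M) (tau : R -> sphere R) :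
  0 < r1 -> 2 * r1 < r ->
  (forall w, modulus (w - chart (chart_at p) p) < r ->
     [/\ chart_dom (chart_at p) (chart_inv (chart_at p) w),
         chart (chart_at p) (chart_inv (chart_at p) w) = w,
         ~ zeros X (chart_inv (chart_at p) w) &
         cderiv F w (omega X (chart_at p) (chart_inv (chart_at p) w))]) ->
  (forall w, r1 <= modulus (w - chart (chart_at p) p) ->
     modulus (w - chart (chart_at p) p) < r ->
     d <= modulus (F w - F (chart (chart_at p) p))) ->
  (forall w, spherical_disc (Some a : sphere R) rho (Some w) -> modulus (w - a) < d) ->
  continuation X c tau -> c 1 = p -> tau 1 = Some a ->
  (forall s, unit_interval s -> spherical_disc (Some a : sphere R) rho (tau s)) ->
  open_square p r1 (c 0).
Proof.
set i := chart_at p; set w0 := chart i p.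
move=> r10 r1r HF iso disc [/within_continuousP cc ctau] c1 tau1 taud.
(* The sheet is part of the condition: a path returning to the square might carry a branch that
   differs from [F] by another constant. *)
pose T := [set s | open_square p r1 (c s) /\
  tau s = Some (F (chart i (c s)) - F w0 + a)].
have clK : closed (closed_square p r1).
  by apply: (closed_square_closed r1r) => w /HF[].
suff [_ /(_ _)[]] : T 0 <-> T 1.
- split; last by rewrite c1 tau1 subrr add0r.
  by rewrite /open_square /= c1 subrr /= normr0; split=> //; exact: chart_at_dom.
- by [].
apply: segment_clopen => // s s01.
have [Ks|nKs] := pselect (closed_square p r1 (c s)); last first.
  have [|e e0 eP] := cc s s01 (~` closed_square p r1).
    by apply: open_nbhs_nbhs; split=> //; exact: closed_openC.
  exists e => // u u01 us; split=> -[/open_square_closed] //.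
  by move: (eP u u01 us).
have [is_ sr] : chart_dom i (c s) /\ modulus (chart i (c s) - w0) < r.
  move: Ks => [[x y] [/= xr yr] <-].
  have xyr : modulus (w0 + (x +i* y) - w0) < r.
    rewrite addrAC subrr add0r; apply: le_lt_trans (modulus_le _) _ => /=.
    by move: xr yr; lra.
  by have [iw ww _ _] := HF _ xyr; rewrite -/i -/w0 ww.
have [V [Psi [bV Vs tauP]]] := ctau s s01.
have r20 : 0 < r - modulus (chart i (c s) - w0) by rewrite subr_gt0.
have inr w : modulus (w - chart i (c s)) < r - modulus (chart i (c s) - w0) ->
    modulus (w - w0) < r.
  by move=> H; have := modulus_triangle w (chart i (c s)) w0; lra.
have [|g [r3 [r30 gP]]] := branch_local bV Vs is_ r20.
  by move=> w /inr /HF[].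
pose r4 := Num.min r3 (r - modulus (chart i (c s) - w0)).
have r40 : 0 < r4 by rewrite lt_min r30.
(* Near [c s] the branch followed by [tau] and the primitive [F] have the same derivative, hence a
   constant difference, called [ka] below. *)
have const w : modulus (w - chart i (c s)) < r4 ->
    F w - g w = F (chart i (c s)) - g (chart i (c s)).
  apply: (@primitive_unique _ F g (fun w => omega X i (chart_inv i w))) => z.
  by rewrite lt_min => /andP[/gP[_ _ _ gz] /inr /HF[_ _ _ Fz]].
have [e1 e10 e1P] := cc s s01 _ (nbhs_chart is_ r40).
have [e2 e20 e2P] := (nbhs_realP _ _).1 tauP.
set ka := F (chart i (c s)) - g (chart i (c s)) in const.
have tauE u : unit_interval u -> `|u - s| < e1 -> `|u - s| < e2 ->
    tau u = Some (F (chart i (c u)) - ka).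
  move=> u01 /(e1P u u01)[iu ur4] /e2P -> //.
  rewrite -(const _ ur4) opprB addrCA subrr addr0 -{1}(chartK iu).
  have ur3 : modulus (chart i (c u) - chart i (c s)) < r3.
    by rewrite (lt_le_trans ur4) // ge_min lexx.
  by have [_ _ -> _] := gP _ ur3.
have ssE : tau s = Some (F (chart i (c s)) - ka).
  by apply: tauE => //; rewrite subrr normr0.
(* On the boundary no nearby time is in [T]: it would force [ka = F w0 - a], so that [|tau s - a|]
   equals [|F - F w0| >= d] at [c s], against the size of the disc. *)
have [[_ xs ys]|nOs] := pselect (open_square p r1 (c s)); last first.
  exists (Num.min e1 e2) => [|u u01]; first by rewrite lt_min e10.
  rewrite lt_min => /andP[ue1 ue2]; split=> [[Ou]|[]//].
  rewrite tauE // => -[/(congr1 (fun z => F (chart i (c u)) - z))].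
  rewrite opprB addrCA subrr addr0 => kaE; exfalso.
  have : ~ (modulus (chart i (c s) - w0) < r1).
    move=> lt1; apply: nOs; split=> //; apply: le_lt_trans lt1.
      exact: Re_le_modulus.
    exact: Im_le_modulus.
  move/negP; rewrite -leNgt => /iso /(_ sr); apply/negP; rewrite -ltNge.
  have := taud s s01; rewrite ssE => /disc.
  suff -> : F (chart i (c s)) - ka - a = F (chart i (c s)) - F w0 by [].
  by rewrite kaE; ring.
pose r5 := Num.min (r1 - `|complex.Re (chart i (c s) - w0)|)
  (r1 - `|complex.Im (chart i (c s) - w0)|).
have r50 : 0 < r5 by rewrite lt_min !subr_gt0 xs ys.
have [e3 e30 e3P] := cc s s01 _ (nbhs_chart is_ r50).
exists (Num.min (Num.min e1 e2) e3) => [|u u01]; first by rewrite !lt_min e10 e20.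
rewrite !lt_min => /andP[/andP[ue1 ue2] /(e3P u u01)[iu]].
rewrite lt_min => /andP[ux uy].
have Ou : open_square p r1 (c u).
  have E : chart i (c u) - w0 = (chart i (c u) - chart i (c s)) + (chart i (c s) - w0).
    by rewrite addrA subrK.
  split=> //; rewrite -/i -/w0.
    rewrite E raddfD /=; apply: le_lt_trans (ler_normD _ _) _.
    by have := Re_le_modulus (chart i (c u) - chart i (c s)); lra.
  rewrite E raddfD /=; apply: le_lt_trans (ler_normD _ _) _.
  by have := Im_le_modulus (chart i (c u) - chart i (c s)); lra.
have kaP z z' : F z - ka = F z - F w0 + a -> F z' - ka = F z' - F w0 + a.
  move=> E; have {}E : - ka = - F w0 + a by apply: (addrI (F z)); rewrite E addrA.
  by rewrite E addrA.
rewrite /T /= tauE // ssE; split=> -[_ [/kaP E]]; split=> //.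
  by rewrite E.
by rewrite E.
Qed.

Lemma transcendental_at_essential (zs : M) (a : cplx R) (alpha : R -> M) v :
  essential X zs -> alpha s @[s --> +oo] --> zs ->
  transcendental_singularity X (Some a) alpha v.
Proof.
move=> ezs alphazs Lambda Psi _ _; apply/seteqP; split=> // p /= H; exfalso.
have {}H (rho : R) : 0 < rho -> [/\ psi_dom X p,
    spherical_disc (Some a : sphere R) rho (Psi p) &
    exists2 s0, 0 <= s0 & forall s, s0 <= s -> same_component X
     (spherical_disc (Some a : sphere R) rho)
     (alpha s, Some (path_integral X alpha v s)) (p, Psi p)].
  move=> rho0; have [[q t] [[s0 s00 sP] [q' [_ psiq] [q'q tE]]] /= qp] := H rho rho0.
  subst q' q; subst t; split=> //; last by exists s0.
  have [c [tau [_ _ [_ <-] tauD]]] := sP s0 (lexx _).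
  by apply: tauD; rewrite /unit_interval /= ler01 lexx.
have Psip : Psi p = Some a.
  by apply: spherical_disc_inj => rho /H[].
have ep : ~ essential X p.
  by have [psip _ _] := H 1 ltr01; move=> ep; apply: psip; left.
(* At a zero every branch takes the value infinity, whereas the lift arrives at [p] with the finite
   value [a]. *)
have zp : ~ zeros X p.
  move=> zp; have [_ _ [s0 s00 sP]] := H 1 ltr01.
  have [c [tau [[_ ctau] _ [c1 tau1] _]]] := sP s0 (lexx _).
  have u1 : unit_interval (1 : R) by rewrite /unit_interval /= ler01 lexx.
  have [V [Phi [[_ _ bV] Vc /nbhs_singleton tauE]]] := ctau 1 u1.
  have [_ + _] := bV _ Vc; rewrite c1 => /(_ zp) Phip.
  have := tauE u1; rewrite c1 tau1 Psip Phip; discriminate.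
have pzs : p != zs by apply/eqP => pE; apply: ep; rewrite pE.
have [F [r [r0 FP iso]]] := local_primitive zp ep.
have [[U W] [/= pU zW] [oU oW UW]] : exists2 UW : set M * set M,
    UW.1 p /\ UW.2 zs & [/\ open UW.1, open UW.2 & UW.1 `&` UW.2 = set0].
  have := surface_hausdorff (r := M); rewrite open_hausdorff => /(_ p zs pzs).
  case=> UW [/set_mem pU /set_mem zW] [oU oW UW0]; exists UW.
    by split; [exact: pU | exact: zW].
  by split; [exact: oU | exact: oW | exact/eqP].
have [r' r'0 r'P] := chart_nbhs (chart_at_dom p) (open_nbhs_nbhs (conj oU pU)).
(* The square of half-side [r1] lies in the disc of radius [2 r1], which has to fit in both discs;
   hence a third. *)
pose r1 := Num.min r r' / 3.
have rr' : 0 < Num.min r r' by rewrite lt_min r0.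
have r10 : 0 < r1 by rewrite divr_gt0.
have r1r : 2 * r1 < r.
  have : Num.min r r' <= r by rewrite ge_min lexx.
  by rewrite /r1; lra.
have r1r' : 2 * r1 < r'.
  have : Num.min r r' <= r' by rewrite ge_min lexx orbT.
  by rewrite /r1; lra.
have squareU : open_square p r1 `<=` U.
  move=> q /open_square_closed[[x y] [/= xr yr] <-].
  have [|//] := r'P (chart (chart_at p) p + (x +i* y)).
  rewrite addrAC subrr add0r; apply: le_lt_trans (modulus_le _) _ => /=.
  by lra.
have [d d0 dP] := iso r1 r10.
have [rho rho0 disc] := spherical_disc_modulus a d0.
have [_ _ [s0 s00 sP]] := H rho rho0.
have : \forall s \near +oo, W (alpha s).
  by apply: alphazs; exact: open_nbhs_nbhs.
case=> s1 [_ s1P].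
(* [s1 + 1] because the eventual statement concerns times strictly beyond [s1]. *)
pose s := Num.max s0 (s1 + 1).
have [|c [tau [ct [c0 tau0] [c1 tau1] tauD]]] := sP s; first by rewrite le_max lexx.
have Ws : W (alpha s) by apply: s1P; rewrite lt_max ltrDl ltr01 orbT.
have HF w : modulus (w - chart (chart_at p) p) < r ->
    [/\ chart_dom (chart_at p) (chart_inv (chart_at p) w),
        chart (chart_at p) (chart_inv (chart_at p) w) = w,
        ~ zeros X (chart_inv (chart_at p) w) &
        cderiv F w (omega X (chart_at p) (chart_inv (chart_at p) w))].
  by move=> /FP[h1 h2 h3 _ h5]; split; [exact: h1 | exact: h2 | exact: h3 | exact: h5].
rewrite Psip in tau1.
have := same_component_confined r10 r1r HF dP disc ct c1 tau1 tauD.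
rewrite c0 => /squareU Us; have : (U `&` W) (alpha s) by split; [exact: Us | exact: Ws].
by rewrite UW.
Qed.

End Transcendental.

(** * Ends of trajectories *)

Section Solutions.
Context {R : realType} {M : riemann_surface R}.
Implicit Types (X Y : vector_field M) (a b : \bar R) (z : R -> M) (zs p : M).

Lemma time_domain_between a b (s t u : R) : time_domain a b s -> time_domain a b t ->
  Num.min s t <= u <= Num.max s t -> time_domain a b u.
Proof.
move=> /andP[as_ sb] /andP[at_ tb]; rewrite ge_min le_max /time_domain /=.
move=> /andP[/orP[h1|h1] /orP[h2|h2]]; apply/andP; split.
- by apply: lt_le_trans as_ _; rewrite lee_fin.
- by apply: le_lt_trans sb; rewrite lee_fin.
- by apply: lt_le_trans as_ _; rewrite lee_fin.
- by apply: le_lt_trans tb; rewrite lee_fin.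
- by apply: lt_le_trans at_ _; rewrite lee_fin.
- by apply: le_lt_trans sb; rewrite lee_fin.
- by apply: lt_le_trans at_ _; rewrite lee_fin.
- by apply: le_lt_trans tb; rewrite lee_fin.
Qed.

Lemma at_leftP (t : R) (B : set R) : t^'- B <->
  exists2 r : R, 0 < r & forall s, t - r < s < t -> B s.
Proof.
split=> [/nbhs_realP[r r0 rP]|[r r0 rP]].
  by exists r => // s /andP[rs st]; apply: rP => //; rewrite ltr_norml; apply/andP; split; lra.
apply/nbhs_realP; exists r => // s; rewrite ltr_norml => /andP[rs _] st.
by apply: rP; apply/andP; split=> //; lra.
Qed.

Lemma at_rightP (t : R) (B : set R) : t^'+ B <->
  exists2 r : R, 0 < r & forall s, t < s < t + r -> B s.
Proof.
split=> [/nbhs_realP[r r0 rP]|[r r0 rP]].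
  by exists r => // s /andP[rs st]; apply: rP => //; rewrite ltr_norml; apply/andP; split; lra.
apply/nbhs_realP; exists r => // s; rewrite ltr_norml => /andP[_ rs] st.
by apply: rP; apply/andP; split=> //; lra.
Qed.

Lemma pderiv_chart_change X (A : set R) z t i j :
  {within A, continuous z} -> A t -> field_dom X (z t) ->
  chart_dom i (z t) -> chart_dom j (z t) ->
  pderiv A (chart i \o z) t (field_comp X i (z t)) ->
  pderiv A (chart j \o z) t (field_comp X j (z t)).
Proof.
move=> /within_continuousP cz At Xt it jt hi.
have [|r r0 rP] := cz t At (chart_dom i).
  by apply: open_nbhs_nbhs; split; [exact: chart_dom_open | exact: it].
rewrite (field_comp_change Xt it jt).
have td := derivable_cderiv (chart_transition it jt).
have := cderiv_pderiv hi td; apply: pderiv_ext r0 At _ => s As /(rP _ As) is_ /=.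
by rewrite (chartK is_).
Qed.

Lemma solution_pderiv X a b z t i : solution X a b z -> time_domain a b t ->
  chart_dom i (z t) ->
  pderiv (time_domain a b) (chart i \o z) t (field_comp X i (z t)).
Proof. by move=> [_ _ zP] /zP[_ H] /H /path_derivP. Qed.

Lemma field_linear_bound X i p : zeros X p -> chart_dom i p ->
  exists2 C : R, 0 <= C & exists2 r : R, 0 < r & forall w,
    modulus (w - chart i p) < r ->
    modulus (field_comp X i (chart_inv i w)) <= C * modulus (w - chart i p).
Proof.
move=> zp ip; have [Xp _] := zp; have [d /(_ 1 ltr01)[r r0 rP]] := field_comp_cderiv Xp ip.
exists (1 + modulus d); first by rewrite addr_ge0 ?modulus_ge0.
exists r => // w /rP /=; rewrite (chartK ip) (field_comp_zero zp ip) subr0 => H.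
set f := field_comp _ _ _ in H *.
have -> : f = (f - d * (w - chart i p)) + d * (w - chart i p) by rewrite subrK.
by apply: le_trans (modulusD _ _) _; rewrite modulusM mulrDl lerD2r.
Qed.

(** The times spent at the zero form a closed set because points are closed, and an open one by
    [flow_stationary]; the time interval is connected. *)
Lemma solution_stationary X a b z t0 : solution X a b z -> time_domain a b t0 ->
  zeros X (z t0) -> forall t, time_domain a b t -> z t = z t0.
Proof.
move=> solz t0D z0 t tD.
have [_ /within_continuousP cz _] := solz.
pose i := chart_at (z t0); have i0 : chart_dom i (z t0) := chart_at_dom _.
have [C C0 [r r0 rP]] := field_linear_bound z0 i0.
have loc s : time_domain a b s -> exists2 d : R, 0 < d & forall u, time_domain a b u ->
    `|u - s| < d -> (z u = z t0 <-> z s = z t0).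
  move=> sD; have [zs0|zs0] := pselect (z s = z t0); last first.
    have [|d d0 dP] := cz s sD (~` [set z t0]).
      apply: open_nbhs_nbhs; split; last by move=> /zs0.
      by apply/closed_openC/accessible_closed_set1/hausdorff_accessible/surface_hausdorff.
    by exists d => // u uD /(dP u uD) zu; split=> [/zu|/zs0].
  have r20 : 0 < r / 2 by rewrite divr_gt0.
  have [|d d0 dP] := cz s sD _ (_ : nbhs (z s) [set q | chart_dom i q /\
      modulus (chart i q - chart i (z t0)) < r / 2]).
    by rewrite zs0; exact: nbhs_chart.
  (* This gives [C |u - s| <= 1 / 2]; the added 1 covers [C = 0]. *)
  exists (Num.min d (2^-1 / (C + 1))).
    by rewrite lt_min d0 divr_gt0 // ltr_wpDl.
  move=> u uD; rewrite lt_min => /andP[ud uC]; split=> // _.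
  have iu := dP u uD ud.
  rewrite -(chartK iu.1) -(chartK i0); congr chart_inv.
  apply: (@flow_stationary _ (time_domain a b) (field_comp X i \o chart_inv i)
    (chart i \o z) _ C (r / 2) s) => //=.
  - by move=> w wr; apply: rP; move: wr; lra.
  - exact: ltW.
  - have C1 : 0 < C + 1 by lra.
    move: uC; rewrite ltr_pdivlMr // => uC.
    have : 0 <= `|u - s| by []. 
    by move: uC; lra.
  - by rewrite zs0.
  - move=> x xb; have xD := time_domain_between sD uD xb.
    have [ix xr] := dP x xD (le_lt_trans (between_dist xb) ud).
    split; [exact: xD | | exact: ltW].
    by rewrite (chartK ix); exact: solution_pderiv.
have link lo hi : lo <= hi -> time_domain a b lo -> time_domain a b hi ->
    z lo = z t0 <-> z hi = z t0.
  move=> lohi loD hiD; apply: (@segment_clopen _ [set u | z u = z t0]) => // s sb.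
  have D x : lo <= x <= hi -> time_domain a b x.
    by move=> xb; apply: (time_domain_between loD hiD); rewrite min_l // max_r.
  have [d d0 dP] := loc s (D s sb); exists d => // u /D uD ud; exact: dP.
have [t0t|/ltW tt0] := leP t0 t; first exact: (link _ _ t0t t0D tD).1.
exact: (link _ _ tt0 tD t0D).2.
Qed.

Lemma constant_solution X p : zeros X p -> solution X -oo%E +oo%E (fun=> p).
Proof.
move=> zp; split; first by exists 0; rewrite /time_domain /= ltNyr ltry.
  by apply: continuous_subspaceT => t; exact: cvg_cst.
move=> t _; split=> [|i ip]; first by case: zp.
by apply/path_derivP; rewrite (field_comp_zero zp ip); exact: pderiv_cst.
Qed.

(** Through a zero the trajectory would be part of a constant solution, which lives for all times,
    and maximality would make its domain the whole line. *)
Lemma incomplete_zero_free X a b z t : incomplete_trajectory X a b z ->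
  time_domain a b t -> ~ zeros X (z t).
Proof.
move=> [[solz maxz] incz] tD zt; apply: incz.
have TT : time_domain -oo%E +oo%E = [set: R].
  by apply/seteqP; split=> // x _; rewrite /time_domain /= ltNyr ltry.
rewrite -(maxz _ _ _ (constant_solution zt)) ?TT //.
by move=> s; rewrite inE => sD; exact/esym/(solution_stationary solz tD zt).
Qed.

(** No derivative is known at [b0], so the mean value inequality for [c - v t] is used on [[s, t]]
    only, and [t] is then sent to [b0] by continuity. *)
Lemma left_derivative_limit (A : set R) (c k : R -> cplx R) (b0 : R) (v : cplx R) :
  (forall e : R, 0 < e -> exists2 r : R, 0 < r & forall s, b0 - r < s < b0 ->
     [/\ A s, pderiv A c s (k s), modulus (k s - v) <= e & modulus (c s - c b0) <= e]) ->
  forall e : R, 0 < e -> exists2 r : R, 0 < r & forall s, b0 - r < s < b0 ->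
    modulus (c s - c b0 - v * (s - b0)%:C) <= e * `|s - b0|.
Proof.
move=> H e e0; have [r r0 rP] := H e e0; exists r => // s /andP[rs sb].
pose g t := c t - v * t%:C.
have gP t : b0 - r < t < b0 -> pderiv A g t (k t - v).
  move=> /rP[_ ht _ _]; apply: pderivB => //.
  by rewrite -[X in pderiv _ _ _ X]mulr1; exact/pderivZ/pderiv_real.
have -> : c s - c b0 - v * (s - b0)%:C = g s - g b0 by rewrite rmorphB /= /g; ring.
rewrite distrC gtr0_norm ?subr_gt0 //.
apply: (@le_of_slope _ _ _ (1 + modulus v)); first by rewrite addr_ge0 // modulus_ge0.
move=> eta eta0; have [r1 r10 r1P] := H eta eta0.
(* The three terms put [t] beyond [s], within reach of the continuity bound at [b0], and within
   [eta] of [b0] to control [v (t - b0)]. *)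
pose t := Num.max ((s + b0) / 2) (Num.max (b0 - r1 / 2) (b0 - eta)).
have tb : t < b0 by rewrite !gt_max; apply/and3P; split; lra.
have st : s < t by rewrite lt_max; apply/orP; left; lra.
have tr1 : b0 - r1 / 2 <= t by rewrite !le_max lexx !orbT.
have teta : b0 - eta <= t by rewrite !le_max lexx !orbT.
have [_ _ _ cb] := r1P t ltac:(apply/andP; split; lra).
have gst : modulus (g t - g s) <= e * (t - s).
  apply: (@mean_value_le _ A); first exact: ltW.
    move=> x /andP[sx xt]; have [|//] := rP x; apply/andP; split; lra.
  move=> x /andP[sx xt]; have xr : b0 - r < x < b0 by apply/andP; split; lra.
  by exists (k x - v); [exact: gP | have [] := rP x xr].
have gb : modulus (g t - g b0) <= eta * (1 + modulus v).
  have -> : g t - g b0 = (c t - c b0) - v * (t - b0)%:C by rewrite rmorphB /= /g; ring.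
  apply: le_trans (modulusB _ _) _; rewrite modulusM modulus_real mulrDr mulr1 lerD //.
  rewrite mulrC ler_wpM2r ?modulus_ge0 // distrC gtr0_norm ?subr_gt0 //; lra.
apply: le_trans (modulus_triangle _ (g t) _) _; rewrite modulus_distC.
apply: lerD gb => //; apply: le_trans gst _.
by rewrite ler_pM2l //; lra.
Qed.

(** At a zero the constant path serves; elsewhere [local_flow], which inverts a primitive of
    [1 / f]. Only times from [b0] on matter, for gluing after a trajectory. *)
Lemma local_solution X p (b0 : R) : field_dom X p -> exists (d : R) (u : R -> cplx R),
  [/\ 0 < d, u b0 = chart (chart_at p) p &
    forall t, b0 <= t < b0 + d ->
      [/\ chart_dom (chart_at p) (chart_inv (chart_at p) (u t)),
          chart (chart_at p) (chart_inv (chart_at p) (u t)) = u t,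
          field_dom X (chart_inv (chart_at p) (u t)) &
          pderiv [set t | b0 <= t < b0 + d] u t
            (field_comp X (chart_at p) (chart_inv (chart_at p) (u t)))]].
Proof.
move=> Xp; set i := chart_at p; have ip : chart_dom i p := chart_at_dom p.
have XN : nbhs p (field_dom X).
  by apply: open_nbhs_nbhs; split; [exact: field_dom_open |].
have [r r0 rP] := chart_nbhs ip XN.
have [f0|f0] := eqVneq (field_comp X i p) 0.
  exists 1, (fun=> chart i p); split=> // t _; rewrite (chartK ip) f0.
  by split=> //; exact: pderiv_cst.
have [w|| d [u [d0 u0 uP]]] :=
    @local_flow _ (field_comp X i \o chart_inv i) (chart i p) r r0.
- by move=> /rP[iw ww Xw]; have := field_comp_cderiv Xw iw; rewrite ww.
- by rewrite /= (chartK ip).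
exists d, (fun t => u (t - b0)); split=> //; first by rewrite subrr.
move=> t /andP[bt td].
have [|/rP[iw ww Xw] ut] := uP (t - b0).
  by rewrite ger0_norm ?subr_ge0 //; lra.
split=> // e /ut[r1 r10 r1P]; exists r1 => // s /andP[bs sd] st.
have sE : s - b0 - (t - b0) = s - t by rewrite opprB addrA subrK.
have := r1P (s - b0); rewrite sE; apply=> //=.
by rewrite ger0_norm ?subr_ge0 //; lra.
Qed.

(** Otherwise the trajectory followed by a local solution from [zs] would be a solution whose domain
    contains [b0]. The difficulty is differentiability at the seam. *)
Lemma right_end_singular X a (b0 : R) z zs : maximal_trajectory X a b0%:E z ->
  z t @[t --> b0^'-] --> zs -> ~ field_dom X zs.
Proof.
move=> [solz maxz] limz Xzs.
have [d [u [d0 ub uP]]] := local_solution b0 Xzs.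
set i := chart_at zs in ub uP; have izs : chart_dom i zs := chart_at_dom zs.
pose z' t := if t < b0 then z t else chart_inv i (u t).
have z'b : z' b0 = zs by rewrite /z' ltxx ub (chartK izs).
have [[t0 /andP[at0 t0b]] /within_continuousP cz zP] := solz.
rewrite lte_fin in t0b.
have leftD s : t0 <= s < b0 -> time_domain a b0%:E s.
  move=> /andP[ts sb]; rewrite /time_domain /= lte_fin sb andbT.
  by apply: lt_le_trans at0 _; rewrite lee_fin.
have rightD t : time_domain a (b0 + d)%:E t -> ~ t < b0 -> b0 <= t < b0 + d.
  move=> /andP[_]; rewrite lte_fin => tbd /negP; rewrite -leNgt => ->; exact: tbd.
have leftP t : time_domain a (b0 + d)%:E t -> t < b0 -> time_domain a b0%:E t.
  by move=> /andP[at_ _] tb; rewrite /time_domain /= lte_fin at_ tb.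
have limP (B : set M) : nbhs zs B -> exists2 r : R, 0 < r & forall s, b0 - r < s < b0 -> B (z s).
  by move=> /limz /at_leftP.
have cz' : {within time_domain a (b0 + d)%:E, continuous z'}.
  apply/within_continuousP => t tD B.
  have right : b0 <= t < b0 + d -> nbhs (chart_inv i (u t)) B ->
      exists2 r : R, 0 < r & forall s, b0 <= s < b0 + d -> `|s - t| < r -> B (chart_inv i (u s)).
    move=> tr tB; have [iw ww _ ut] := uP t tr.
    have [r r0 rP] := chart_nbhs iw tB; rewrite ww in rP.
    have [r1 r10 r1P] := pderiv_continuous ut r0.
    by exists r1 => // s sr st; have [] := rP _ (r1P s sr st).
  have [tb|tb|tb] := ltrgtP t b0.
  - rewrite {1}/z' tb => /(cz t (leftP t tD tb))[r r0 rP].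
    exists (Num.min r (b0 - t)); first by rewrite lt_min r0 subr_gt0.
    move=> s sD; rewrite lt_min => /andP[sr st].
    have sb : s < b0 by have := ler_norm (s - t); lra.
    by rewrite /z' sb; exact: rP (leftP s sD sb) sr.
  - have tr : b0 <= t < b0 + d by apply: rightD tD _ => ?; lra.
    rewrite {1}/z' ltNge (ltW tb) => /(right tr)[r r0 rP].
    exists (Num.min r (t - b0)); first by rewrite lt_min r0 subr_gt0.
    move=> s sD; rewrite lt_min => /andP[sr st].
    have sb : ~ s < b0 by have := ler_norm (t - s); rewrite distrC; lra.
    by rewrite /z'; case: ifP => // _; exact: rP (rightD s sD sb) sr.
  - have tr : b0 <= t < b0 + d by apply: rightD tD _ => ?; lra.
    rewrite {1}tb z'b => zB.
    have := right tr; rewrite {1}tb ub (chartK izs) => /(_ zB)[r r0 rP].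
    have [r1 r10 r1P] := limP B zB.
    exists (Num.min r r1); first by rewrite lt_min r0.
    move=> s sD; rewrite lt_min tb => /andP[sr st].
    rewrite /z'; case: ifPn => sb; last by apply: rP; [exact/rightD/negP | rewrite tb].
    by apply: r1P; rewrite sb andbT; have := ler_norm (b0 - s); rewrite distrC; lra.
have solz' : solution X a (b0 + d)%:E z'.
  split=> //.
    exists b0; rewrite /time_domain /= lte_fin ltrDl d0 andbT.
    by apply: lt_trans at0 _; rewrite lte_fin.
  move=> t tD.
  (* One chart at each time suffices; [pderiv_chart_change] carries the derivative to the others. *)
  suff [Xt [j [jt hj]]] : field_dom X (z' t) /\ exists j, chart_dom j (z' t) /\
      pderiv (time_domain a (b0 + d)%:E) (chart j \o z') t (field_comp X j (z' t)).
    split=> // k kt; apply/path_derivP.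
    exact: (pderiv_chart_change cz' tD Xt jt kt hj).
  have [tb|tb] := ltP t b0.
    have tD' := leftP t tD tb; have [Xt _] := zP t tD'.
    have z't : z' t = z t by rewrite /z' tb.
    rewrite z't; split=> //; exists (chart_at (z t)); split; first exact: chart_at_dom.
    move=> e e0; have [r r0 rP] := solution_pderiv solz tD' (chart_at_dom (z t)) e0.
    exists (Num.min r (b0 - t)); first by rewrite lt_min r0 subr_gt0.
    move=> s sD; rewrite lt_min => /andP[sr st].
    have sb : s < b0 by have := ler_norm (s - t); lra.
    by rewrite /= z't /z' sb; exact: rP (leftP s sD sb) sr.
  have tr : b0 <= t < b0 + d by apply: rightD tD _ => ?; lra.
  have [iw ww Xw ut] := uP t tr.
  have z't : z' t = chart_inv i (u t) by rewrite /z' ltNge tb.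
  rewrite z't; split=> //; exists i; split=> // e e0.
  have [r r0 rP] := ut e e0.
  have right s : time_domain a (b0 + d)%:E s -> ~ s < b0 -> `|s - t| < r ->
      modulus (chart i (z' s) - chart i (z' t) -
        field_comp X i (chart_inv i (u t)) * (s - t)%:C) <= e * `|s - t|.
    move=> sD sb sr; have sR := rightD s sD sb.
    have [_ ws _ _] := uP s sR.
    rewrite z't ww /z'; case: ifP => // _; rewrite ws; exact: rP.
  have [bt|] := ltP b0 t.
    exists (Num.min r (t - b0)); first by rewrite lt_min r0 subr_gt0.
    move=> s sD; rewrite lt_min => /andP[sr st]; apply: right => //.
    by have := ler_norm (t - s); rewrite distrC; lra.
  move=> tb'; have {tb tb'} tb : t = b0 by apply/le_anti; rewrite tb tb'.
  have zsE : chart_inv i (u t) = zs by rewrite tb ub (chartK izs).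
  (* At the seam the left derivative is the limit of the earlier derivatives, which are the values
     of the field along the trajectory. *)
  have left e' : 0 < e' -> exists2 r : R, 0 < r & forall s, b0 - r < s < b0 ->
     [/\ time_domain a b0%:E s,
      pderiv (time_domain a b0%:E) (chart i \o z') s (field_comp X i (z s)),
      modulus (field_comp X i (z s) - field_comp X i zs) <= e' &
      modulus ((chart i \o z') s - (chart i \o z') b0) <= e'].
    move=> e'0; have [df fd] := field_comp_cderiv Xzs izs.
    have [r1 r10 r1P] := cderiv_continuous fd e'0.
    have r20 : 0 < Num.min r1 e' by rewrite lt_min r10.
    have [r3 r30 r3P] := limP _ (nbhs_chart izs r20).
    exists (Num.min r3 (b0 - t0)) => [|s]; first by rewrite lt_min r30 subr_gt0.
    rewrite ltrBlDl -ltrBlDr => /andP[+ sb]; rewrite lt_min => /andP[sr st].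
    have [is_ ] := r3P s ltac:(apply/andP; split=> //; lra).
    rewrite lt_min => /andP[sr1 se].
    have sD : time_domain a b0%:E s by apply: leftD; rewrite sb andbT; lra.
    split=> //=.
    - move=> e1 e10; have [r4 r40 r4P] := solution_pderiv solz sD is_ e10.
      exists r4 => // x xD xs; rewrite /= /z' sb; move: (xD) => /andP[_].
      by rewrite lte_fin => ->; exact: r4P.
    - by have := r1P _ sr1; rewrite /= !chartK // => /ltW.
    - by rewrite {1}/z' sb z'b ltW.
  have [r1 r10 r1P] := left_derivative_limit left e0.
  exists (Num.min r r1); first by rewrite lt_min r0.
  move=> s sD; rewrite lt_min => /andP[sr sr1].
  have [sb|] := ltP s b0; last by move=> sb; apply: right => //; rewrite ltNge sb.
  rewrite zsE tb; apply: r1P; rewrite sb andbT.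
  by have := ler_norm (t - s); rewrite distrC; lra.
have sub : time_domain a b0%:E `<=` time_domain a (b0 + d)%:E.
  move=> t /andP[at_ tb]; rewrite /time_domain /= at_ /= lte_fin.
  by rewrite lte_fin in tb; lra.
have agree : {in time_domain a b0%:E, z' =1 z}.
  by move=> t; rewrite inE => /andP[_]; rewrite lte_fin /z' => ->.
have E := maxz _ _ _ solz' sub agree.
have : time_domain a (b0 + d)%:E b0.
  rewrite /time_domain /= lte_fin ltrDl d0 andbT.
  by apply: lt_trans at0 _; rewrite lte_fin.
by rewrite E /time_domain /= ltxx andbF.
Qed.

End Solutions.

(** * Time reversal *)

Section Reversal.
Context {R : realType} {M : riemann_surface R}.
Implicit Types (X Y : vector_field M) (a b : \bar R) (z : R -> M) (zs p : M).

(** Running time backwards turns an initial end for [X] into a final end for this field. It is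
    transparent so that its domain and components compute. *)
Definition opp_field X : vector_field M.
Proof.
apply: (@VectorField R M (field_dom X) (fun i p => - field_comp X i p)).
- exact: field_dom_open.
- by move=> i p Xp ip; exact/derivableN/(field_comp_holomorphic Xp ip).
- by move=> i j p Xp ip jp; rewrite mulrN -(field_comp_change Xp ip jp).
Defined.

Lemma time_domainN a b (t : R) : time_domain (- b)%E (- a)%E t <-> time_domain a b (- t).
Proof.
by rewrite /time_domain /= !EFinN -[(- b < _)%E]lteN2 -[(_ < - a)%E]lteN2 !oppeK andbC.
Qed.

(** Stated for two fields with opposite components, so that it also leads back from [opp_field X] to
    [X]. *)
Lemma solution_reverse X Y a b z :
  field_dom X = field_dom Y -> (forall i p, field_comp Y i p = - field_comp X i p) ->
  solution X a b z -> solution Y (- b)%E (- a)%E (fun t => z (- t)).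
Proof.
move=> domE compE [[t0 t0D] /within_continuousP cz zP]; split.
- by exists (- t0); apply/time_domainN; rewrite opprK.
- apply/within_continuousP => t /time_domainN tD B /(cz _ tD)[r r0 rP].
  exists r => // s /time_domainN sD st; apply: rP => //.
  by rewrite opprK addrC distrC.
move=> t /time_domainN tD; have [Xt _] := zP _ tD; rewrite -domE; split=> // i it.
have solz : solution X a b z by split=> //; [exists t0 | exact/within_continuousP].
apply/path_derivP => e e0; have [r r0 rP] := solution_pderiv solz tD it e0.
exists r => // s /time_domainN sD st; have := rP _ sD.
have -> : - s - - t = - (s - t) by ring.
rewrite normrN => /(_ st) /=.
by rewrite compE rmorphN mulrN mulNr.
Qed.

Lemma maximal_reverse X a b z : maximal_trajectory X a b z ->
  maximal_trajectory (opp_field X) (- b)%E (- a)%E (fun t => z (- t)).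
Proof.
move=> [solz maxz]; split; first exact: solution_reverse solz.
move=> a' b' z' solz' sub agree.
have solz'' : solution X (- b')%E (- a')%E (fun t => z' (- t)).
  by apply: solution_reverse solz' => // i p; rewrite /= opprK.
have -> : time_domain a' b' = [set t | time_domain (- b')%E (- a')%E (- t)].
  by apply/seteqP; split=> t /=; rewrite time_domainN opprK.
rewrite (maxz _ _ _ solz''); first by apply/seteqP; split=> t /time_domainN.
  by move=> t tD; apply/time_domainN/sub/time_domainN; rewrite opprK.
move=> t; rewrite inE => tD; rewrite agree ?opprK // inE.
by apply/time_domainN; rewrite opprK.
Qed.

Lemma left_end_singular X (a0 : R) b z zs : maximal_trajectory X a0%:E b z ->
  z t @[t --> a0^'+] --> zs -> ~ field_dom X zs.
Proof.
move=> /maximal_reverse maxz limz; rewrite -EFinN in maxz.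
apply: (right_end_singular maxz) => B /limz /at_rightP[r r0 rP].
by apply/at_leftP; exists r => // s /andP[? ?]; apply: rP; apply/andP; split; lra.
Qed.

End Reversal.

Section TimeAlongPath.
Context {R : realType}.
Implicit Types (c w : R -> cplx R) (theta : R -> R).

Lemma cvg_withinP (A : set R) c (s : R) : (c u @[u --> within A (nbhs s)] --> c s) <->
  forall e : R, 0 < e -> exists2 r : R, 0 < r & forall u, A u -> `|u - s| < r ->
    modulus (c u - c s) < e.
Proof.
split=> [cs e e0|cs B /nbhs_cplxP[e e0 eB]].
  have : nbhs (c s) [set z | modulus (z - c s) < e] by apply/nbhs_cplxP; exists e.
  by move=> /cs /nbhs_realP[r r0 rP]; exists r => // u Au us; exact: rP.
have [r r0 rP] := cs e e0; rewrite nbhs_filterE; apply/nbhs_realP.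
by exists r => // u us Au; exact/eB/rP.
Qed.

(** Every point of the half line is approached from its right, where the expansion determines its
    coefficient. *)
Lemma half_line_pderiv_unique c (s : R) v v' : half_line s ->
  pderiv half_line c s v -> pderiv half_line c s v' -> v = v'.
Proof.
rewrite /half_line /= => s0 h1 h2; apply/eqP; rewrite -subr_eq0 -modulus_eq0.
rewrite eq_le modulus_ge0 andbT; apply: (@le_of_slope _ _ _ 2) => // e e0.
have [r1 r10 H1] := h1 e e0; have [r2 r20 H2] := h2 e e0.
pose u := s + Num.min r1 r2 / 2.
have m0 : 0 < Num.min r1 r2 by rewrite lt_min r10.
have m1 : Num.min r1 r2 <= r1 by rewrite ge_min lexx.
have m2 : Num.min r1 r2 <= r2 by rewrite ge_min lexx orbT.
have us : u - s = Num.min r1 r2 / 2 by rewrite /u addrAC subrr add0r.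
have us0 : 0 < u - s by rewrite us divr_gt0.
have hu : half_line u by rewrite /half_line /=; lra.
have := H1 u hu; have := H2 u hu; rewrite gtr0_norm // => {}H2 {}H1.
have {}H1 := H1 ltac:(lra); have {}H2 := H2 ltac:(lra).
rewrite add0r -(ler_pM2r us0).
have -> : modulus (v - v') * (u - s) = modulus ((v - v') * (u - s)%:C).
  by rewrite modulusM modulus_real gtr0_norm.
have -> : (v - v') * (u - s)%:C =
    (c u - c s - v' * (u - s)%:C) - (c u - c s - v * (u - s)%:C) by ring.
by apply: le_trans (modulusB _ _) _; lra.
Qed.

Lemma half_line_pderiv_real theta (s : R) v : half_line s ->
  pderiv half_line (fun u => (theta u)%:C) s v -> v = (complex.Re v)%:C.
Proof.
move=> s0 h; apply: (half_line_pderiv_unique s0 h) => e e0.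
have [r r0 rP] := h e e0; exists r => // u hu us.
rewrite -!rmorphB -rmorphM -rmorphB /= modulus_real; apply: le_trans (rP u hu us).
have <- : complex.Re ((theta u)%:C - (theta s)%:C - v * (u - s)%:C) =
    theta u - theta s - complex.Re v * (u - s).
  by case: v {h rP} => x y /=; ring.
exact: Re_le_modulus.
Qed.

(** [w] is real, being the derivative of a real function: its imaginary part integrates to 0 and its
    real part falls under the fundamental theorem of calculus. *)
Lemma half_line_ftc theta w (s : R) :
  (forall u, half_line u -> pderiv half_line (fun u => (theta u)%:C) u (w u)) ->
  (forall u, half_line u -> w x @[x --> within half_line (nbhs u)] --> w u) ->
  half_line s -> cintegral 0 s w = (theta s - theta 0)%:C.
Proof.
move=> hd hc hs; have s0 : 0 <= s by exact: hs.
have wre u : half_line u -> w u = (complex.Re (w u))%:C.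
  by move=> hu; exact: (half_line_pderiv_real hu (hd u hu)).
have inh u : 0 <= u <= s -> half_line u by case/andP.
rewrite /cintegral.
have -> : (\int[@lebesgue_measure R]_(t in `[0, s]) complex.Im (w t))%R = 0.
  rewrite (@eq_Rintegral _ _ _ _ _ (fun=> 0)); first by rewrite /Rintegral integral0.
  by move=> u; rewrite inE /= in_itv /= => /inh /wre ->.
congr (_ +i* _); move: s0; rewrite le_eqVlt => /predU1P[<-|s0].
  by rewrite set_itv1 Rintegral_set1 subrr.
have dtheta u : 0 < u -> is_derive (u : R) (1 : R) theta (complex.Re (w u)).
  move=> u0; have hu : half_line u by exact: ltW.
  apply/real_derivP => e e0; rewrite -(wre u hu).
  have [r r0 rP] := hd u hu e e0.
  exists (Num.min r u); first by rewrite lt_min r0.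
  move=> x _; rewrite lt_min => /andP[xr xu]; apply: rP => //.
  by rewrite /half_line /=; have := ler_norm (u - x); rewrite distrC; lra.
have ctheta u : half_line u -> theta x @[x --> within half_line (nbhs u)] --> theta u.
  move=> hu B /nbhs_realP[e e0 eB]; rewrite nbhs_filterE; apply/nbhs_realP.
  have [r r0 rP] := pderiv_continuous (hd u hu) e0.
  exists r => // x xu hx; apply: eB; have := rP x hx xu.
  by rewrite -rmorphB modulus_real.
rewrite /Rintegral (@continuous_FTC2 _ _ theta) //.
- apply/subspace_continuousP => u; rewrite /= in_itv /= => u0s.
  move=> B /nbhs_realP[e e0 eB]; rewrite nbhs_filterE; apply/nbhs_realP.
  have [r r0 rP] := (cvg_withinP half_line w u).1 (hc u (inh u u0s)) e e0.
  exists r => // x xu; rewrite /= in_itv /= => x0s; apply: eB.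
  apply: le_lt_trans (rP x (inh x x0s) xu).
  by rewrite -ReB Re_le_modulus.
- split.
  + by move=> u; rewrite in_itv /= => /andP[u0 _]; have [] := dtheta u u0.
  + move=> B /(ctheta 0 (lexx 0)) /nbhs_realP[r r0 rP].
    by apply/at_rightP; exists r => // u /andP[u0 ur]; apply: rP;
      rewrite /half_line /= ?ltW // subr0 gtr0_norm //; lra.
  + move=> B /(ctheta s hs) /nbhs_realP[r r0 rP].
    apply/at_leftP; exists (Num.min r s); first by rewrite lt_min r0.
    move=> u; rewrite ltrBlDl -ltrBlDr lt_min => /andP[/andP[ur us] u_s].
    by apply: rP; rewrite /half_line /= ?ltr_norml; [apply/andP; split; lra | lra].
- move=> u; rewrite in_itv /= => /andP[u0 _].
  by rewrite derive1E; have [_ ->] := dtheta u u0.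
Qed.

End TimeAlongPath.

(** * Time along a trajectory *)

Section TrajectoryTime.
Context {R : realType} {M : riemann_surface R} (X : vector_field M).
Context (a b : \bar R) (z alpha : R -> M) (theta : R -> R).
Context (v : chart_index M -> R -> cplx R).
Context (solz : solution X a b z).
Context (theta_continuous : {within half_line, continuous theta}).
Context (alphaE : forall s, half_line s ->
  time_domain a b (theta s) /\ alpha s = z (theta s)).
Context (alpha_c1 : c1_path alpha v).
Context (alpha_zero_free : forall s, half_line s -> ~ zeros X (alpha s)).

Let alpha_dom s : half_line s -> field_dom X (alpha s).
Proof. by move=> /alphaE[tD ->]; have [_ _ /(_ _ tD)[]] := solz. Qed.

(** [theta] is only known to be continuous. The chart displacement is [f dt] to first order along
    [z] and [w du] along [alpha], and [f <> 0] allows solving for [dt]. *)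
Lemma trajectory_time_pderiv (s : R) i : half_line s -> chart_dom i (alpha s) ->
  pderiv half_line (fun u => (theta u)%:C) s (omega X i (alpha s) * v i s).
Proof.
move=> hs is_; have [tD alphas] := alphaE hs.
have f0 := field_comp_neq0 (alpha_dom hs) (alpha_zero_free hs) is_.
rewrite omega_field; last exact: alpha_dom.
have hz : pderiv (time_domain a b) (chart i \o z) (theta s) (field_comp X i (alpha s)).
  by rewrite alphas; apply: solution_pderiv; rewrite -?alphas.
have [/path_derivP ha _] := alpha_c1.2 i s hs is_.
set f := field_comp X i (alpha s) in f0 hz *; set w := v i s in ha *.
pose m := modulus f; have m0 : 0 < m by rewrite modulus_gt0.
pose W := modulus w + 1; have W0 : 0 < W by rewrite ltr_wpDl // modulus_ge0.
move=> e e0.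
(* The bounds [m / 2] and 1 absorb the errors into [|dt| <= (2 W / m) |du|]; with it the other two
   bounds make each error at most [(e m / 2) |du|]. *)
pose e2 := Num.min 1 (e * m / 2).
have e20 : 0 < e2 by rewrite lt_min ltr01 !divr_gt0 // mulr_gt0.
pose e1 := Num.min (m / 2) (e * m / 4 / W * m).
have e10 : 0 < e1.
  by rewrite lt_min divr_gt0 //= mulr_gt0 // divr_gt0 // divr_gt0 // mulr_gt0.
have [r1 r10 r1P] := hz e1 e10; have [r2 r20 r2P] := ha e2 e20.
have rN : nbhs (theta s) [set t | `|t - theta s| < r1] by apply/nbhs_realP; exists r1.
have [r3 r30 r3P] := (within_continuousP _ _).1 theta_continuous s hs _ rN.
exists (Num.min r2 r3); first by rewrite lt_min r20.
move=> u hu; rewrite lt_min => /andP[ur2 ur3].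
have [uD alphau] := alphaE hu.
have H1 := r1P _ uD (r3P u hu ur3); have H2 := r2P u hu ur2.
rewrite /= -alphau -alphas in H1; rewrite /= in H2.
set dc := chart i (alpha u) - chart i (alpha s) in H1 H2.
set dt := theta u - theta s in H1 *; set du := u - s in H2 *.
have du0 : 0 <= `|du| by []. have dt0 : 0 <= `|dt| by [].
have K : modulus (f * dt%:C - w * du%:C) <= e1 * `|dt| + e2 * `|du|.
  have -> : f * dt%:C - w * du%:C = (dc - w * du%:C) - (dc - f * dt%:C) by ring.
  by apply: le_trans (modulusB _ _) _; lra.
have ft : m * `|dt| <= modulus w * `|du| + (e1 * `|dt| + e2 * `|du|).
  have -> : m * `|dt| = modulus (f * dt%:C) by rewrite modulusM modulus_real.
  have -> : f * dt%:C = w * du%:C + (f * dt%:C - w * du%:C) by rewrite addrC subrK.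
  apply: le_trans (modulusD _ _) _; rewrite modulusM modulus_real lerD2l; exact: K.
have e1m : e1 * `|dt| <= m / 2 * `|dt| by rewrite ler_wpM2r // ge_min lexx.
have e21 : e2 * `|du| <= `|du| by rewrite ler_piMl // ge_min lexx.
have dtu : m / 2 * `|dt| <= W * `|du| by rewrite /W mulrDl mul1r; lra.
have e1e : e1 * `|dt| <= e * m / 2 * `|du|.
  apply: (@le_trans _ _ (e * m / 4 / W * m * `|dt|)).
    by rewrite ler_wpM2r // ge_min lexx orbT.
  have -> : e * m / 4 / W * m * `|dt| = (e * m / 2 / W) * (m / 2 * `|dt|) by field; rewrite gt_eqF.
  have -> : e * m / 2 * `|du| = (e * m / 2 / W) * (W * `|du|) by field; rewrite gt_eqF.
  by rewrite ler_wpM2l // divr_ge0 ?divr_ge0 ?mulr_ge0 // ltW.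
have e2e : e2 * `|du| <= e * m / 2 * `|du| by rewrite ler_wpM2r // ge_min lexx orbT.
rewrite -rmorphB /= -/dt.
have -> : dt%:C - f^-1 * w * du%:C = f^-1 * (f * dt%:C - w * du%:C).
  by rewrite mulrBr !mulrA (mulVf f0) mul1r.
rewrite modulusM modulusV mulrC ler_pdivrMr //.
by apply: le_trans K _; rewrite -/m; lra.
Qed.

(** The chart in [omega_along] may jump with the time. Its value does not: in every chart it is the
    derivative of [theta], which is unique, so a fixed chart can be used near [s]. *)
Lemma omega_along_continuous (s : R) : half_line s ->
  omega_along X alpha v u @[u --> within half_line (nbhs s)] --> omega_along X alpha v s.
Proof.
move=> hs; pose i := chart_at (alpha s).
have is_ : chart_dom i (alpha s) := chart_at_dom _.
have Xs := alpha_dom hs.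
have f0 := field_comp_neq0 Xs (alpha_zero_free hs) is_.
pose g u : cplx R := omega X i (alpha u).
have gc : g u @[u --> within half_line (nbhs s)] --> g s.
  apply/cvg_withinP => e e0.
  have [d fd] := field_comp_cderiv Xs is_.
  have f0' : (field_comp X i \o chart_inv i) (chart i (alpha s)) != 0.
    by rewrite /= (chartK is_).
  have [d' fd'] := cderivV f0' fd.
  have [r r0 rP] := cderiv_continuous fd' e0.
  have [r1 r10 r1P] := (within_continuousP _ _).1 alpha_c1.1 s hs _ (nbhs_chart is_ r0).
  exists r1 => // u hu /(r1P u hu)[iu /rP]; rewrite /= (chartK is_) (chartK iu).
  by rewrite /g !omega_field //; exact: alpha_dom.
have [_ vc] := alpha_c1.2 i s hs is_.
have gvc : (fun u => g u * v i u : cplx R) u @[u --> within half_line (nbhs s)]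
    --> (g s * v i s : cplx R).
  exact: cvgM gc vc.
have is_near := open_nbhs_nbhs (conj (chart_dom_open i) is_).
have [r r0 rP] := (within_continuousP _ _).1 alpha_c1.1 s hs _ is_near.
apply/cvg_withinP => e e0.
have [r1 r10 r1P] := (cvg_withinP half_line (fun u => g u * v i u) s).1 gvc e e0.
exists (Num.min r r1); first by rewrite lt_min r0.
move=> u hu; rewrite lt_min => /andP[ur ur1].
suff -> : omega_along X alpha v u = g u * v i u by exact: r1P.
apply: (half_line_pderiv_unique hu (trajectory_time_pderiv hu (chart_at_dom _))).
by apply: trajectory_time_pderiv => //; exact: rP.
Qed.

Lemma trajectory_path_integral (s : R) : half_line s ->
  path_integral X alpha v s = (theta s - theta 0)%:C.
Proof.
apply: half_line_ftc => u hu; last exact: omega_along_continuous.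
exact/trajectory_time_pderiv/chart_at_dom.
Qed.

End TrajectoryTime.

(** * From a finite singular value to a finite end *)

Section Ends.
Context {R : realType} {M : riemann_surface R}.
Implicit Types (X : vector_field M) (theta : R -> R).

(** By the intermediate value theorem all times between [theta s1] and the limit are visited after
    [s1]; this converts the limit of [alpha] into a limit of [z] in its own time. *)
Lemma between_attained theta (s1 e t : R) : {within half_line, continuous theta} ->
  half_line s1 -> theta s @[s --> +oo] --> e ->
  (theta s1 < t < e) \/ (e < t < theta s1) -> exists2 s, s1 <= s & theta s = t.
Proof.
move=> /within_continuousP ctheta hs1 lim bt.
have bt0 : 0 < `|e - t|.
  by rewrite normr_gt0 subr_eq0; apply/eqP => et; case: bt => /andP[]; lra.
have [s2 s12 s2P] : exists2 s2, s1 <= s2 & `|theta s2 - e| < `|e - t|.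
  have : nbhs e [set x | `|x - e| < `|e - t|] by apply/nbhs_realP; exists `|e - t|.
  move=> /lim [S [_ SP]]; exists (Num.max s1 (S + 1)); first by rewrite le_max lexx.
  by apply: SP; rewrite lt_max ltrDl ltr01 orbT.
have cs : {within `[s1, s2], continuous theta}.
  apply/within_continuousP => u; rewrite /= in_itv /= => /andP[u1 u2] B uB.
  have [r r0 rP] := ctheta u (le_trans hs1 u1) B uB.
  exists r => // x; rewrite in_itv /= => /andP[x1 x2]; apply: rP.
  exact: le_trans hs1 x1.
have [|s] := @IVT R theta s1 s2 t s12 cs.
  move: s2P; rewrite ltr_norml ge_min le_max; case: bt => /andP[b1 b2].
    rewrite gtr0_norm ?subr_gt0 // => /andP[c1 c2].
    by rewrite (ltW b1) /=; apply/orP; right; lra.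
  rewrite ltr0_norm ?subr_lt0 // => /andP[c1 c2].
  by rewrite (ltW b2) andbT; apply/orP; right; lra.
by rewrite in_itv /= => /andP[s1s _] <-; exists s.
Qed.

Lemma sphere_cvg (c : R -> cplx R) (a : cplx R) :
  (Some (c s) : sphere R) @[s --> +oo] --> (Some a : sphere R) ->
  forall e : R, 0 < e -> \forall s \near +oo, modulus (c s - a) < e.
Proof.
move=> ca e e0.
have aN : nbhs a [set w | modulus (w - a) < e] by apply/nbhs_cplxP; exists e.
have := ca _ (one_point_compactification_some_nbhs _ _ aN).
rewrite nbhs_filterE /=; apply: filterS => s [w wa [<-]]; exact: wa.
Qed.

Lemma singular_value_trajectory_end X (a : cplx R) alpha zs :
  singular_value X (Some a) alpha zs -> is_trajectory X alpha ->
  exists (c d : \bar R) z,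
    incomplete_trajectory X c d z /\ limit_at_finite_end c d z zs.
Proof.
move=> [v [[ac1 [_ noz] [_ alphazs] _ lim] _]] [c [d [z [theta [maxz ct aE mono]]]]].
have solz := maxz.1.
have nozero s : half_line s -> ~ zeros X (alpha s).
  by move=> hs zs'; apply: (noz s hs); left.
have pint := trajectory_path_integral solz ct aE ac1 nozero.
(* [theta s - theta 0] is the path integral, which tends to [a]. *)
pose e := complex.Re a + theta 0.
have thetae : theta s @[s --> +oo] --> e.
  move=> B /nbhs_realP[r r0 rP]; rewrite nbhs_filterE.
  have [S [Sr SP]] := sphere_cvg lim r0.
  exists (Num.max S 0); split; first exact: num_real.
  move=> s; rewrite gt_max => /andP[sS s0]; apply: rP.
  apply: le_lt_trans (SP s sS).
  rewrite pint; last exact: ltW.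
  apply: le_trans (Re_le_modulus _); rewrite ReB /= /e.
  by rewrite le_eqVlt; apply/orP; left; apply/eqP; congr (`|_|); ring.
have thetaE : (theta s)%:E @[s --> +oo] --> e%:E by apply: cvg_EFin => //; exact: nearW.
have half_real s : 0 < s -> half_line s by exact: ltW.
exists c, d, z.
have near_end B : nbhs zs B -> exists2 S : R, 0 <= S & forall s, S <= s -> B (alpha s).
  move=> /alphazs[S [_ SP]]; exists (Num.max (S + 1) 0); first by rewrite le_max lexx orbT.
  by move=> s; rewrite ge_max => /andP[Ss _]; apply: SP; apply: lt_le_trans Ss; rewrite ltrDl.
have lt0 : half_line (0 : R) by rewrite /half_line /=.
case: mono => [[_ thetad]|[_ thetac]].
  (* The end [d] is the limit of [theta] in the extended reals, so it is the finite time [e]. *)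
  have dE : d = e%:E by exact: (cvg_unique (@ereal_hausdorff R) thetad thetaE).
  subst d; split.
    split=> // TT.
    have : time_domain c e%:E e by rewrite TT.
    by rewrite /time_domain /= ltxx andbF.
  left; exists e => // B /near_end[S S0 SP]; apply/at_leftP.
  have [/andP[_ te] _] := aE S S0; rewrite lte_fin in te.
  exists (e - theta S); first by rewrite subr_gt0.
  move=> t; rewrite subKr => tb.
  have [s Ss <-] := between_attained ct S0 thetae (or_introl tb).
  by have := SP s Ss; rewrite (aE s (le_trans S0 Ss)).2.
have cE : c = e%:E by exact: (cvg_unique (@ereal_hausdorff R) thetac thetaE).
subst c; split.
  split=> // TT.
  have : time_domain e%:E d e by rewrite TT.
  by rewrite /time_domain /= ltxx.
right; exists e => // B /near_end[S S0 SP]; apply/at_rightP.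
have [/andP[te _] _] := aE S S0; rewrite lte_fin in te.
exists (theta S - e); first by rewrite subr_gt0.
move=> t; rewrite addrC subrK => tb.
have [s Ss <-] := between_attained ct S0 thetae (or_intror tb).
by have := SP s Ss; rewrite (aE s (le_trans S0 Ss)).2.
Qed.

End Ends.

(** * Exponential parametrization of a finite time interval *)

Section Approach.
Context {R : realType}.
Implicit Types (e t s : R).

(** Smooth and strictly monotone from [t] towards [e]; one formula covers both [t < e] and
    [e < t]. *)
Definition approach e t s : R := e + (t - e) * expR (- s).

Lemma approach0 e t : approach e t 0 = t.
Proof. by rewrite /approach oppr0 expR0 mulr1 addrCA subrr addr0. Qed.

Lemma pderiv_expRN (A : set R) s :
  pderiv A (fun u => (expR (- u))%:C) s (- expR (- s))%:C.
Proof.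
apply: (@pderiv_sub _ setT) => //.
have dN : pderiv setT (fun u : R => (- u)%:C) s (-1).
  have := pderivZ (-1) (pderiv_real setT s); rewrite mulr1.
  by apply: pderiv_ext ltr01 _ _ => // u _ _; rewrite mulN1r rmorphN.
have dE : pderiv setT (fun u => (expR u)%:C) (- s) (expR (- s))%:C.
  by apply/real_derivP; exact: is_derive_expR.
have := pderiv_reparam (fun _ _ => I) dE dN.
by rewrite mulrN1 -rmorphN.
Qed.

Lemma pderiv_approach (A : set R) e t s :
  pderiv A (fun u => (approach e t u)%:C) s ((e - t) * expR (- s))%:C.
Proof.
have := pderivD (pderiv_cst A e%:C s) (pderivZ (t - e)%:C (pderiv_expRN A s)).
have -> : 0 + (t - e)%:C * (- expR (- s))%:C = ((e - t) * expR (- s))%:C :> cplx R.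
  by rewrite add0r -rmorphM /= mulrN -mulNr opprB.
move=> H d /H[r r0 rP]; exists r => // u Au us.
by have := rP u Au us; rewrite /approach !(rmorphD, rmorphM).
Qed.

Lemma cvg_approach e t : approach e t s @[s --> +oo] --> e.
Proof.
have -> : nbhs e = nbhs (e + (t - e) * 0) by rewrite mulr0 addr0.
by apply: cvgD (cvg_cst e) _; apply: cvgM (cvg_cst (t - e)) (@cvgr_expR R).
Qed.

Lemma near_approach e t (d : R) : 0 < d ->
  \forall s \near +oo, `|approach e t s - e| < d.
Proof.
move=> d0; apply: (@cvg_approach e t [set x | `|x - e| < d]).
by apply/nbhs_realP; exists d.
Qed.

Lemma approach_homo e t s u : t < e -> s < u -> approach e t s < approach e t u.
Proof.
move=> te su; rewrite /approach ltrD2l ltr_nM2l ?subr_lt0 //.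
by rewrite ltr_expR ltrN2.
Qed.

Lemma approach_nhomo e t s u : e < t -> s < u -> approach e t u < approach e t s.
Proof.
move=> te su; rewrite /approach ltrD2l ltr_pM2l ?subr_gt0 //.
by rewrite ltr_expR ltrN2.
Qed.

Lemma approach_lt e t s : t < e -> approach e t s < e.
Proof. by move=> te; rewrite gtrDl nmulr_rlt0 ?subr_lt0 // expR_gt0. Qed.

Lemma approach_gt e t s : e < t -> e < approach e t s.
Proof. by move=> te; rewrite ltrDl mulr_gt0 ?subr_gt0 // expR_gt0. Qed.

Lemma approach_ge e t s : t < e -> half_line s -> t <= approach e t s.
Proof.
rewrite /half_line /= le_eqVlt => te /predU1P[<-|s0]; first by rewrite approach0.
by rewrite -{1}(approach0 e t) ltW // approach_homo.
Qed.

Lemma approach_le e t s : e < t -> half_line s -> approach e t s <= t.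
Proof.
rewrite /half_line /= le_eqVlt => te /predU1P[<-|s0]; first by rewrite approach0.
by rewrite -{2}(approach0 e t) ltW // approach_nhomo.
Qed.

Lemma approach_continuous e t (A : set R) : {within A, continuous (approach e t)}.
Proof.
apply/within_continuousP => s As B /nbhs_realP[d d0 dP].
have [r r0 rP] := pderiv_continuous (pderiv_approach A e t s) d0.
exists r => // u Au us; apply: dP; have := rP u Au us.
by rewrite -rmorphB modulus_real.
Qed.

End Approach.

(** * From a finite end to a singular value *)

Section FiniteEnd.
Context {R : realType} {M : riemann_surface R} (X : vector_field M).
Context (a b : \bar R) (z : R -> M) (t0 e : R) (zs : M).
Context (solz : solution X a b z).
Context (zero_free : forall t, time_domain a b t -> ~ zeros X (z t)).
Context (approach_dom : forall s, half_line s -> time_domain a b (approach e t0 s)).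
Context (t0e : t0 != e) (zs_dom : ~ field_dom X zs).
Context (zs_lim : z (approach e t0 s) @[s --> +oo] --> zs).

Let alpha (s : R) : M := z (approach e t0 s).
Let speed (s : R) : R := (e - t0) * expR (- s).
Let v (i : chart_index M) (s : R) : cplx R := field_comp X i (alpha s) * (speed s)%:C.

Let alpha_dom s : half_line s -> field_dom X (alpha s).
Proof. by move=> /approach_dom tD; have [_ _ /(_ _ tD)[]] := solz. Qed.

Let alpha_zero_free s : half_line s -> ~ zeros X (alpha s).
Proof. by move=> /approach_dom; exact: zero_free. Qed.

Let alpha_continuous : {within half_line, continuous alpha}.
Proof.
have [_ /within_continuousP cz _] := solz.
apply/within_continuousP => s hs B /(cz _ (approach_dom hs))[r r0 rP].
have [r1 r10 r1P] := pderiv_continuous (pderiv_approach half_line e t0 s) r0.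
exists r1 => // u hu us; apply: rP; first exact: approach_dom.
by have := r1P u hu us; rewrite -rmorphB modulus_real.
Qed.

Let alpha_pderiv i s : half_line s -> chart_dom i (alpha s) ->
  pderiv half_line (chart i \o alpha) s (v i s).
Proof.
move=> hs is_; apply: (@pderiv_reparam _ (time_domain a b) _ (chart i \o z)) => //.
  exact: solution_pderiv solz (approach_dom hs) is_.
exact: pderiv_approach.
Qed.

Lemma approach_c1_path : c1_path alpha v.
Proof.
split=> // i s hs is_; split; first exact/path_derivP/alpha_pderiv.
have Xs := alpha_dom hs.
have fc : field_comp X i (alpha u) @[u --> within half_line (nbhs s)] --> field_comp X i (alpha s).
  apply/(cvg_withinP _ (fun u => field_comp X i (alpha u))) => d d0.
  have [f' fd] := field_comp_cderiv Xs is_.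
  have [r r0 rP] := cderiv_continuous fd d0.
  have [r1 r10 r1P] := (within_continuousP _ _).1 alpha_continuous s hs _ (nbhs_chart is_ r0).
  exists r1 => // u hu /(r1P u hu)[iu /rP].
  by rewrite /= (chartK is_) (chartK iu).
have sc : ((speed u)%:C : cplx R) @[u --> within half_line (nbhs s)] --> ((speed s)%:C : cplx R).
  apply/(cvg_withinP _ (fun u => (speed u)%:C)) => d d0.
  have := pderiv_continuous (pderivZ (e - t0)%:C (pderiv_expRN half_line s)) d0.
  by move=> [r r0 rP]; exists r => // u hu us; have := rP u hu us; rewrite -!rmorphM.
exact: cvgM fc sc.
Qed.

(** The component of [X] in the velocity cancels against the 1-form of time and only the real speed
    is left. *)
Lemma approach_omega_along s : half_line s -> omega_along X alpha v s = (speed s)%:C.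
Proof.
move=> hs; rewrite /omega_along omega_field; last exact: alpha_dom.
have f0 := field_comp_neq0 (alpha_dom hs) (alpha_zero_free hs) (chart_at_dom (alpha s)).
by rewrite /v mulrA (mulVf f0) mul1r.
Qed.

Lemma approach_path_integral s : half_line s ->
  path_integral X alpha v s = (approach e t0 s - t0)%:C.
Proof.
move=> hs; rewrite -{2}(approach0 e t0).
apply: (trajectory_path_integral solz _ _ approach_c1_path) => //.
  exact: approach_continuous.
by move=> u hu; split=> //; exact: approach_dom.
Qed.

Let essential_or_pole : essential X zs \/ poles X zs.
Proof.
have [pz|pz] := pselect (poles X zs); [by right | by left => -[]].
Qed.

Lemma approach_asymptotic_path : asymptotic_path X zs (Some (e - t0)%:C) alpha v.
Proof.
have h0 : half_line (0 : R) by rewrite /half_line /=.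
have noz s : half_line s -> ~ (zeros X `|` essential X) (alpha s).
  move=> hs [zs0|es]; first exact: alpha_zero_free hs zs0.
  by apply: es; left; exact: alpha_dom.
split.
- exact: approach_c1_path.
- split=> // -[[z0|p0]|e0].
  + by apply: (noz 0 h0); left.
  + exact: (pole_not_dom p0 (alpha_dom h0)).
  + by apply: (noz 0 h0); right.
- by split=> //; have [ez|pz] := essential_or_pole; [right | left; right].
(* The speed [(e - t0) exp(-s)] has constant sign, so its normalization is this constant. *)
- exists ((e - t0) / `|e - t0|)%:C.
    rewrite -modulus_eq0 modulus_real normr_eq0 mulf_neq0 //.
      by rewrite subr_eq0 eq_sym.
    by rewrite invr_eq0 normr_eq0 subr_eq0 eq_sym.
  apply: cvg_near_cst; exists 0; split=> // s s0.
  have hs : half_line s by exact: ltW.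
  rewrite approach_omega_along // normcE modulus_real -fmorphV -rmorphM /=.
  rewrite /speed normrM (gtr0_norm (expR_gt0 _)); congr (_%:C).
  have E0 : expR (- s) != 0 by rewrite gt_eqF // expR_gt0.
  by rewrite invfM mulrACA divff // mulr1.
have lim : ((approach e t0 s - t0)%:C : cplx R) @[s --> +oo] --> ((e - t0)%:C : cplx R).
  move=> B /nbhs_cplxP[r r0 rP].
  have H := near_approach e t0 r0; rewrite nbhs_filterE /=.
  apply: filterS H => s sr.
  apply: rP; rewrite -rmorphB modulus_real.
  by have -> : approach e t0 s - t0 - (e - t0) = approach e t0 s - e by ring.
have slim : (Some ((approach e t0 s - t0)%:C : cplx R) : sphere R) @[s --> +oo]
    --> (Some ((e - t0)%:C : cplx R) : sphere R).
  by move=> B /(@one_point_compactification_some_continuous _ ((e - t0)%:C : cplx R)) /lim.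
move=> B /slim[S [_ SP]]; exists (Num.max S 0); split; first exact: num_real.
move=> s; rewrite gt_max => /andP[/SP Bs s0].
by rewrite /= approach_path_integral // /half_line /= ltW.
Qed.

(* The constant of the primitive is adjusted so that it agrees with the time
   elapsed along the trajectory. *)
Lemma approach_critical_value : poles X zs ->
  critical_value X zs (Some (e - t0)%:C) alpha v.
Proof.
move=> pzs.
have zzs : ~ zeros X zs by move=> [].
have ezs : ~ essential X zs by apply; right.
have [F [r [r0 FP _]]] := local_primitive zzs ezs.
set i := chart_at zs in FP; have izs : chart_dom i zs := chart_at_dom zs.
have [S [_ SP]] := zs_lim (nbhs_chart izs r0).
pose s1 := Num.max (S + 1) 0.
have hs1 : half_line s1 by rewrite /half_line /= le_max lexx orbT.
have near s : s1 <= s -> [/\ half_line s, chart_dom i (alpha s) &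
    modulus (chart i (alpha s) - chart i zs) < r].
  rewrite ge_max => /andP[Ss s0]; have [] := SP s; first by apply: lt_le_trans Ss; rewrite ltrDl.
  by split.
(* Along the trajectory [F] grows exactly like time, so the difference has derivative 0. *)
have Fc s : s1 <= s -> pderiv half_line (fun u => F (chart i (alpha u)) - (approach e t0 u)%:C) s 0.
  move=> s1s; have [hs is_ sr] := near s s1s.
  have [_ _ _ _ Fd] := FP _ sr; rewrite (chartK is_) in Fd.
  have := pderivB (cderiv_pderiv (alpha_pderiv hs is_) Fd) (pderiv_approach half_line e t0 s).
  suff -> : omega X i (alpha s) * v i s - ((e - t0) * expR (- s))%:C = 0 by [].
  rewrite omega_field; last exact: alpha_dom.
  have f0 := field_comp_neq0 (alpha_dom hs) (alpha_zero_free hs) is_.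
  by rewrite /v mulrA (mulVf f0) mul1r subrr.
pose ka := F (chart i (alpha s1)) - (approach e t0 s1 - t0)%:C.
have FE s : s1 <= s -> F (chart i (alpha s)) - ka = (approach e t0 s - t0)%:C.
  move=> s1s; apply/eqP; rewrite -subr_eq0 -modulus_eq0 eq_le modulus_ge0 andbT.
  have := @mean_value_le _ half_line (fun u => F (chart i (alpha u)) - (approach e t0 u)%:C)
    s1 s 0 s1s; rewrite mul0r => H.
  have -> : F (chart i (alpha s)) - ka - (approach e t0 s - t0)%:C =
      F (chart i (alpha s)) - (approach e t0 s)%:C -
      (F (chart i (alpha s1)) - (approach e t0 s1)%:C).
    by rewrite /ka !rmorphB /=; ring.
  apply: H => u /andP[s1u _]; first exact: le_trans hs1 s1u.
  by exists 0; [exact: Fc | rewrite modulus0].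
pose V : set M := [set q | chart_dom i q /\ modulus (chart i q - chart i zs) < r].
pose g (q : M) : cplx R := F (chart i q) - ka.
have gd q : V q -> cderiv (g \o chart_inv i) (chart i q) (omega X i q).
  move=> [iq qr]; have [_ _ _ _ Fd] := FP _ qr; rewrite (chartK iq) in Fd.
  have := cderivB Fd (cderiv_cst ka (chart i q)); rewrite subr0.
  have r1 : 0 < r - modulus (chart i q - chart i zs) by rewrite subr_gt0.
  apply: cderiv_ext r1 _ => w wr.
  have [|_ ww _ _ _] := FP w; last by rewrite /= /g ww.
  by have := modulus_triangle w (chart i q) (chart i zs); lra.
have Vzs : V zs by split=> //; rewrite subrr modulus0.
have openV : open V.
  rewrite openE => q [iq qr].
  have r1 : 0 < r - modulus (chart i q - chart i zs) by rewrite subr_gt0.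
  apply: filterS (nbhs_chart iq r1) => q' [iq' q'r]; split=> //.
  by have := modulus_triangle (chart i q') (chart i q) (chart i zs); lra.
have V_regular q : V q -> ~ zeros X q /\ ~ essential X q.
  by move=> [iq qr]; have [_ _ + + _] := FP _ qr; rewrite (chartK iq).
pose Psi (q : M) : sphere R := Some (g q).
(* Both [F] along the path and the elapsed time converge: compare them at a late [s] and let the
   error tend to 0. *)
have gzs : g zs = (e - t0)%:C.
  apply/eqP; rewrite -subr_eq0 -modulus_eq0 eq_le modulus_ge0 andbT.
  apply: (@le_of_slope _ _ _ 2) => // d d0; rewrite add0r.
  have [_ _ _ _ Fd] := FP _ Vzs.2.
  have [r1 r10 r1P] := cderiv_continuous Fd d0.
  have [S1 [_ S1P]] := zs_lim (nbhs_chart izs r10).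
  have [S2 [_ S2P]] := near_approach e t0 d0.
  pose s := Num.max s1 (Num.max (S1 + 1) (S2 + 1)).
  have s1s : s1 <= s by rewrite le_max lexx.
  have [_ /r1P F1] : [set q | chart_dom i q /\ modulus (chart i q - chart i zs) < r1] (alpha s).
    by apply: S1P; rewrite !lt_max ltrDl ltr01 /= orbT.
  have A1 : `|approach e t0 s - e| < d by apply: S2P; rewrite !lt_max ltrDl ltr01 /= !orbT.
  have -> : g zs - (e - t0)%:C = (approach e t0 s - e)%:C -
      (F (chart i (alpha s)) - F (chart i zs)).
    have -> : (approach e t0 s - e)%:C = (approach e t0 s - t0)%:C - (e - t0)%:C :> cplx R.
      by rewrite -rmorphB /=; congr (_%:C); ring.
    by rewrite -FE // /g; ring.
  by apply: le_trans (modulusB _ _) _; rewrite modulus_real; lra.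
exists V, Psi; split=> //.
- split=> //.
    by move=> q /V_regular[zq eq] [|[]].
  move=> q Vq; have [iq _] := Vq; have [zq eq] := V_regular q Vq; split=> //.
    have gq : {for q, continuous g}.
      move=> B /nbhs_cplxP[d d0 dP]; rewrite nbhs_filterE.
      have [r1 r10 r1P] := cderiv_continuous (gd q Vq) d0.
      apply: filterS (nbhs_chart iq r10) => q' [iq' /r1P].
      by rewrite /= (chartK iq) (chartK iq') => /dP.
    by move=> B /(@one_point_compactification_some_continuous _ (g q)) /gq.
  move=> _; exists g; split; first by apply: nearW.
  apply/cderivP; apply: (omega_change zq iq (chart_at_dom q)); exact: gd.
- exists s1; split; first exact: num_real.
  move=> s /ltW s1s; have [hs _ _] := near s s1s.
  by rewrite approach_path_integral // -FE.
- by rewrite /Psi gzs.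
- exists g; split; first by apply: nearW.
  (* The derivative of [g] is [omega], which is 0 at a pole; hence the critical point. *)
  by apply/cderivP; have := gd zs Vzs; rewrite omega_pole.

Qed.

Lemma approach_singular_value : singular_value X (Some (e - t0)%:C) alpha zs.
Proof.
exists v; split; first exact: approach_asymptotic_path.
have [ezs|pzs] := essential_or_pole.
  by right; apply: transcendental_at_essential ezs zs_lim.
left; exact: approach_critical_value pzs.
Qed.

End FiniteEnd.

Section IncompleteTrajectories.
Context {R : realType} {M : riemann_surface R} (X : vector_field M).

(** The path starts at an arbitrary time [t0] of the trajectory, so the value is the remaining time
    [e - t0], negative at an initial end. *)
Lemma incomplete_singular_value a b z zs :
  incomplete_trajectory X a b z -> limit_at_finite_end a b z zs ->
  exists (c : cplx R) (alpha : R -> M),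
    singular_value X (Some c) alpha zs /\ is_trajectory X alpha.
Proof.
move=> incz lim; have [maxz _] := incz; have [solz _] := maxz.
have zero_free t := incomplete_zero_free (t := t) incz.
have [[t0 t0D] _ _] := solz.
case: lim => [[e bE limz]|[e aE limz]].
  subst b; have t0e : t0 < e by case/andP: t0D; rewrite lte_fin.
  have appD s : half_line s -> time_domain a e%:E (approach e t0 s).
    move=> hs; case/andP: t0D => at0 _; rewrite /time_domain /= lte_fin approach_lt // andbT.
    by apply: lt_le_trans at0 _; rewrite lee_fin approach_ge.
  have zs_lim : z (approach e t0 s) @[s --> +oo] --> zs.
    move=> B /limz /at_leftP[r r0 rP]; rewrite nbhs_filterE.
    apply: filterS (near_approach e t0 r0) => s.
    rewrite ltr_norml => /andP[sr _]; apply: rP; rewrite approach_lt // andbT.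
    by rewrite ltrBlDr -ltrBlDl; move: sr; lra.
  exists (e - t0)%:C, (fun s => z (approach e t0 s)); split.
    apply: (approach_singular_value solz) => //; first by rewrite lt_eqF.
    exact: right_end_singular maxz limz.
  exists a, e%:E, z, (approach e t0); split=> //.
  - exact: approach_continuous.
  - by move=> s hs; split=> //; exact: appD.
  - left; split; first by move=> s u _ _; exact: approach_homo.
    by apply: cvg_EFin; [exact: nearW | exact: cvg_approach].
subst a; have et0 : e < t0 by case/andP: t0D; rewrite lte_fin.
have appD s : half_line s -> time_domain e%:E b (approach e t0 s).
  move=> hs; case/andP: t0D => _ t0b; rewrite /time_domain /= lte_fin approach_gt //=.
  by apply: le_lt_trans t0b; rewrite lee_fin approach_le.
have zs_lim : z (approach e t0 s) @[s --> +oo] --> zs.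
  move=> B /limz /at_rightP[r r0 rP]; rewrite nbhs_filterE.
  apply: filterS (near_approach e t0 r0) => s.
  rewrite ltr_norml => /andP[_ sr]; apply: rP; rewrite approach_gt //=.
  by move: sr; lra.
exists (e - t0)%:C, (fun s => z (approach e t0 s)); split.
  apply: (approach_singular_value solz) => //; first by rewrite gt_eqF.
  exact: left_end_singular maxz limz.
exists e%:E, b, z, (approach e t0); split=> //.
- exact: approach_continuous.
- by move=> s hs; split=> //; exact: appD.
- right; split; first by move=> s u _ _; exact: approach_nhomo.
  by apply: cvg_EFin; [exact: nearW | exact: cvg_approach].
Qed.

End IncompleteTrajectories.

Theorem theorem7 (R : realType) (M : riemann_surface R)
    (X : singular_vector_field M) (hS : countable (singular_R X)) (zs : M) :
  (exists (a b : \bar R) (z : R -> M),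
     incomplete_trajectory X a b z /\ limit_at_finite_end a b z zs)
  <->
  (exists (a : cplx R) (alpha : R -> M),
     singular_value X (Some a) alpha zs /\ is_trajectory X alpha).
Proof.
split=> [[a [b [z [incz limz]]]]|[a [alpha [sv traj]]]].
  exact: incomplete_singular_value incz limz.
exact: singular_value_trajectory_end sv traj.
Qed.
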